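(* Let $\alpha$ be irrational and let $\mathcal M_\alpha=\{f\in\overline{\mathcal B}\mid\rho(f)=\alpha\}$. Let $\mathcal M_\alpha^{*}$ be the set of those $f\in\mathcal M_\alpha$ that are either circle diffeomorphisms or multicritical circle maps. (1) At each $f_0\in\mathcal M_\alpha^{*}$ the set $\mathcal M_\alpha$ has a tangent subspace in $\overline{\mathcal B}$ in the sense of Fréchet, and this subspace is given by $$v\in T_{f_0}\mathcal M_\alpha\iff\int_{\mathbb R/\mathbb Z}v(f_0^{-1}(x))\,d\mu_{f_0}(x)=0,$$ where $\mu_{f_0}$ is the unique $(-1)$-measure of $f_0$. (2) This tangent space varies continuously with $f_0$ in the weak topology: if $g_n,g\in\mathcal M_\alpha^{*}$ and $g_n\to g$ in $\mathcal D$, then $\tilde\mu_{g_n}\to\tilde\mu_g$ weakly, where for $h\in \mathcal M_\alpha^*$ the probability measure $\tilde\mu_h$ is defined by $\tilde\mu_h(I)=\mu_h(h(I))$, so that $\int v\circ h^{-1}\,d\mu_h=\int v\,d\tilde\mu_h$.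
   Context: $\mathcal D$ is the Banach manifold of $C^3$-smooth orientation-preserving (degree one) maps of $\mathbb R/\mathbb Z$ to itself, with the norm $\|f\|_{C^3}=\sum_{i=0}^{3}\|f^{(i)}\|_\infty$; its tangent space is the Banach space $C^3(\mathbb R/\mathbb Z,\mathbb R)$. $\mathcal B\subset\mathcal D$ is the open subset of circle diffeomorphisms and $\overline{\mathcal B}$ is its closure in $\mathcal D$. The rotation number $\rho(f)=\lim F^n(x)/n \bmod 1$ ($F$ a lift of $f$) is defined for $f\in\overline{\mathcal B}$. Multicritical circle map: an orientation-preserving $C^3$-smooth circle homeomorphism $f$ such that $f'>0$ everywhere except at finitely many points, and on a neighborhood of each of these points $c_n$ one has $f(x)=f(c_n)+\psi_n(x)|\psi_n(x)|^{d_n-1}$, where $\psi_n$ is a $C^3$-smooth diffeomorphism (onto its image) and $d_n$ is a real number. $(-1)$-measure of $f$: a Borel probability measure $\mu$ on $\mathbb R/\mathbb Z$ such that $\int\phi\,d\mu=\int f'(f^{-1}(x))\,\phi(f^{-1}(x))\,d\mu(x)$ for every continuous $\phi$. Every circle diffeomorphism in $\mathcal B$ and every multicritical circle map, with irrational rotation number, has a unique $(-1)$-measure, denoted $\mu_f$. Tangent subspace in the sense of Fréchet: let $V_0=\{v\in C^3(\mathbb R/\mathbb Z,\mathbb R): v(0)=0\}$ and let $f_0\in\mathcal M_\alpha$. For $v\in V_0$ small with $f_0+v\in\overline{\mathcal B}$, there is a unique real number $\tau(v)$ near $0$ with $\rho(f_0+v+\tau(v))=\alpha$; this defines a continuous function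 $\tau$ with $\tau(0)=0$, so that near $f_0$ the set $\mathcal M_\alpha$ is $\{f_0+v+\tau(v)\}$. One says that $\mathcal M_\alpha$ has a tangent subspace at $f_0$ in $\overline{\mathcal B}$ in the sense of Fréchet if there is a bounded linear functional $L$ on $V_0$ such that $\tau(v)=Lv+o(\|v\|_{C^3})$ as $v\to0$ within $\{v\in V_0: f_0+v\in\overline{\mathcal B}\}$, and then the tangent subspace is $T_{f_0}\mathcal M_\alpha=\{v+Lv: v\in V_0\}$ (here $Lv$ is regarded as a constant function). *)

(* Defs.v *)
From HB Require Import structures.
From mathcomp Require Import all_boot all_order all_algebra.
From mathcomp Require Import all_classical all_reals all_analysis.

Set Implicit Arguments.
Unset Strict Implicit.
Unset Printing Implicit Defensive.
Import Order.TTheory GRing.Theory Num.Theory.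
Import numFieldNormedType.Exports.
Local Open Scope ring_scope.
Local Open Scope classical_set_scope.

Section circle.
Variable R : realType.

(* [int_num_subdef] is the predicate underlying the qualifier [Num.int]. *)
Definition integers : zmodClosed R :=
  GRing.ZmodClosed.clone R (@Num.int_num_subdef R) _.

Definition circle : Type :=
  quotient_topology (@Quotient.quot R integers).

HB.instance Definition _ := PointedTopological.on circle.
HB.instance Definition _ := Quotient.on circle.
HB.instance Definition _ := GRing.isZmodule.Build circle
  (@Quotient.addqA R integers)
  (@Quotient.addqC R integers)
  (@Quotient.add0q R integers)
  (@Quotient.addNq R integers).

HB.instance Definition _ := @isMeasurable.Build (sigma_display (@open circle))
  circle <<s @open circle >>
  (@sigma_algebra0 _ setT _) (@sigma_algebraC circle _)
  (@sigma_algebra_bigcup _ setT _).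

Definition circle_proj : R -> circle := \pi_circle%qT.

Lemma circle_projD x y : circle_proj (x + y) = circle_proj x + circle_proj y.
Proof. exact: (@Quotient.pi_add R integers). Qed.

Lemma circle_proj0 : circle_proj 0 = 0.
Proof. by apply: (addrI (circle_proj 0)); rewrite -circle_projD !addr0. Qed.

Lemma circle_projN x : circle_proj (- x) = - circle_proj x.
Proof. exact: (@Quotient.pi_opp R integers). Qed.

Lemma circle_proj_int x : x \is a Num.int -> circle_proj x = 0.
Proof.
move=> xZ; rewrite -circle_proj0.
suff: x = 0 %[mod Quotient.quot integers]%qT by [].
by apply/eqP; rewrite -Quotient.idealrBE subr0.
Qed.

Lemma circle_projD1 x : circle_proj (x + 1) = circle_proj x.
Proof. by rewrite circle_projD (@circle_proj_int 1) ?addr0. Qed.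

Lemma circle_reprK p : circle_proj (repr p) = p.
Proof. exact: reprK. Qed.

End circle.

(* [F^`(n)] is junk where the lower derivatives do not exist, so each of
   them is required to be differentiable in turn. *)
Definition C3_on (R : realType) (U : set R) (F : R -> R) : Prop :=
  forall x, U x ->
    (forall i, (i < 3)%N -> derivable F^`(i) x 1) /\ {for x, continuous F^`(3)}.

Section C3_closure.
Variable R : realType.
Implicit Types F G : R -> R.

Lemma C3_derivable F i x : C3_on setT F -> (i < 3)%N -> derivable F^`(i) x 1.
Proof. by move=> /(_ x I)[+ _]; exact. Qed.

Lemma C3_continuous F i : C3_on setT F -> (i < 4)%N -> continuous F^`(i).
Proof.
move=> F3; rewrite ltnS leq_eqVlt => /predU1P[->|i3] x.
  by have [] := F3 x I.
by apply/differentiable_continuous/derivable1_diffP; exact: C3_derivable.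
Qed.

Lemma C3_deriveP F G (a : R) i : C3_on setT F -> C3_on setT G -> (i < 4)%N ->
  derive1n i (a *: F + G) = a *: derive1n i F + derive1n i G.
Proof.
move=> F3 G3; elim: i => [|i IH] i4; first by rewrite !derive1n0.
rewrite !derive1nS IH; last exact: ltnW.
have dF x : derivable (derive1n i F) x 1 by exact: C3_derivable.
have dG x : derivable (derive1n i G) x 1 by exact: C3_derivable.
apply/funext => x; rewrite derive1E deriveD; [|exact: derivableZ|exact: dG].
rewrite deriveZ; last exact: dF.
by rewrite -!derive1E.
Qed.

Lemma C3_lin F G (a : R) :
  C3_on setT F -> C3_on setT G -> C3_on setT (a *: F + G).
Proof.
move=> F3 G3 x _; split=> [i i3|].
  rewrite C3_deriveP//; last exact: ltnW.
  by apply: derivableD; [apply: derivableZ|]; exact: C3_derivable.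
rewrite C3_deriveP//; apply: continuousD; first apply: continuousZl_tmp.
all: exact: C3_continuous.
Qed.

Lemma C3_cst (c : R) : C3_on setT (cst c).
Proof.
have h i : (cst c : R -> R)^`(i) = if i is 0 then cst c else cst 0.
  elim: i => // i IH; rewrite derive1nS IH; apply/funext => x.
  by case: i {IH} => [|i]; rewrite derive1_cst.
move=> x _; split=> [i _|]; rewrite h; last exact: cst_continuous.
by case: i => [|i]; exact: derivable_cst.
Qed.

Lemma C3_id : C3_on setT (@id R).
Proof.
have h i : (@id R)^`(i.+1) = cst (if i is 0 then 1 else 0).
  elim: i => [|i IH]; apply/funext => x; rewrite derive1nS.
    by rewrite derive1n0 derive1_id.
  by rewrite IH derive1_cst.
move=> x _; split=> [[|i] _|]; rewrite ?h.
- exact: derivable_id.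
- exact: derivable_cst.
- exact: cst_continuous.
Qed.

Lemma periodic_derive1n F i : (forall x, F (x + 1) = F x) ->
  forall x, derive1n i F (x + 1) = derive1n i F x.
Proof.
move=> Fp; elim: i => [|i IH] x; first by rewrite derive1n0.
rewrite !derive1nS /derive1; set a := (X in X @ _); set b := (X in _ = lim (X @ _)).
suff -> : a = b by [].
by rewrite {}/a {}/b; apply/funext => h; rewrite addrA !IH.
Qed.

Lemma periodic_bounded F : continuous F -> (forall x, F (x + 1) = F x) ->
  exists M, forall x, `|F x| <= M.
Proof.
move=> Fc Fp.
have FpZ (m : int) x : F (x + m%:~R) = F x.
  have FpN n y : F (y + n%:R) = F y.
    elim: n => [|n IH]; first by rewrite addr0.
    by rewrite -natr1 addrA Fp.
  case: m => n; first exact: FpN.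
  by rewrite NegzE -(FpN n.+1) mulrNz -addrA addNr addr0.
have nFc : {within `[0, 1], continuous (fun x => `|F x|)}.
  apply: continuous_subspaceT => x; apply: continuous_comp; first exact: Fc.
  exact: norm_continuous.
have [c _ cM] := EVT_max (@ler01 R) nFc.
exists `|F c| => x; rewrite -(FpZ (- Num.floor x)); apply: cM.
rewrite in_itv/= mulrNz subr_ge0 lerBlDr Num.Theory.floor_le //=.
by rewrite addrC; have := ltW (Num.Theory.floorD1_gt x); rewrite intrD.
Qed.

End C3_closure.

Section vector_fields.
Variable R : realType.

Definition C3_pred : {pred circle R -> R} :=
  fun v => `[< C3_on setT (v \o @circle_proj R) >].

Lemma C3_pred_submod : submod_closed C3_pred.
Proof.
split=> [|a u v /asboolP u3 /asboolP v3]; apply/asboolP.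
  exact: (C3_cst 0).
exact: (C3_lin a u3 v3).
Qed.

HB.instance Definition _ :=
  GRing.isSubmodClosed.Build R (circle R -> R) C3_pred C3_pred_submod.

(* The space C^3(R/Z, R); it carries its norm below. *)
Record vfield := VField {
  vfield_val :> circle R -> R ;
  vfield_subproof : vfield_val \in C3_pred }.

HB.instance Definition _ := [isSub for vfield_val].
HB.instance Definition _ := [Choice of vfield by <:].
HB.instance Definition _ := [SubChoice_isSubLmodule of vfield by <:].

Implicit Types v w : vfield.

(* The i-th derivative of v, as a 1-periodic function on R. *)
Definition vderiv i v : R -> R := derive1n i (v \o @circle_proj R).

Lemma vfieldP v : C3_on setT (v \o @circle_proj R).
Proof. by case: v => v /= /asboolP. Qed.

Lemma vderivP (a : R) v w i : (i < 4)%N ->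
  vderiv i (a *: v + w) = a *: vderiv i v + vderiv i w.
Proof. by move=> i4; rewrite -C3_deriveP//; exact: vfieldP. Qed.

Lemma vderiv_bounded v i : (i < 4)%N ->
  has_sup (range (fun x => `|vderiv i v x|)).
Proof.
move=> i4; split; first by exists `|vderiv i v 0|, 0.
have [||M hM] := @periodic_bounded R (vderiv i v).
- by apply: C3_continuous => //; exact: vfieldP.
- by apply: periodic_derive1n => x /=; rewrite circle_projD1.
- by exists M => _ [x _ <-]; exact: hM.
Qed.

Definition sup_norm (F : R -> R) : R := sup (range (fun x => `|F x|)).

Definition C3_norm v : R := \sum_(i < 4) sup_norm (vderiv i v).

Lemma sup_norm_ub v i x : (i < 4)%N -> `|vderiv i v x| <= sup_norm (vderiv i v).
Proof.
move=> i4; have [_ ub] := vderiv_bounded v i4.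
by apply: ub_le_sup => //; exists x.
Qed.

Lemma sup_norm_le v i M : (forall x, `|vderiv i v x| <= M) ->
  sup_norm (vderiv i v) <= M.
Proof.
move=> h; apply: ge_sup; first by exists `|vderiv i v 0|, 0.
by move=> _ [x _ <-]; exact: h.
Qed.

Lemma sup_norm_ge0 v i : (i < 4)%N -> 0 <= sup_norm (vderiv i v).
Proof. by move=> i4; apply: le_trans (sup_norm_ub v 0 i4). Qed.

Lemma C3_normD v w : C3_norm (v + w) <= C3_norm v + C3_norm w.
Proof.
rewrite /C3_norm -big_split /=; apply: ler_sum => i _; apply: sup_norm_le => x.
rewrite -[v]scale1r vderivP// !scale1r.
by apply: (le_trans (ler_normD _ _)); apply: lerD; exact: sup_norm_ub.
Qed.

Lemma vderivZ (a : R) v i : (i < 4)%N -> vderiv i (a *: v) = a *: vderiv i v.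
Proof.
move=> i4; suff v0 : vderiv i 0 = 0 by rewrite -[a *: v]addr0 vderivP// v0 addr0.
apply: (addrI (vderiv i 0)); rewrite addr0 -{1}[vderiv i 0]scale1r -vderivP//.
by rewrite scale1r addr0.
Qed.

Lemma C3_normZ (a : R) v : C3_norm (a *: v) = `|a| * C3_norm v.
Proof.
rewrite /C3_norm mulr_sumr; apply: eq_bigr => i _; rewrite vderivZ//.
apply/eqP; rewrite eq_le; apply/andP; split.
  rewrite -vderivZ//; apply: sup_norm_le => x.
  by rewrite vderivZ// normrM ler_wpM2l//; exact: sup_norm_ub.
have [->|a0] := eqVneq a 0.
  by rewrite normr0 mul0r -vderivZ// sup_norm_ge0.
rewrite -ler_pdivlMl ?normr_gt0//; apply: sup_norm_le => x.
rewrite ler_pdivlMl ?normr_gt0// -normrM.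
have := sup_norm_ub (a *: v) x (ltn_ord i).
by rewrite vderivZ.
Qed.

Lemma C3_norm0_eq0 v : C3_norm v = 0 -> v = 0.
Proof.
move=> /eqP; rewrite psumr_eq0; last by move=> i _; exact: sup_norm_ge0.
move=> /allP/(_ ord0); rewrite mem_index_enum => /(_ isT)/eqP v0.
apply: val_inj; apply/funext => p.
have := @sup_norm_ub v 0 (repr p) isT; rewrite [sup_norm _]v0 normr_le0 => /eqP.
by rewrite /vderiv /= circle_reprK.
Qed.

HB.instance Definition _ :=
  Lmodule_isNormed.Build R vfield C3_normD C3_normZ C3_norm0_eq0.

Lemma vfield_cst_subproof (c : R) : (cst c : circle R -> R) \in C3_pred.
Proof. by apply/asboolP; exact: C3_cst. Qed.

Definition vfield_cst c : vfield := VField (vfield_cst_subproof c).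

End vector_fields.

Section circle_maps.
Variable R : realType.
Notation vfield := (vfield R).

Definition degree1_lift (f : circle R -> circle R) (F : R -> R) : Prop :=
  [/\ forall x, circle_proj (F x) = f (circle_proj x),
      forall x, F (x + 1) = F x + 1 & C3_on setT F].

(* The manifold of C^3 maps of R/Z to itself of degree one; critical points
   and non-injective maps are allowed. *)
Record cmap := CMap {
  cmap_val :> circle R -> circle R ;
  cmap_subproof : `[< exists F, degree1_lift cmap_val F >] }.

HB.instance Definition _ := [isSub for cmap_val].
HB.instance Definition _ := [Choice of cmap by <:].

Implicit Types f g : cmap.

Lemma cmap_id_subproof : `[< exists F, degree1_lift (@id (circle R)) F >].
Proof. by apply/asboolP; exists id; split => //; exact: C3_id. Qed.

HB.instance Definition _ := isPointed.Build cmap (CMap cmap_id_subproof).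

Definition rlift f : R -> R := @xget (R -> R) id (degree1_lift f).

Lemma rliftP f : degree1_lift f (rlift f).
Proof.
by have /asboolP[F hF] := cmap_subproof f; apply: (@xgetPex (R -> R)); exists F.
Qed.

(* The derivative of f; it does not depend on the lift. *)
Definition cderiv f (p : circle R) : R := derive1n 1 (rlift f) (repr p).

Lemma translate_subproof f (v : vfield) :
  `[< exists F, degree1_lift (fun p => f p + circle_proj (v p)) F >].
Proof.
apply/asboolP; exists (rlift f + (v \o @circle_proj R)).
have [F1 F2 F3] := rliftP f; split=> [x|x|].
- by rewrite circle_projD F1.
- by rewrite /= fctE F2 /= circle_projD1 addrAC.
- by have := C3_lin 1 F3 (vfieldP v); rewrite scale1r.
Qed.

(* The map f + v; addition is that of the group R / Z. *)
Definition translate f (v : vfield) : cmap := CMap (translate_subproof f v).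

Lemma translateD f v w : translate (translate f v) w = translate f (v + w).
Proof. by apply/val_inj/funext => p /=; rewrite circle_projD addrA. Qed.

Lemma translate0 f : translate f 0 = f.
Proof. by apply/val_inj/funext => p /=; rewrite circle_proj0 addr0. Qed.

(* The C^3 topology: near f, the manifold is parametrized by v |-> f + v. *)
Definition cmap_ball f (e : R) g : Prop :=
  exists2 v : vfield, `|v| < e & g = translate f v.
Definition cmap_ent : set_system (cmap * cmap) := entourage_ cmap_ball.

HB.instance Definition _ := hasNbhs.Build cmap (nbhs_ cmap_ent).

Lemma cmap_nbhsE : nbhs = nbhs_ cmap_ent. Proof. by []. Qed.

Lemma cmap_ball_center f (e : R) : 0 < e -> cmap_ball f e f.
Proof. by exists 0; rewrite ?normr0 ?translate0. Qed.

Lemma cmap_ball_sym f g (e : R) : cmap_ball f e g -> cmap_ball g e f.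
Proof.
by move=> [v ve ->]; exists (- v); rewrite ?normrN// translateD subrr translate0.
Qed.

Lemma cmap_ball_triangle f g h e1 e2 :
  cmap_ball f e1 g -> cmap_ball g e2 h -> cmap_ball f (e1 + e2) h.
Proof.
move=> [v ve ->] [w we ->]; exists (v + w); last by rewrite translateD.
by apply: le_lt_trans (ler_normD _ _) _; exact: ltrD.
Qed.

HB.instance Definition _ := @Nbhs_isPseudoMetric.Build R cmap
  cmap_ent cmap_nbhsE cmap_ball
  cmap_ball_center cmap_ball_sym cmap_ball_triangle erefl.

End circle_maps.

Section tangent.
Variable R : realType.
Notation vfield := (vfield R).
Notation cmap := (cmap R).
Implicit Types f g : cmap.

Definition circle_diffeo : set cmap :=
  [set f : cmap | exists g : cmap, cancel f g /\ cancel g f].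

Definition circle_homeo (f : circle R -> circle R) : Prop :=
  exists g, [/\ cancel f g, cancel g f, continuous f & continuous g].

(* psi restricts to a C^3 diffeomorphism of U onto its open image. *)
Definition C3_diffeo_on (U : set R) (psi : R -> R) : Prop :=
  C3_on U psi /\
  exists chi : R -> R,
    [/\ open (psi @` U), C3_on (psi @` U) chi & forall x, U x -> chi (psi x) = x].

(* The local normal form at the critical point [circle_proj c] is written in the
   coordinate given by the lift, where both sides are real numbers. *)
Definition multicritical : set cmap := [set f : cmap |
  [/\ circle_homeo f,
      finite_set [set p | ~ 0 < cderiv f p] &
      forall c : R, ~ 0 < cderiv f (circle_proj c) ->
      exists (U : set R) (psi : R -> R) (d : R),
        [/\ open U, U c, C3_diffeo_on U psi &
            forall x, U x ->
              rlift f x = rlift f c + psi x * `|psi x| `^ (d - 1)]]].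

(* Independent of the base point and of the lift; the limit exists for f in the
   closure of [circle_diffeo]. *)
Definition rotation_number f : circle R :=
  circle_proj (limn (fun n => iter n (rlift f) 0 / n%:R)).

Definition Malpha (alpha : R) : set cmap := [set f : cmap |
  closure circle_diffeo f /\ rotation_number f = circle_proj alpha].

Definition Malpha_star (alpha : R) : set cmap :=
  Malpha alpha `&` (circle_diffeo `|` multicritical).

(* [pinv setT f] is the inverse of f when f is bijective. *)
Definition cinv f : circle R -> circle R := pinv setT f.

Definition minus_one_measure f (mu : probability (circle R) R) : Prop :=
  forall phi : circle R -> R, continuous phi ->
    \int[mu]_x phi x = \int[mu]_x (cderiv f (cinv f x) * phi (cinv f x)).

Definition tilde_measure f (mu : set (circle R) -> \bar R) :
    set (circle R) -> \bar R :=
  fun I => mu (f @` I).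

Definition weakly_cvg (m_ : (set (circle R) -> \bar R)^nat)
    (m : set (circle R) -> \bar R) : Prop :=
  forall phi : circle R -> R, continuous phi ->
    (\int[m_ n]_x (phi x)%:E @[n --> \oo] --> \int[m]_x (phi x)%:E)%E.

Definition V0 : set vfield := [set v | v 0 = 0].

Definition admissible f0 : set vfield :=
  [set v | V0 v /\ closure circle_diffeo (translate f0 v)].

(* tau is the function such that, near f0, the set M_alpha is
   {f0 + v + tau v}; it is determined by f0 on a neighborhood of 0. *)
Definition local_graph (alpha : R) f0 (tau : vfield -> R) : Prop :=
  tau 0 = 0 /\
  exists delta eta : R,
    let S := admissible f0 `&` [set v | `|v| < delta] in
    [/\ 0 < delta, 0 < eta, {within S, continuous tau} &
        forall v, S v -> `|tau v| < eta /\
          forall t, `|t| < eta ->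
            rotation_number (translate f0 (v + vfield_cst t))
              = circle_proj alpha <-> t = tau v].

Definition bounded_linear_on_V0 (L : vfield -> R) : Prop :=
  (forall (a : R) v w, V0 v -> V0 w -> L (a *: v + w) = a * L v + L w) /\
  exists C, forall v, V0 v -> `|L v| <= C * `|v|.

Definition frechet_tangent (alpha : R) f0 (T : set vfield) : Prop :=
  exists (tau L : vfield -> R),
    [/\ local_graph alpha f0 tau, bounded_linear_on_V0 L,
        forall e, 0 < e -> \forall v \near within (admissible f0) (nbhs 0),
          `|tau v - L v| <= e * `|v| &
        T = [set v + vfield_cst (L v) | v in V0]].

End tangent.

(* Main.v *)
Require Import Defs.
From HB Require Import structures.
From mathcomp Require Import all_boot all_order all_algebra.
From mathcomp Require Import all_classical all_reals all_analysis.
From mathcomp Require Import ring lra zify.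

Set Implicit Arguments.
Unset Strict Implicit.
Unset Printing Implicit Defensive.
Import Order.TTheory GRing.Theory Num.Theory.
Import numFieldNormedType.Exports.
Local Open Scope ring_scope.
Local Open Scope classical_set_scope.

(** Transported by [f^-1], a (-1)-measure of [f] becomes a state [M] of [C(R/Z)] such that
    [M (xi o F) = M (F' xi)] for every [xi], where [F] is a lift of [f].

    Uniqueness: the distortion of the slopes [(F y - F x) / (y - x)] is controlled by the critical
    points met by [(x, y]]. Along the closest returns of the rotation this gives real bounds,
    which imply that any two such states are comparable, [M <= C M'], with a constant [C] that
    depends only on [f]. Applied to [(M' - M / C) / (1 - 1 / C)] instead of [M'], and iterated,
    the comparison improves to [M = M'].

    Existence: [p u = inf_xi sup (u - xi o F + F' xi)] is sublinear, and [p 0 = 0]: otherwise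
    some [id + s xi] would semiconjugate [F] to a map lying strictly above it, although the
    rotation number is strictly monotone at irrational values. Hahn-Banach gives a functional
    dominated by [p] taking any value of [p], so that uniqueness yields [p = M].

    Hence every [v] is, up to a small error, [M v] plus a coboundary [xi o F - F' xi], with one
    finite-dimensional family of [xi] for all [v] in the unit ball of [C^3]. As [id + xi] then
    semiconjugates [F] to [F + v - M v] up to [o(|v|)], the graph function is [- M v + o(|v|)].
    The same [xi], tested against nearby states, gives the weak continuity of [M]. *)

(** * Sublinear functionals and the Hahn-Banach theorem *)

(** A zero of the derivative rules out two-sided distortion control of iterates. What survives is an
    upper bound for the product of the derivatives at the two ends of an interval. Its exponent is
    additive along orbits, and over arcs that are disjoint mod 1 it sums to at most the total mass
    [V]. The uniqueness argument is therefore built on upper bounds for derivatives of iterates: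
    lower bounds for a state come from the covering of the circle by return arcs, upper bounds from
    their bounded overlap. At a given level a state charges a return arc with a mass inversely
    proportional to its length, up to constants, and the normalization is the same for all states.
    Hahn-Banach is applied on bounded functions, because the measure is recovered from the values at
    indicators of half-lines. At a critical map the small perturbations that stay in the closure of
    the diffeomorphisms need not point in all directions. The tangent functional is pinned down
    along the rays of [K w + v] with [w = id - F + F 0] and [K > |v|]; these rays span [V0]. *)

Section sublinear_functionals.
Context {R : realType} {V : lmodType R}.
Implicit Types p q L : V -> R.

Definition sublinear p :=
  (forall u v, p (u + v) <= p u + p v) /\
  (forall a u, 0 <= a -> p (a *: u) = a * p u).

(** The reverse inequality in the homogeneity is the assumed one for [a^-1], applied at [a *: u]. *)
Lemma sublinear_intro p : (forall u v, p (u + v) <= p u + p v) -> p 0 = 0 ->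
  (forall a u, 0 < a -> p (a *: u) <= a * p u) -> sublinear p.
Proof.
move=> pD p0 pZ; split=> // a u; rewrite le_eqVlt => /predU1P[<-|a0].
  by rewrite scale0r mul0r.
apply/eqP; rewrite eq_le pZ//= -ler_pdivlMl// (le_trans _ (pZ _ _ _)) ?invr_gt0//.
by rewrite scalerA mulVf ?scale1r ?gt_eqF.
Qed.

Lemma sublinear0 p : sublinear p -> p 0 = 0.
Proof. by move=> [_ pZ]; rewrite -(scale0r 0) pZ// mul0r. Qed.

Lemma sublinearN p u : sublinear p -> - p (- u) <= p u.
Proof.
move=> sp; have := sp.1 u (- u).
by rewrite subrr (sublinear0 sp); lra.
Qed.

Lemma linear_functional0 L : (forall a u v, L (a *: u + v) = a * L u + L v) -> L 0 = 0.
Proof.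
move=> Llin; have := Llin 1 0 0; rewrite scale1r addr0 mul1r => h.
by apply: (addrI (L 0)); rewrite -h addr0.
Qed.

(** Zorn's lemma for the reversed pointwise order. A chain is bounded by its pointwise infimum,
    which is finite because a sublinear [s <= p] satisfies [s u >= - s (- u) >= - p (- u)]. *)
Lemma minimal_sublinear p : sublinear p -> exists q,
  [/\ sublinear q, (forall u, q u <= p u) &
      forall q', sublinear q' -> (forall u, q' u <= q u) -> q' = q].
Proof.
move=> sp; pose T := {q : V -> R | sublinear q /\ forall u, q u <= p u}.
pose r (s t : T) := `[< forall u, sval t u <= sval s u >].
have [||||t tmin] := @Zorn T r.
- by move=> t; apply/asboolP.
- move=> s t w /asboolP st /asboolP tw; apply/asboolP => u.
  exact: le_trans (tw u) (st u).
- move=> [s ps] [t pt] /asboolP /= st /asboolP /= ts.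
  have ? : s = t by apply/funext => u; apply/eqP; rewrite eq_le st ts.
  by subst s; rewrite (Prop_irrelevance ps pt).
- move=> A Atot; have [[t0 At0]|A0] := pselect (A !=set0); last first.
    by exists (exist _ p (conj sp (fun=> lexx _))) => s As; case: A0; exists s.
  pose E u := [set sval s u | s in A].
  have Elb u : lbound (E u) (- p (- u)).
    move=> _ [[s [s1 s2]] As <-] /=.
    by apply: le_trans (sublinearN u s1); rewrite lerN2.
  have hE u : has_inf (E u).
    by split; [exists (sval t0 u), t0|exists (- p (- u))].
  have Ele u s : A s -> inf (E u) <= sval s u.
    by move=> As; apply: ge_inf; [exact: (hE u).2|exists s].
  have sq : sublinear (fun u => inf (E u)).
    apply: sublinear_intro => [u v||a u a0].
    + rewrite -lerBlDl; apply: lb_le_inf; first exact: (hE v).1.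
      move=> _ [s2 As2 <-]; rewrite lerBlDl -lerBlDr.
      apply: lb_le_inf; first exact: (hE u).1.
      move=> _ [s1 As1 <-]; rewrite lerBlDr.
      (* Of two members of the chain, the smaller one serves for both arguments. *)
      have [/asboolP s12|/asboolP s21] := Atot _ _ As1 As2.
        apply: le_trans (Ele _ _ As2) _.
        apply: le_trans ((svalP s2).1.1 u v) _.
        by rewrite lerD2r.
      apply: le_trans (Ele _ _ As1) _.
      apply: le_trans ((svalP s1).1.1 u v) _.
      by rewrite lerD2l.
    + rewrite (_ : E 0 = [set 0]) ?inf1//; apply/seteqP; split=> [_ [s As <-]|_ ->] /=.
        exact: sublinear0 (svalP s).1.
      by exists t0 => //; exact: sublinear0 (svalP t0).1.
    + rewrite -ler_pdivrMl//; apply: lb_le_inf; first exact: (hE u).1.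
      move=> _ [s As <-]; rewrite ler_pdivrMl//.
      by rewrite -((svalP s).1.2 _ _ (ltW a0)); exact: Ele.
  have qp u : inf (E u) <= p u.
    by apply: le_trans (Ele _ _ At0) _; exact: (svalP t0).2.
  exists (exist (fun q => sublinear q /\ forall u, q u <= p u) _ (conj sq qp)) => s As; apply/asboolP => u /=.
  exact: Ele.
- exists (sval t); split; [exact: (svalP t).1|exact: (svalP t).2|].
  move=> q' sq' q't.
  have q'p u : q' u <= p u by apply: le_trans (q't u) ((svalP t).2 u).
  by have /(congr1 sval)/= := tmin (exist (fun q => sublinear q /\ forall u, q u <= p u) q' (conj sq' q'p)) (asboolT q't).
Qed.

(* The sublinear functional which forces equality at [v] in Hahn-Banach. *)
Definition sublinear_shift p v u := inf [set p (u + t *: v) - t * p v | t in [set t | 0 <= t]].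

(** The infimum is finite: [t * p v = p (t *: v) <= p (u + t *: v) + p (- u)] bounds the set below
    by [- p (- u)]. *)
Lemma sublinear_shift_le p v u t : sublinear p -> 0 <= t ->
  sublinear_shift p v u <= p (u + t *: v) - t * p v.
Proof.
move=> sp t0; apply: ge_inf; last by exists t.
exists (- p (- u)) => _ [s /= s0 <-].
rewrite -(sp.2 _ _ s0).
have := sp.1 (u + s *: v) (- u).
by rewrite addrAC subrr add0r; lra.
Qed.

Lemma sublinear_shift_sublinear p v : sublinear p -> sublinear (sublinear_shift p v).
Proof.
move=> sp.
have ne u : [set p (u + t *: v) - t * p v | t in [set t | 0 <= t]] !=set0.
  by exists (p (u + 0 *: v) - 0 * p v), 0 => /=.
apply: sublinear_intro => [u w||a u a0].
- rewrite -lerBlDl; apply: lb_le_inf; first exact: ne.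
  move=> _ [t /= t0 <-]; rewrite lerBlDl -lerBlDr.
  apply: lb_le_inf; first exact: ne.
  move=> _ [s /= s0 <-]; rewrite lerBlDr.
  apply: le_trans (sublinear_shift_le _ _ sp (addr_ge0 s0 t0)) _.
  rewrite scalerDl addrACA.
  have := sp.1 (u + s *: v) (w + t *: v); lra.
- apply/eqP; rewrite eq_le; apply/andP; split.
    apply: le_trans (sublinear_shift_le _ _ sp (lexx 0)) _.
    by rewrite scale0r addr0 mul0r subr0 (sublinear0 sp).
  apply: lb_le_inf; first exact: ne.
  by move=> _ [s /= s0 <-]; rewrite add0r sp.2// subrr.
- rewrite -ler_pdivrMl//; apply: lb_le_inf; first exact: ne.
  move=> _ [s /= s0 <-]; rewrite ler_pdivrMl//.
  apply: le_trans (sublinear_shift_le _ _ sp (mulr_ge0 (ltW a0) s0)) _.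
  by rewrite -scalerA -scalerDr sp.2 ?(ltW a0)// mulrBr mulrA.
Qed.

(** Taking [t = 0] shows that the shift of [q] lies below [q], so minimality makes them equal. Then
    [t = 1] gives [q u <= q (u + v) - q v], the missing half of additivity. *)
Lemma minimal_sublinear_linear q : sublinear q ->
  (forall q', sublinear q' -> (forall u, q' u <= q u) -> q' = q) ->
  forall a u v, q (a *: u + v) = a * q u + q v.
Proof.
move=> sq qmin.
have sh v : sublinear_shift q v = q.
  apply: qmin; first exact: sublinear_shift_sublinear.
  move=> u; apply: le_trans (sublinear_shift_le _ _ sq (lexx 0)) _.
  by rewrite scale0r addr0 mul0r subr0.
have qD u v : q (u + v) = q u + q v.
  apply/eqP; rewrite eq_le sq.1/= -lerBrDr -{1}(sh v).
  by have := sublinear_shift_le v u sq ler01; rewrite scale1r mul1r.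
have qN u : q (- u) = - q u.
  by apply/eqP; rewrite -addr_eq0 -qD addNr (sublinear0 sq).
move=> a u v; rewrite qD; congr (_ + _).
have [a0|a0] := leP 0 a; first exact: sq.2.
rewrite -[a *: u]opprK qN -scaleNr sq.2; last by rewrite oppr_ge0 ltW.
by rewrite mulNr opprK.
Qed.

(** A minimal sublinear functional is taken below the shift of [p] along [v], not just below [p]: at
    [- v] with [t = 1] the shift is at most [- p v], which forces [L v >= p v]. *)
Theorem Hahn_Banach p v : sublinear p -> exists L : V -> R,
  [/\ (forall a u w, L (a *: u + w) = a * L u + L w),
      (forall u, L u <= p u) & L v = p v].
Proof.
move=> sp.
have [L [sL Lle Lmin]] := minimal_sublinear (sublinear_shift_sublinear v sp).
have Llin := minimal_sublinear_linear sL Lmin.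
have Lp u : L u <= p u.
  apply: le_trans (Lle u) (le_trans (sublinear_shift_le _ _ sp (lexx 0)) _).
  by rewrite scale0r addr0 mul0r subr0.
exists L; split=> //; apply/eqP; rewrite eq_le Lp/=.
have := le_trans (Lle (- v)) (sublinear_shift_le _ _ sp ler01).
rewrite scale1r mul1r addNr (sublinear0 sp) -[- v]addr0 -scaleN1r Llin.
by rewrite (sublinear0 sL); lra.
Qed.

End sublinear_functionals.

(** * Closest returns of an irrational rotation *)

Section return_times.
Context {R : realType}.
Implicit Types (a e x y : R) (m p : int).

Lemma le0_archimedean (u C : R) : (forall n : nat, n%:R * u <= C) -> u <= 0.
Proof.
move=> h; rewrite leNgt; apply/negP => u0.
have := h (Num.bound `|C / u|); apply/negP; rewrite -ltNge -ltr_pdivrMr//.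
by apply: le_lt_trans (ler_norm _) _; exact: archi_boundP.
Qed.

Lemma irrational_mul a n m : irrational a -> (0 < n)%N -> n%:R * a != m%:~R.
Proof.
move=> ia n0; apply/eqP => h; apply: ia; rewrite /rational /=.
exists (m%:~R / n%:R)%R => //.
rewrite fmorph_div/= rmorph_int rmorph_nat -h mulrAC divff ?mul1r//.
by rewrite pnatr_eq0 -lt0n.
Qed.

Lemma irrationalN a : irrational a -> irrational (- a).
Proof.
move=> ia [q _ qa]; apply: ia; exists (- q) => //.
by rewrite rmorphN/= qa opprK.
Qed.

Lemma irrationalDint a m : irrational a -> irrational (a + m%:~R).
Proof.
move=> ia [q _ qa]; apply: ia; exists (q - m%:~R) => //.
by rewrite rmorphB/= qa rmorph_int addrK.
Qed.

Lemma int_small_eq0 m : `|m%:~R : R| < 1 -> m = 0.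
Proof. by rewrite -intr_norm -[1]/(1%:~R) ltr_int; lia. Qed.

(** Pigeonhole: two of the fractional parts of [i * a], [i < N + 2], fall into the same of [N + 1]
    boxes of length [(N + 1)^-1]. *)
Lemma dirichlet a e : 0 < e ->
  exists j m, (0 < j)%N /\ `|j%:R * a - m%:~R| < e.
Proof.
move=> e0; have [N Ne] : exists N : nat, e^-1 < N.+1%:R.
  exists (Num.bound e^-1); apply: lt_le_trans (archi_boundP _) _.
    by rewrite invr_ge0 ltW.
  by rewrite ler_nat.
have N0 : 0 < N.+1%:R :> R by rewrite ltr0n.
pose fr (i : nat) := i%:R * a - (Num.floor (i%:R * a))%:~R.
have fr0 i : 0 <= fr i by rewrite subr_ge0 floor_le_tmp.
have fr1 i : fr i < 1.
  by rewrite ltrBlDl; have := floorD1_gt (i%:R * a); rewrite intrD.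
have box i : exists k : 'I_N.+1, k%:R <= N.+1%:R * fr i < k%:R + 1.
  have := truncn_itv (mulr_ge0 (ltW N0) (fr0 i)).
  set k := Num.truncn _ => /andP[k1 k2].
  have kN : (k < N.+1)%N.
    rewrite -(ltr_nat R); apply: le_lt_trans k1 _.
    by rewrite gtr_pMr.
  by exists (Ordinal kN); rewrite /= k1/= natr1.
have [f fP] := choice box.
have : ~~ injectiveb [ffun i : 'I_N.+2 => f i].
  apply/negP => /injectiveP/leq_card.
  by rewrite !card_ord ltnn.
move=> /injectivePn[i1 [i2 i12]]; rewrite !ffunE => f12.
wlog lt12 : i1 i2 i12 f12 / (i1 < i2)%N.
  move=> W; have [h|h|h] := ltngtP i1 i2; first exact: (W i1 i2).
    by apply: (W i2 i1) => //; rewrite eq_sym.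
  by rewrite (ord_inj h) eqxx in i12.
exists (i2 - i1)%N, (Num.floor (i2%:R * a) - Num.floor (i1%:R * a)).
rewrite subn_gt0; split=> //.
have -> : (i2 - i1)%:R * a - (Num.floor (i2%:R * a) - Num.floor (i1%:R * a))%:~R
    = fr i2 - fr i1.
  by rewrite natrB ?(ltnW lt12)// intrB /fr; ring.
have /andP[h1 h2] := fP i1; have /andP[h3 h4] := fP i2.
rewrite f12 in h1 h2.
have : N.+1%:R * `|fr i2 - fr i1| < 1.
  rewrite -[X in X * _]ger0_norm ?ltW// -normrM ltr_norml; apply/andP; split; lra.
rewrite -ltr_pdivlMl// mulr1 => /lt_trans; apply.
by rewrite invf_plt.
Qed.

Lemma closest_return a e : 0 < e -> exists q p,
  [/\ (0 < q)%N, `|q%:R * a - p%:~R| < e &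
      forall j m, (0 < j < q)%N -> e <= `|j%:R * a - m%:~R|].
Proof.
move=> e0; pose P j := `[< (0 < j)%N /\ exists m, `|j%:R * a - m%:~R| < e >].
have exP : exists j, P j.
  by have [j [m [j0 jm]]] := dirichlet a e0; exists j; apply/asboolP; split=> //; exists m.
case: (ex_minnP exP) => q /asboolP[q0 [p qp]] qmin.
exists q, p; split=> // j m /andP[j0 jq]; rewrite leNgt; apply/negP => jm.
suff : (q <= j)%N by rewrite leqNgt jq.
by apply: qmin; apply/asboolP; split=> //; exists m.
Qed.

(** The errors of consecutive closest returns have opposite signs: otherwise the error of [Q - q],
    which is their difference, would be smaller than that of [q], against the minimality of [Q]. *)
Lemma next_return a e q p : irrational a -> e <= 2^-1 -> (0 < q)%N ->
  `|q%:R * a - p%:~R| < e ->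
  (forall j m, (0 < j < q)%N -> e <= `|j%:R * a - m%:~R|) ->
  exists Q P, [/\ (q < Q)%N, `|Q%:R * a - P%:~R| < `|q%:R * a - p%:~R|,
    (forall j m, (0 < j < Q)%N -> `|q%:R * a - p%:~R| <= `|j%:R * a - m%:~R|) &
    (0 < q%:R * a - p%:~R) = (Q%:R * a - P%:~R < 0)].
Proof.
move=> ia e2 q0 qe qmin.
have d0 : 0 < `|q%:R * a - p%:~R|.
  by rewrite normr_gt0 subr_eq0 irrational_mul.
have [Q [P [Q0 Qd Qmin]]] := closest_return a d0.
have qQ : (q < Q)%N.
  rewrite ltnNge; apply/negP; rewrite leq_eqVlt => /predU1P[Qq|Qq].
    move: Qd; rewrite Qq => Qd.
    (* Both errors are below [1 / 2], so [q = Q] would force the same integer part and hence equal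
       errors. *)
    have : p - P = 0.
      apply: int_small_eq0; rewrite intrB.
      have -> : p%:~R - P%:~R = (q%:R * a - P%:~R) - (q%:R * a - p%:~R) by ring.
      by apply: le_lt_trans (ler_normB _ _) _; lra.
    by move/eqP; rewrite subr_eq0 => /eqP pP; rewrite pP ltxx in Qd.
  by have := qmin Q P; rewrite Q0 Qq => /(_ isT); lra.
exists Q, P; split=> //.
have e0 : Q%:R * a - P%:~R != 0 by rewrite subr_eq0 irrational_mul.
have d0' : q%:R * a - p%:~R != 0 by rewrite subr_eq0 irrational_mul.
have : `|q%:R * a - p%:~R| <= `|(Q - q)%:R * a - (P - p)%:~R|.
  by apply: Qmin; rewrite subn_gt0 qQ/=; lia.
rewrite natrB ?(ltnW qQ)// intrB.
have -> : (Q%:R - q%:R) * a - (P%:~R - p%:~R) =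
  (Q%:R * a - P%:~R) - (q%:R * a - p%:~R) by ring.
move: Qd e0 d0'; set u := Q%:R * a - _; set v := q%:R * a - _.
move=> uv u0 v0 h.
have [v1|v1|v1] := ltgtP 0 v; last by rewrite -v1 eqxx in v0.
- rewrite (gtr0_norm v1) in uv h.
  have [u1|u1|u1] := ltgtP u 0 => //; last by rewrite u1 eqxx in u0.
  by rewrite gtr0_norm// in uv; rewrite ltr0_norm in h; lra.
- rewrite (ltr0_norm v1) in uv h.
  have [u1|u1|u1] := ltgtP u 0 => //.
  by rewrite ltr0_norm// in uv; rewrite gtr0_norm in h; lra.
Qed.

(* Consecutive closest returns [q < Q] of the rotation by [a], with [q] on the
   right and [Q] on the left of the starting point. *)
Definition return_pair a (q : nat) p (Q : nat) P :=
  [/\ (0 < q < Q)%N, 0 < q%:R * a - p%:~R,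
      forall j m, (0 < j < Q)%N -> q%:R * a - p%:~R <= `|j%:R * a - m%:~R| &
      0 < P%:~R - Q%:R * a < q%:R * a - p%:~R].

(** If the first closest return found lies on the left, the next one lies on the right, and the pair
    starts there. *)
Lemma exists_return_pair a e : irrational a -> 0 < e ->
  exists q p Q P, return_pair a q p Q P /\ q%:R * a - p%:~R < e.
Proof.
move=> ia e0.
have e1 : 0 < Num.min e 2^-1 by rewrite lt_min e0 invr_gt0 ltr0n.
have e2 : Num.min e 2^-1 <= 2^-1 by rewrite ge_min lexx orbT.
have ee : Num.min e 2^-1 <= e by rewrite ge_min lexx.
have [q [p [q0 qe qmin]]] := closest_return a e1.
have [Q [P [qQ Qd Qmin sgn]]] := next_return ia e2 q0 qe qmin.
have q0' : q%:R * a - p%:~R != 0 by rewrite subr_eq0 irrational_mul.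
have Q0 : (0 < Q)%N by apply: leq_trans qQ.
have Q0' : Q%:R * a - P%:~R != 0 by rewrite subr_eq0 irrational_mul.
have [v1|v1|v1] := ltgtP 0 (q%:R * a - p%:~R); last by rewrite -v1 eqxx in q0'.
  exists q, p, Q, P; split.
    rewrite v1 in sgn; have u1 := esym sgn.
    rewrite (gtr0_norm v1) (ltr0_norm u1) in Qd.
    split=> //; first by rewrite q0.
    - by move=> j m jQ; have := Qmin j m jQ; rewrite gtr0_norm.
    - by apply/andP; split; lra.
  by rewrite gtr0_norm// in qe; lra.
have u1 : 0 < Q%:R * a - P%:~R.
  by rewrite lt0r Q0' leNgt -sgn -leNgt ltW.
have f2 : `|q%:R * a - p%:~R| <= 2^-1 by lra.
have [Q' [P' [qQ' Qd' Qmin' sgn']]] := next_return ia f2 Q0 Qd Qmin.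
exists Q, P, Q', P'; split.
  rewrite u1 in sgn'; have w1 := esym sgn'.
  rewrite (gtr0_norm u1) (ltr0_norm w1) in Qd'.
  split=> //; first by rewrite Q0.
  - by move=> j m jQ; have := Qmin' j m jQ; rewrite gtr0_norm.
  - by apply/andP; split; lra.
rewrite gtr0_norm// in Qd; lra.
Qed.

(** Serves to force late returns: a return with error below [e] has a time beyond [N]. *)
Lemma irrational_away a (N : nat) : irrational a ->
  exists2 e, 0 < e & forall j m, (0 < j <= N)%N -> e <= `|j%:R * a - m%:~R|.
Proof.
move=> ia; elim: N => [|N [e e0 eN]]; first by exists 1 => // j m; case: j.
set v := N.+1%:R * a; set f := Num.floor v.
have f1 : f%:~R < v by rewrite lt_neqAle floor_le_tmp andbT eq_sym irrational_mul.
have f2 : v < f%:~R + 1 by have := floorD1_gt v; rewrite intrD.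
exists (Num.min e (Num.min (v - f%:~R) (f%:~R + 1 - v))).
  by rewrite !lt_min e0 !subr_gt0 f1.
move=> j m /andP[j0]; rewrite leq_eqVlt => /predU1P[->|jN]; last first.
  by rewrite ge_min eN// j0.
rewrite ge_min; apply/orP; right; rewrite -/v ge_min.
have [mf|fm] := leP m f; apply/orP; [left|right].
  have : m%:~R <= f%:~R :> R by rewrite ler_int.
  by move=> ?; rewrite ger0_norm; lra.
have : f%:~R + 1 <= m%:~R :> R by rewrite -[1]/(1%:~R) -intrD ler_int; lia.
by move=> ?; rewrite ltr0_norm; lra.
Qed.

End return_times.

(** * Translation numbers *)

Section translation_number.
Context {R : realType}.
Implicit Types (F G H Th : R -> R) (a b x y : R) (m p : int).

Definition degree1 G := forall x, G (x + 1) = G x + 1.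

Definition monotone_lift G := degree1 G /\ {homo G : x y / x <= y}.

(** The iterates of a monotone lift stay within 1 of the translation by [n * a], for the translation
    number [a]. This uniform bound determines [a] without passing to a limit. *)
Definition tn G a := forall (n : nat) x, `|iter n G x - x - n%:R * a| <= 1.

Lemma periodic_int (f : R -> R) (V : R) : (forall x, f (x + 1) = f x + V) ->
  forall x m, f (x + m%:~R) = f x + m%:~R * V.
Proof.
move=> fV; have fn (n : nat) x : f (x + n%:R) = f x + n%:R * V.
  elim: n => [|n IH]; first by rewrite addr0 mul0r addr0.
  by rewrite -natr1 addrA fV IH mulrDl mul1r addrA.
move=> x [n|n]; first exact: fn.
rewrite NegzE mulrNz; set k : R := n.+1%:~R.
have := fn n.+1 (x - k); rewrite subrK => ->.
by rewrite mulNr addrK.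
Qed.

Lemma degree1_int G x m : degree1 G -> G (x + m%:~R) = G x + m%:~R.
Proof. by move=> /periodic_int ->; rewrite mulr1. Qed.

Lemma monotone_lift_iter G n : monotone_lift G -> monotone_lift (iter n G).
Proof.
move=> [G1 Gh]; elim: n => [|n [IH1 IH2]]; first by split.
split=> [x|x y xy] /=; first by rewrite IH1 G1.
exact/Gh/IH2.
Qed.

Lemma iter_degree1_int G n x m : degree1 G ->
  iter n G (x + m%:~R) = iter n G x + m%:~R.
Proof. by move=> G1; elim: n => //= n ->; rewrite degree1_int. Qed.

Lemma floor_shift x y : exists m : int, x <= y + m%:~R < x + 1.
Proof.
exists (- Num.floor (y - x)); rewrite mulrNz.
have h1 := floor_le_tmp (y - x); have h2 := floorD1_gt (y - x).
by rewrite intrD in h2; apply/andP; split; lra.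
Qed.

Lemma monotone_lift_osc G x y : monotone_lift G ->
  `|(G x - x) - (G y - y)| <= 1.
Proof.
move=> [G1 Gh]; have [m /andP[m1 m2]] := floor_shift x y.
have := Gh _ _ m1; have := Gh _ _ (ltW m2).
by rewrite G1 degree1_int// ler_norml => *; apply/andP; split; lra.
Qed.

Lemma iter_le_mul G (k n : nat) x c : monotone_lift G ->
  (forall y, iter k G y - y <= c) -> iter (n * k) G x - x <= n%:R * c.
Proof.
move=> Gm h; elim: n => [|n IH]; first by rewrite /= mul0r subrr.
rewrite mulSn iterD -natr1 mulrDl mul1r.
by have := h (iter (n * k) G x); lra.
Qed.

Lemma iter_ge_mul G (k n : nat) x c : monotone_lift G ->
  (forall y, c <= iter k G y - y) -> n%:R * c <= iter (n * k) G x - x.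
Proof.
move=> Gm h; elim: n => [|n IH]; first by rewrite /= mul0r subrr.
rewrite mulSn iterD -natr1 mulrDl mul1r.
by have := h (iter (n * k) G x); lra.
Qed.

(** With [d n] the displacement of [0] under the [n]-th iterate, computing the [(n * m)]-th iterate
    in two ways gives [(d n - 1) / n <= (d m + 1) / m] for all [n] and [m]; the supremum of the left
    sides is the translation number. *)
Lemma tn_exists G : monotone_lift G -> exists a, tn G a.
Proof.
move=> Gm; pose d n := iter n G 0.
have up n y : iter n G y - y <= d n + 1.
  have := monotone_lift_osc y 0 (monotone_lift_iter n Gm).
  by rewrite ler_norml /d => /andP[]; lra.
have lo n y : d n - 1 <= iter n G y - y.
  have := monotone_lift_osc y 0 (monotone_lift_iter n Gm).
  by rewrite ler_norml /d => /andP[]; lra.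
have key (n m : nat) : (0 < n)%N -> (0 < m)%N -> (d n - 1) / n%:R <= (d m + 1) / m%:R.
  move=> n0 m0; rewrite ler_pdivrMr ?ltr0n// mulrAC ler_pdivlMr ?ltr0n//.
  rewrite mulrC [leRHS]mulrC.
  apply: le_trans (iter_ge_mul m 0 Gm (lo n)) _.
  by rewrite mulnC; exact: iter_le_mul.
pose E := [set (d n - 1) / n%:R | n in [set n | (0 < n)%N]].
have hE : has_sup E.
  split; first by exists ((d 1%N - 1) / 1%:R), 1%N.
  by exists ((d 1%N + 1) / 1%:R) => _ [n n0 <-]; exact: key.
exists (sup E) => n x.
have [->|n0] := posnP n; first by rewrite /= subrr mul0r subr0 normr0 ler01.
have le1 (k : nat) : (0 < k)%N -> d k - 1 <= k%:R * sup E.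
  move=> k0; rewrite mulrC -ler_pdivrMr ?ltr0n//; apply: ub_le_sup; first exact: hE.2.
  by exists k.
have ge1 (k : nat) : (0 < k)%N -> k%:R * sup E <= d k + 1.
  move=> k0; rewrite mulrC -ler_pdivlMr ?ltr0n//; apply: ge_sup; first exact: hE.1.
  by move=> _ [j j0 <-]; exact: key.
(* A deviation of more than 1 at one point becomes a deviation by a fixed [e > 0] at every point,
   since the displacement oscillates by at most 1. Iteration makes it grow linearly, against the
   bounds on [d]. *)
rewrite ler_norml; apply/andP; split; rewrite leNgt; apply/negP => h.
  pose e := n%:R * sup E - 1 - (iter n G x - x).
  have e0 : 0 < e by rewrite /e; lra.
  have : e <= 0.
    apply: (@le0_archimedean _ _ 2) => k; have [->|k0] := posnP k; first by rewrite mul0r.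
    have hh y : iter n G y - y <= n%:R * sup E - e.
      have := monotone_lift_osc y x (monotone_lift_iter n Gm).
      by rewrite ler_norml /e => /andP[]; lra.
    have := iter_le_mul k 0 Gm hh; rewrite subr0 -/(d _) mulrBr.
    have := ge1 (k * n)%N; rewrite muln_gt0 k0 n0 natrM => /(_ isT).
    by rewrite -mulrA; lra.
  by rewrite leNgt e0.
pose e := iter n G x - x - n%:R * sup E - 1.
have e0 : 0 < e by rewrite /e; lra.
have : e <= 0.
  apply: (@le0_archimedean _ _ 2) => k; have [->|k0] := posnP k; first by rewrite mul0r.
  have hh y : n%:R * sup E + e <= iter n G y - y.
    have := monotone_lift_osc y x (monotone_lift_iter n Gm).
    by rewrite ler_norml /e => /andP[]; lra.
  have := iter_ge_mul k 0 Gm hh; rewrite subr0 -/(d _) mulrDr.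
  have := le1 (k * n)%N; rewrite muln_gt0 k0 n0 natrM => /(_ isT).
  by rewrite -mulrA; lra.
by rewrite leNgt e0.
Qed.

(** The inequality commutes with integer translations, so it can be iterated [n] times; dividing by
    [n] removes the bounded error in [tn]. *)
Lemma tn_le_int G a x (k : nat) m : monotone_lift G -> tn G a ->
  iter k G x <= x + m%:~R -> k%:R * a <= m%:~R.
Proof.
move=> Gm Ga h; rewrite -subr_le0; apply: (@le0_archimedean _ _ 1) => n.
have : iter (n * k) G x <= x + n%:R * m%:~R.
  elim: n => [|n IH]; first by rewrite mul0r addr0.
  rewrite mulSn iterD; have := (monotone_lift_iter k Gm).2 _ _ IH.
  have -> : n%:R * m%:~R = (n%:Z * m)%:~R :> R by rewrite intrM.
  rewrite iter_degree1_int; last exact: Gm.1.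
  by rewrite intrM -natr1 /=; lra.
have := Ga (n * k)%N x; rewrite ler_norml natrM => /andP[+ _].
by rewrite mulrBr mulrA; lra.
Qed.

Lemma tn_ge_int G a x (k : nat) m : monotone_lift G -> tn G a ->
  x + m%:~R <= iter k G x -> m%:~R <= k%:R * a.
Proof.
move=> Gm Ga h; rewrite -subr_le0; apply: (@le0_archimedean _ _ 1) => n.
have : x + n%:R * m%:~R <= iter (n * k) G x.
  elim: n => [|n IH]; first by rewrite mul0r addr0.
  rewrite mulSn iterD; have := (monotone_lift_iter k Gm).2 _ _ IH.
  have -> : n%:R * m%:~R = (n%:Z * m)%:~R :> R by rewrite intrM.
  rewrite iter_degree1_int; last exact: Gm.1.
  by rewrite intrM -natr1 /=; lra.
have := Ga (n * k)%N x; rewrite ler_norml natrM => /andP[_ +].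
by rewrite mulrBr mulrA; lra.
Qed.

Lemma tn_mono G H a b : monotone_lift G -> monotone_lift H -> tn G a -> tn H b ->
  (forall x, G x <= H x) -> a <= b.
Proof.
move=> Gm Hm Ga Hb GH; rewrite -subr_le0; apply: (@le0_archimedean _ _ 2) => n.
have : iter n G 0 <= iter n H 0.
  elim: n => //= n IH; exact: le_trans (GH _) (Hm.2 _ _ IH).
have := Ga n 0; have := Hb n 0; rewrite !ler_norml => /andP[_ h1] /andP[h2 _].
by rewrite mulrBr; lra.
Qed.

Lemma tn_unique G a b : monotone_lift G -> tn G a -> tn G b -> a = b.
Proof. by move=> Gm Ga Gb; apply/eqP; rewrite eq_le !(@tn_mono G G). Qed.

(** Orbits are ordered mod 1 like those of the rotation: a reversed pair is an integer bound on the
    displacement after [j - i] steps, which bounds [(j - i) * a] on the wrong side. *)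
Lemma orbit_lt G a x (i j : nat) m m' : monotone_lift G -> tn G a ->
  i%:R * a + m%:~R < j%:R * a + m'%:~R ->
  iter i G x + m%:~R < iter j G x + m'%:~R.
Proof.
move=> Gm Ga h; rewrite ltNge; apply/negP => c.
have [ij|ji] := leqP i j.
- have := @tn_le_int G a (iter i G x) (j - i) (m - m') Gm Ga.
  rewrite -iterD subnK// intrB natrB// mulrBl.
  have /[swap]/[apply] : iter j G x <= iter i G x + (m%:~R - m'%:~R) by lra.
  by lra.
- have := @tn_ge_int G a (iter j G x) (i - j) (m' - m) Gm Ga.
  rewrite -iterD subnK ?(ltnW ji)// intrB natrB ?(ltnW ji)// mulrBl.
  have /[swap]/[apply] : iter j G x + (m'%:~R - m%:~R) <= iter i G x by lra.
  by lra.
Qed.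

Lemma orbit_le G a x (i j : nat) m m' : monotone_lift G -> tn G a -> irrational a ->
  i%:R * a + m%:~R <= j%:R * a + m'%:~R ->
  iter i G x + m%:~R <= iter j G x + m'%:~R.
Proof.
move=> Gm Ga ia; rewrite le_eqVlt => /predU1P[h|h]; last first.
  exact/ltW/(orbit_lt _ Gm Ga).
wlog ij : i j m m' h / (i <= j)%N.
  move=> W; have [ij|ji] := leqP i j; first exact: (W i j).
  suff <- : iter j G x + m'%:~R = iter i G x + m%:~R by [].
  apply/eqP; rewrite eq_le (W j i m' m) ?(ltnW ji)//=.
  move: h => /esym h.
  have := @irrational_mul _ a (i - j) (m' - m) ia.
  rewrite subn_gt0 ji natrB ?(ltnW ji)// intrB mulrBl => /(_ isT)/eqP[].
  by lra.
move: ij; rewrite leq_eqVlt => /predU1P[ij|ij].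
  by rewrite ij in h *; lra.
have := @irrational_mul _ a (j - i) (m - m') ia.
rewrite subn_gt0 ij natrB ?(ltnW ij)// intrB mulrBl => /(_ isT)/eqP[].
by lra.
Qed.

Section disjoint_sum.
Variables (Th : R -> R) (V : R).
Hypothesis Th_homo : {homo Th : x y / x <= y}.

(** Induction on the number of intervals: one of them splits the others into those on its left and
    those on its right. *)
Lemma separated_sum (u v : nat -> R) (s : seq nat) (A B : R) : uniq s -> A <= B ->
  (forall i, i \in s -> [/\ u i <= v i, A <= u i & v i <= B]) ->
  (forall i j, i \in s -> j \in s -> i != j -> v i <= u j \/ v j <= u i) ->
  \sum_(i <- s) (Th (v i) - Th (u i)) <= Th B - Th A.
Proof.
have [n] := ubnP (size s); elim: n s A B => // n IH [|x s] A B /=.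
  by move=> _ _ AB _ _; rewrite big_nil subr_ge0 Th_homo.
rewrite ltnS => sn /andP[xs us] AB inAB sep.
have [ux Ax Bx] := inAB x (mem_head _ _).
rewrite big_cons (bigID (fun i => v i <= u x))/=.
have h1 : \sum_(i <- s | v i <= u x) (Th (v i) - Th (u i)) <= Th (u x) - Th A.
  rewrite -big_filter; apply: IH => //.
  - by apply: leq_ltn_trans sn; rewrite size_filter count_size.
  - exact: filter_uniq.
  - by move=> i; rewrite mem_filter => /andP[ix si]; have [] := inAB i (mem_behead (s := x :: s) si).
  - move=> i j; rewrite !mem_filter => /andP[_ si] /andP[_ sj] ij.
    by apply: sep => //; rewrite inE ?si ?sj orbT.
have h2 : \sum_(i <- s | ~~ (v i <= u x)) (Th (v i) - Th (u i)) <= Th B - Th (v x).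
  rewrite -big_filter; apply: IH => //.
  - by apply: leq_ltn_trans sn; rewrite size_filter count_size.
  - exact: filter_uniq.
  - move=> i; rewrite mem_filter => /andP[ix si].
    have [uvi Ai Bi] := inAB i (mem_behead (s := x :: s) si); split=> //.
    have : i != x by apply: contraNneq xs => <-.
    move=> /(sep i x (mem_behead (s := x :: s) si) (mem_head _ _))[]//.
    by move/negP: ix.
  - move=> i j; rewrite !mem_filter => /andP[_ si] /andP[_ sj] ij.
    by apply: sep => //; rewrite inE ?si ?sj orbT.
by move: h1 h2; lra.
Qed.

Hypothesis ThV : forall x, Th (x + 1) = Th x + V.

(** Each interval is translated so that its left end falls in [[u 0, u 0 + 1)]. Its right end then
    stays below [u 0 + 1], because it avoids the translate by 1 of the interval of index 0. *)
Lemma separated_mod1_sum (u v : nat -> R) n :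
  (forall i, (i < n)%N -> u i <= v i <= u i + 1) ->
  (forall i j m, (i < n)%N -> (j < n)%N -> i != j ->
     v i <= u j + m%:~R \/ v j + m%:~R <= u i) ->
  \sum_(0 <= i < n) (Th (v i) - Th (u i)) <= V.
Proof.
move=> uv sep; have V0 : 0 <= V.
  by have : Th 0 <= Th (0 + 1); [apply: Th_homo; rewrite lerDl ler01|rewrite ThV; lra].
case: n uv sep => [|n] uv sep; first by rewrite big_geq.
have [k kP] := choice (fun i => floor_shift (u 0%N) (u i)).
have -> : V = Th (u 0%N + 1) - Th (u 0%N) by rewrite ThV; lra.
rewrite (eq_bigr (fun i => Th (v i + (k i)%:~R) - Th (u i + (k i)%:~R))); last first.
  by move=> i _; rewrite !(periodic_int ThV); lra.
apply: (@separated_sum (fun i => u i + (k i)%:~R) (fun i => v i + (k i)%:~R)).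
- exact: iota_uniq.
- by rewrite lerDl.
- move=> i; rewrite mem_index_iota/= => ni.
  have /andP[k1 k2] := kP i; have /andP[uvi uvi1] := uv i ni.
  split=> //; first by rewrite lerD2r.
  have [i0|i0] := eqVneq i 0%N.
    subst i; have : k 0%N = 0 by apply: (@int_small_eq0 R); rewrite ltr_norml; apply/andP; split; lra.
    by move=> ->; rewrite addr0.
  have /andP[uv0 _] := uv 0%N isT.
  have := sep i 0%N (1 - k i) ni isT i0; rewrite intrB => -[]; lra.
- move=> i j; rewrite !mem_index_iota/= => ni nj ij.
  by have := sep i j (k j - k i) ni nj ij; rewrite intrB => -[h|h]; [left|right]; lra.
Qed.

End disjoint_sum.

(** For distinct times below [Q] the rotation separates the left ends by at least [q * a - p], the
    length of a rotated arc. As orbits are ordered like the rotation, the [Q] arcs are disjoint mod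
    1. *)
Lemma arcs_sum F a Th V (q Q : nat) p P x : monotone_lift F -> tn F a -> irrational a ->
  return_pair a q p Q P -> {homo Th : x y / x <= y} ->
  (forall x, Th (x + 1) = Th x + V) ->
  \sum_(0 <= i < Q) (Th (iter (i + q) F x - p%:~R) - Th (iter i F x)) <= V.
Proof.
move=> Fm Fa ia [/andP[q0 qQ] d0 dmin Pd] Th_homo ThV.
apply: (separated_mod1_sum Th_homo ThV) => [i iQ|i j m iQ jQ ij].
- have d1 : q%:R * a - p%:~R <= 1.
    have Q1 : (0 < 1 < Q)%N by lia.
    have h1 := dmin _ (Num.floor a) Q1.
    apply: le_trans h1 _; rewrite mul1r ger0_norm ?subr_ge0 ?floor_le_tmp//.
    by have := floorD1_gt a; rewrite intrD; lra.
  have := @orbit_le F a x i (i + q) 0 (- p) Fm Fa ia.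
  have := @orbit_le F a x (i + q) i (- p) 1 Fm Fa ia.
  rewrite natrD mulrNz mulr0z mulr1z mulrDl => h1 h2.
  by apply/andP; split; [have := h2|have := h1]; lra.
- wlog ltij : i j m iQ jQ ij / (i < j)%N.
    move=> W; have [lt|lt|e] := ltngtP i j; first exact: W.
      by have := W j i (- m) jQ iQ; rewrite eq_sym mulrNz => /(_ ij lt)[h|h]; [right|left]; lra.
    by rewrite e eqxx in ij.
  have := dmin (j - i)%N (- m); rewrite subn_gt0 ltij (leq_ltn_trans (leq_subr _ _) jQ).
  move=> /(_ isT); rewrite natrB ?(ltnW ltij)// mulrNz opprK ler_normr => /orP[h|h].
    left; rewrite -mulrNz; apply: (orbit_le _ Fm Fa ia).
    by rewrite natrD mulrNz; lra.
  right; have := @orbit_le F a x (j + q) i (m - p) 0 Fm Fa ia.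
  by rewrite natrD intrB mulr0z => h1; have := h1; lra.
Qed.

Lemma tn_opp G a : tn G a -> tn (fun x => - G (- x)) (- a).
Proof.
move=> Ga n x; have -> : iter n (fun x => - G (- x)) x = - iter n G (- x).
  by elim: n => [|n /= ->]; rewrite ?opprK.
have := Ga n (- x); rewrite -normrN; congr (`| _ | <= _).
by rewrite mulrN; lra.
Qed.

Lemma iter_opp G n x : iter n (fun x => - G (- x)) x = - iter n G (- x).
Proof. by elim: n => [|n /= ->]; rewrite ?opprK. Qed.

Lemma monotone_lift_opp G : monotone_lift G -> monotone_lift (fun x => - G (- x)).
Proof.
move=> [G1 Gh]; split=> [x|x y xy]; last by rewrite lerN2 Gh ?lerN2.
by have := G1 (- (x + 1)); rewrite opprD subrK => ->; lra.
Qed.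

(** Among [Q > t^-1] disjoint return arcs of total length at most 1 one is shorter than [t]. There
    the return of [G] falls short of an integer translate of its starting point by less than [t];
    [H] gains at least [t] and passes it, so [q * b] exceeds an integer that [q * a] does not reach.
    The reflection [x -> - x] puts the return on the left. *)
Lemma tn_strict G H a b t : monotone_lift G -> monotone_lift H ->
  tn G a -> tn H b -> irrational a -> 0 < t -> (forall x, G x + t <= H x) -> a < b.
Proof.
move=> Gm Hm Ga Hb ia t0 GH; pose N := Num.bound t^-1.
(* An error below [e] forces [q > N], whence [Q * t > 1]. *)
have [e e0 eN] := irrational_away N (irrationalN ia).
have [q [p [Q [P [rp qe]]]]] := exists_return_pair (irrationalN ia) e0.
have [/andP[q0 qQ] d0 dmin Pd] := rp.
have NQ : (N < Q)%N.
  apply: leq_ltn_trans qQ; rewrite leqNgt; apply/negP => qN.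
  have := eN q p; rewrite q0 (ltnW qN) => /(_ isT).
  by rewrite gtr0_norm//; lra.
pose G' x := - G (- x).
(* The shortest of the [Q] arcs, whose lengths add up to at most 1. *)
have [i iQ hi] : exists2 i, (i < Q)%N &
    Q%:R * (iter (i + q) G' 0 - p%:~R - iter i G' 0) <= 1.
  apply: contrapT => /forall2NP h.
  have := @arcs_sum G' (- a) id 1 q Q p P 0 (monotone_lift_opp Gm) (tn_opp Ga) (irrationalN ia) rp.
  move=> /(_ (fun _ _ h => h) (fun=> erefl)); apply/negP; rewrite -ltNge.
  have Q0 : (0 < Q)%N by lia.
  have sum1 : \sum_(0 <= i < Q) Q%:R^-1 = 1 :> R.
    by rewrite sumr_const_nat subn0 -[X in X *+ _]mul1r -mulrnAl mulfV// pnatr_eq0 -lt0n.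
  rewrite -[X in X < _]sum1; apply: ltr_sum_nat => // i /andP[_ iQ].
  have [] := h i; first by rewrite iQ.
  by move=> /negP; rewrite -ltNge -ltr_pdivrMl ?ltr0n// mulr1.
have Qt : Q%:R * t > 1.
  rewrite -ltr_pdivrMr// mul1r; apply: lt_le_trans (archi_boundP _) _.
    by rewrite invr_ge0 ltW.
  by rewrite ler_nat ltnW.
have Q0 : 0 < Q%:R :> R by rewrite ltr0n; lia.
have {}hi : iter (i + q) G' 0 - p%:~R - iter i G' 0 < t.
  by rewrite -(ltr_pM2l Q0); lra.
rewrite addnC iterD in hi; set y' := iter i G' 0 in hi.
rewrite /G' iter_opp in hi; set y := - y' in hi.
have GHq (n : nat) : iter n G y + (0 < n)%N%:R * t <= iter n H y.
  elim: n => [|n IH]; first by rewrite mul0r addr0.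
  rewrite /= mul1r; apply: le_trans (GH _) (Hm.2 _ _ _).
  by apply: le_trans IH; rewrite lerDl mulr_ge0// ltW.
have := GHq q; rewrite q0 mul1r => hq.
have : (- p)%:~R <= q%:R * b.
  by apply: (tn_ge_int Hm Hb (x := y)); rewrite mulrNz /y; rewrite /y in hi hq; lra.
rewrite mulrNz => hb.
have : q%:R * a < q%:R * b by lra.
by rewrite ltr_pM2l// ltr0n.
Qed.

End translation_number.

(** * Real bounds at closest returns *)

Section calculus.
Context {R : realType}.
Implicit Types (F dF : R -> R) (a b x y : R).

Lemma is_derive_continuous F x d : is_derive x 1 F d -> {for x, continuous F}.
Proof. by move=> [dF _]; exact/differentiable_continuous/derivable1_diffP. Qed.

Lemma mean_value F dF a b : a < b ->
  (forall x, a <= x <= b -> is_derive x 1 F (dF x)) ->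
  exists2 c, a < c < b & F b - F a = dF c * (b - a).
Proof.
move=> ab dFP.
have fd x : x \in `]a, b[%R -> is_derive x 1 F (dF x).
  by rewrite in_itv/= => /andP[h1 h2]; apply: dFP; rewrite !ltW.
have fc : {within `[a, b], continuous F}.
  apply: derivable_within_continuous => x; rewrite in_itv/= => xab.
  by have [] := dFP x xab.
by have [c cab h] := MVT ab fd fc; exists c => //; rewrite in_itv/= in cab.
Qed.

Lemma intermediate_value F a b v : a <= b -> continuous F -> F a <= v <= F b ->
  exists2 c, a <= c <= b & F c = v.
Proof.
move=> ab cF /andP[h1 h2].
have h : Num.min (F a) (F b) <= v <= Num.max (F a) (F b).
  by rewrite ge_min le_max h1 h2 orbT.
by have [c cab Fc] := IVT ab (continuous_subspaceT cF) h; exists c.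
Qed.

Lemma is_derive_opp F x d : is_derive (- x) 1 F d -> is_derive x 1 (fun y => - F (- y)) d.
Proof.
move=> h; have -> : (fun y => - F (- y)) = - (F \o -%R) by [].
by apply: is_derive_eq; rewrite mulrN1 opprK.
Qed.

Lemma le_of_derive F dF a b : a <= b ->
  (forall x, a <= x <= b -> is_derive x 1 F (dF x)) ->
  (forall x, a <= x <= b -> 0 <= dF x) -> F a <= F b.
Proof.
rewrite le_eqVlt => /predU1P[->//|ab] dFP dF0.
have [c /andP[c1 c2] h] := mean_value ab dFP.
by rewrite -subr_ge0 h mulr_ge0 ?dF0 ?subr_ge0 ?ltW// c1.
Qed.

End calculus.

(** * Three adjacent intervals whose middle image is the shortest *)

Section space.
Context {R : realType}.
Implicit Types (H dH : R -> R) (a b c d x y K mu : R).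

(* The geometric mean of the derivatives at the ends of an interval is at most
   [sqrt K] times the mean slope: the infinitesimal form of the cross-ratio
   inequality. *)
Definition endpoint_bound H dH K a d := forall x y, a <= x -> x < y -> y <= d ->
  dH x * dH y * (y - x) ^+ 2 <= K * (H y - H x) ^+ 2.

(** Some [x] in [[a', b]] has slope [mu / (b - a')], where [[a', b]] has image of length [mu]. The
    endpoint bound between [x] and [y] beyond [c] then gives [dH y <= A / (y - b)^2]. Integration
    over a piece [[c, d']] with image of length [mu] bounds [c - b]. The 9 is the square of 3: the
    image of [[x, y]] is covered by three lengths [mu]. *)
Lemma space_left H dH K a b c d mu : 0 <= K -> 0 < mu -> a < b -> b < c -> c < d ->
  (forall x, is_derive x 1 H (dH x)) -> {homo H : x y / x <= y} ->
  (forall x, 0 <= dH x) -> endpoint_bound H dH K a d ->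
  mu <= H b - H a -> H c - H b = mu -> mu <= H d - H c ->
  c - b <= 9 * K * (b - a).
Proof.
move=> K0 mu0 ab bc cd HdH Hh dH0 HK Hab Hbc Hcd.
have cH : continuous H by move=> x; exact: is_derive_continuous (HdH x).
have [|a' /andP[aa' a'b] Ha'] := @intermediate_value _ H a b (H b - mu) (ltW ab) cH.
  by apply/andP; split; lra.
have [|d' /andP[cd' d'd] Hd'] := @intermediate_value _ H c d (H c + mu) (ltW cd) cH.
  by apply/andP; split; lra.
have {}a'b : a' < b by rewrite lt_neqAle a'b andbT; apply/eqP => e; rewrite e in Ha'; lra.
have [x /andP[a'x xb]] := mean_value a'b (fun x _ => HdH x).
rewrite Ha' opprB addrC subrK => hx.
have ba0 : 0 < b - a' by rewrite subr_gt0.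
pose A := 9 * K * mu * (b - a').
have dHA y : c <= y <= d' -> dH y * (y - b) ^+ 2 <= A.
  move=> /andP[cy yd'].
  have yb : b < y by lra.
  have h1 : dH x * dH y * (y - x) ^+ 2 <= K * (H y - H x) ^+ 2.
    by apply: HK; lra.
  have h2 : (H y - H x) ^+ 2 <= (3 * mu) ^+ 2.
    have := Hh _ _ yd'; have := Hh _ _ (ltW a'x).
    have : H x <= H y by apply: Hh; lra.
    move=> *; rewrite ler_sqr ?nnegrE; lra.
  have h3 : (y - b) ^+ 2 <= (y - x) ^+ 2 by rewrite ler_sqr ?nnegrE; lra.
  have dHx : dH x = mu / (b - a') by rewrite hx mulfK// gt_eqF.
  have : dH x * (dH y * (y - b) ^+ 2) <= K * (3 * mu) ^+ 2.
    apply: le_trans (ler_wpM2l K0 h2); apply: le_trans h1.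
    by rewrite mulrA ler_wpM2l// mulr_ge0.
  rewrite dHx mulrAC ler_pdivrMr// mulrC [leRHS]mulrC => h.
  have {}h : mu * (dH y * (y - b) ^+ 2) <= mu * A.
    by rewrite mulrC (le_trans h)// /A le_eqVlt; apply/orP; left; apply/eqP; ring.
  by rewrite ler_pM2l in h.
(* The integration over [[c, d']] is carried out as monotonicity of [- H y - A / (y - b)], since
   [- 1 / (y - b)] is a primitive of [(y - b)^-2]. *)
have dG y : c <= y <= d' ->
    is_derive y 1 (fun y => - H y - A * (y - b)^-1) (- dH y + A * (y - b) ^- 2).
  move=> /andP[cy _]; have yb : y - b != 0 by rewrite subr_eq0 gt_eqF//; lra.
  have h1 : is_derive y 1 (fun y : R => y - b) 1.
    have -> : (fun y : R => y - b) = id - cst b by [].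
    by apply: is_derive_eq; rewrite subr0.
  have h2 := @is_deriveV _ (fun y : R => y - b) y 1 1 yb h1.
  have h3 := is_deriveZ A h2.
  have h4 := is_deriveB (is_deriveN (HdH y)) h3.
  apply: (is_derive_eq (f' := - dH y - A *: (- (y - b) ^- 2 *: 1))) => //.
  by rewrite /GRing.scale/=; ring.
have := le_of_derive cd' dG.
have gpos x0 : c <= x0 <= d' -> 0 <= - dH x0 + A * (x0 - b) ^- 2.
  move=> h; have := dHA _ h; move: h => /andP[cx _].
  have xb0 : 0 < (x0 - b) ^+ 2 by rewrite exprn_gt0// subr_gt0; lra.
  by rewrite -ler_pdivlMr//; lra.
move=> /(_ gpos); rewrite Hd' => h.
have {h} : mu <= A * (c - b)^-1.
  have : 0 <= A * (d' - b)^-1.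
    rewrite mulr_ge0 ?invr_ge0 /A ?mulr_ge0//; lra.
  by lra.
rewrite ler_pdivlMr ?subr_gt0// /A => h.
have {}h : mu * (c - b) <= mu * (9 * K * (b - a')) by apply: le_trans h _; rewrite le_eqVlt; apply/orP; left; apply/eqP; ring.
rewrite ler_pM2l// in h; apply: le_trans h _.
by rewrite ler_wpM2l ?mulr_ge0//; lra.
Qed.

Lemma space_right H dH K a b c d mu : 0 <= K -> 0 < mu -> a < b -> b < c -> c < d ->
  (forall x, is_derive x 1 H (dH x)) -> {homo H : x y / x <= y} ->
  (forall x, 0 <= dH x) -> endpoint_bound H dH K a d ->
  mu <= H b - H a -> H c - H b = mu -> mu <= H d - H c ->
  c - b <= 9 * K * (d - c).
Proof.
move=> K0 mu0 ab bc cd HdH Hh dH0 HK Hab Hbc Hcd.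
have -> : c - b = - b - - c by ring.
have -> : d - c = - c - - d by ring.
apply: (@space_left (fun x => - H (- x)) (fun x => dH (- x)) K (- d) (- c) (- b) (- a) mu);
  rewrite ?ltrN2 ?opprK//; try lra.
- by move=> x; apply: is_derive_opp; exact: HdH.
- by move=> x y xy; rewrite lerN2 Hh// lerN2.
- move=> x y dx xy ya.
  have := HK (- y) (- x); rewrite !ltrN2 => /(_ _ xy _) h.
  have -> : (y - x) = - x - - y by ring.
  by rewrite [dH _ * _]mulrC (le_trans (h _ _)); lra.
Qed.

(** The endpoint bound is used between [u] and a point of [[b, c]] whose derivative is the mean
    slope there. This is the source of all upper bounds on derivatives of iterates. *)
Lemma endpoint_bound_derive H dH K u b c : 0 <= K -> u < b -> b < c ->
  (forall x, is_derive x 1 H (dH x)) -> (forall x, 0 <= dH x) ->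
  endpoint_bound H dH K u c -> {homo H : x y / x <= y} ->
  dH u * (b - u) ^+ 2 * (H c - H b) <= K * (H c - H u) ^+ 2 * (c - b).
Proof.
move=> K0 ub bc HdH dH0 HK Hh.
have [y /andP[by_ yc] hy] := mean_value bc (fun x _ => HdH x).
have h1 := HK u y (lexx _) (lt_trans ub by_) (ltW yc).
rewrite hy mulrA ler_wpM2r ?subr_ge0 ?(ltW bc)//.
have h2 : (H y - H u) ^+ 2 <= (H c - H u) ^+ 2.
  have := Hh _ _ (ltW yc); have : H u <= H y by apply: Hh; lra.
  by move=> *; rewrite ler_sqr ?nnegrE; lra.
have h3 : (b - u) ^+ 2 <= (y - u) ^+ 2 by rewrite ler_sqr ?nnegrE; lra.
apply: le_trans (ler_wpM2l K0 h2); apply: le_trans h1.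
by rewrite mulrAC ler_wpM2l// mulr_ge0.
Qed.

End space.

(** * Comparability of neighbouring return arcs *)

Section real_bounds.
Context {R : realType}.
Implicit Types (x y u v w : R) (m p : int).

(* [dl_bound] is the one-step distortion estimate. [Th] is the distribution
   function of a finite measure on the circle: a multiple of Lebesgue measure
   plus an atom at each critical point. *)
Record distortion_lift (F dF Th : R -> R) (V : R) : Prop := {
  dl_mono : monotone_lift F ;
  dl_inj : {homo F : x y / x < y} ;
  dl_der : forall x, is_derive x 1 F (dF x) ;
  dl_ge0 : forall x, 0 <= dF x ;
  dl_homo : {homo Th : x y / x <= y} ;
  dl_period : forall x, Th (x + 1) = Th x + V ;
  dl_bound : forall x y, x < y -> y <= x + 1 ->
    dF x * dF y * (y - x) ^+ 2 <= expR (Th y - Th x) * (F y - F x) ^+ 2 }.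

Definition diter (F dF : R -> R) n x := \prod_(0 <= i < n) dF (iter i F x).

Variables (F dF Th : R -> R) (V a : R).
Hypothesis FD : distortion_lift F dF Th V.
Hypothesis Fa : tn F a.
Hypothesis ia : irrational a.

Let Fm : monotone_lift F := dl_mono FD.

Lemma iter_homo_lt n : {homo iter n F : x y / x < y}.
Proof. by elim: n => //= n IH x y xy; apply: (dl_inj FD); exact: IH. Qed.

Lemma iter_homo_le n : {homo iter n F : x y / x <= y}.
Proof. exact: (monotone_lift_iter n Fm).2. Qed.

Lemma iter_is_derive n x : is_derive x 1 (iter n F) (diter F dF n x).
Proof.
elim: n => [|n IH].
  by rewrite /diter big_geq//; exact: is_derive_id.
rewrite /diter big_nat_recr//= -/(diter F dF n x) mulrC.
have := dl_der FD (iter n F x) => h.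
exact: (@is_derive1_comp _ F (iter n F) x _ _ h IH).
Qed.

Lemma diter_ge0 n x : 0 <= diter F dF n x.
Proof. by rewrite /diter prodr_ge0// => i _; exact: dl_ge0 FD _. Qed.

Lemma iter_continuous n : continuous (iter n F).
Proof. by move=> x; exact: is_derive_continuous (iter_is_derive n x). Qed.

Lemma iter_surj n y : exists x, iter n F x = y.
Proof.
have [Hd Hh] := monotone_lift_iter n Fm.
have [m /andP[m1 m2]] := floor_shift (iter n F 0) y.
have [|x _ hx] := @intermediate_value _ (iter n F) 0 1 (y + m%:~R) ler01 (@iter_continuous n).
  by rewrite m1 -[X in iter n F X]add0r Hd ltW.
exists (x - m%:~R); rewrite -mulrNz degree1_int// hx mulrNz; lra.
Qed.

Lemma endpoint_bound_iter n x y : x < y -> y <= x + 1 ->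
  diter F dF n x * diter F dF n y * (y - x) ^+ 2 <=
  expR (\sum_(0 <= i < n) (Th (iter i F y) - Th (iter i F x))) *
    (iter n F y - iter n F x) ^+ 2.
Proof.
move=> xy yx1; elim: n => [|n IH].
  by rewrite /diter !big_geq//= expR0 !mul1r.
rewrite /diter !big_nat_recr//= -!/(diter F dF n _) expRD.
set D := diter F dF n x in IH *; set D' := diter F dF n y in IH *.
set S := expR _ in IH *.
have lt : iter n F x < iter n F y by exact: iter_homo_lt.
have le1 : iter n F y <= iter n F x + 1.
  by rewrite -(monotone_lift_iter n Fm).1; exact: iter_homo_le.
have := dl_bound FD lt le1; set E := expR (Th _ - Th _) => h.
apply: (@le_trans _ _ (dF (iter n F x) * dF (iter n F y) *
   (S * (iter n F y - iter n F x) ^+ 2))).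
  rewrite [leLHS](_ : _ = dF (iter n F x) * dF (iter n F y) * (D * D' * (y - x) ^+ 2)).
    by rewrite ler_wpM2l// mulr_ge0// (dl_ge0 FD).
  by ring.
rewrite mulrCA -mulrA ler_wpM2l// ?expR_ge0//.
Qed.

Section return_pair.
Variables (q : nat) (p : int) (Q : nat) (P : int).
Hypothesis qQ : return_pair a q p Q P.
Hypothesis d10 : q%:R * a - p%:~R < 10^-1.

(** The closest-return map on the lift. It commutes with [F], so [F] permutes the return arcs from
    [x] to [step x], whose lengths are the values of [gap]. *)
Definition step x := iter q F x - p%:~R.
Definition gap x := step x - x.

Lemma iter_stepE k x : iter k step x = iter (k * q) F x + (- (k%:Z * p))%:~R.
Proof.
elim: k => [|k IH]; first by rewrite mul0r oppr0 mulr0z addr0.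
rewrite /= IH /step iter_degree1_int; last exact: Fm.1.
have e : k.+1%:Z%:~R = k%:Z%:~R + 1 :> R by rewrite -addn1 PoszD intrD.
by rewrite mulSn iterD !mulrNz !intrM e; ring.
Qed.

Lemma iter_step_comm i x : iter i F (step x) = step (iter i F x).
Proof.
rewrite /step -mulrNz iter_degree1_int; last exact: Fm.1.
by rewrite -!iterD addnC.
Qed.

Lemma iter_iter_step_comm i k x : iter i F (iter k step x) = iter k step (iter i F x).
Proof. by elim: k => //= k IH; rewrite iter_step_comm IH. Qed.

Lemma step_homo_lt : {homo step : x y / x < y}.
Proof. by move=> x y xy; rewrite /step ltrD2r; exact: iter_homo_lt. Qed.

Lemma step_homo_le : {homo step : x y / x <= y}.
Proof. by move=> x y xy; rewrite /step lerD2r; exact: iter_homo_le. Qed.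

Lemma step_int x m : step (x + m%:~R) = step x + m%:~R.
Proof. by rewrite /step iter_degree1_int; [ring|exact: Fm.1]. Qed.

Lemma gap_int x m : gap (x + m%:~R) = gap x.
Proof. by rewrite /gap step_int; ring. Qed.

Lemma gap_gt0 x : 0 < gap x.
Proof.
have [_ d0 _ _] := qQ.
have := @orbit_lt R F a x 0 q 0 (- p) Fm Fa.
by rewrite mul0r mulr0z addr0 mulrNz => /(_ d0); rewrite /gap /step /=; lra.
Qed.

Lemma step_gt x : x < step x.
Proof. by have := gap_gt0 x; rewrite /gap subr_gt0. Qed.

Lemma step_continuous : continuous step.
Proof.
move=> x; apply: continuousB; first exact: iter_continuous.
exact: cst_continuous.
Qed.

(** Ten rotations by less than [1 / 10] stay within one turn, which leaves room for the eight
    adjacent arcs used below. *)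
Lemma iter_step_le1 k x : (k <= 10)%N -> iter k step x <= x + 1.
Proof.
move=> k10; rewrite iter_stepE.
have := @orbit_le R F a x (k * q) 0 (- (k%:Z * p)) 1 Fm Fa ia.
rewrite mul0r natrM mulrNz intrM /= mulr1z; apply.
have [_ d0 _ _] := qQ.
have k10' : k%:R <= 10 :> R by rewrite (ler_nat _ k 10).
have : k%:R * (q%:R * a - p%:~R) <= 10 * 10^-1 by apply: ler_pM => //; exact: ltW.
have -> : k%:~R = k%:R :> R by [].
by lra.
Qed.

Lemma gap_le1 x : gap x <= 1.
Proof. by have := @iter_step_le1 1 x isT; rewrite /gap /=; lra. Qed.

Lemma arc_sum x :
  \sum_(0 <= i < Q) (Th (iter i F (step x)) - Th (iter i F x)) <= V.
Proof.
apply: le_trans (arcs_sum x Fm Fa ia qQ (dl_homo FD) (dl_period FD)).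
by rewrite le_eqVlt; apply/orP; left; apply/eqP/eq_bigr => i _; rewrite iter_step_comm /step -iterD addnC.
Qed.

Lemma arc_sum_blocks n x :
  \sum_(0 <= i < n * Q) (Th (iter i F (step x)) - Th (iter i F x)) <= n%:R * V.
Proof.
elim: n x => [|n IH] x; first by rewrite big_geq// mul0r.
rewrite (@big_cat_nat _ _ _ Q)//=; last by rewrite mulSn leq_addr.
rewrite -natr1 mulrDl mul1r addrC lerD ?arc_sum//.
rewrite -{1}[Q]add0n big_addn mulSn addKn.
apply: le_trans (IH (iter Q F x)).
rewrite le_eqVlt; apply/orP; left; apply/eqP/eq_bigr => i _.
by rewrite -iter_step_comm -!iterD.
Qed.

Lemma arc_sum_steps k n x :
  \sum_(0 <= i < n * Q) (Th (iter i F (iter k step x)) - Th (iter i F x))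
    <= k%:R * (n%:R * V).
Proof.
elim: k => [|k IH].
  by rewrite mul0r big1// => i _; rewrite subrr.
rewrite (eq_bigr (fun i => (Th (iter i F (step (iter k step x))) - Th (iter i F (iter k step x)))
  + (Th (iter i F (iter k step x)) - Th (iter i F x)))); last first.
  by move=> i _ /=; ring.
rewrite big_split/= -natr1 mulrDl mul1r addrC lerD//.
exact: arc_sum_blocks.
Qed.

(** Eight adjacent arcs are followed along [8 * Q] iterates, and each block of [Q] iterates of one
    arc contributes at most [V]: hence [64 = 8 * 8]. *)
Definition distortion_cst := expR (64 * V).
Local Notation K := distortion_cst.

Lemma endpoint_bound_arcs n w : (n <= 8 * Q)%N ->
  endpoint_bound (iter n F) (diter F dF n) K w (iter 8 step w).
Proof.
move=> nQ x y wx xy yw.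
have yx1 : y <= x + 1 by have := @iter_step_le1 8 w isT; lra.
apply: le_trans (endpoint_bound_iter n xy yx1) _.
rewrite ler_wpM2r ?sqr_ge0// ler_expR.
have hle i : Th (iter i F y) - Th (iter i F x) <=
    Th (iter i F (iter 8 step w)) - Th (iter i F w).
  have := dl_homo FD (iter_homo_le i yw); have := dl_homo FD (iter_homo_le i wx).
  by lra.
have := @arc_sum_steps 8 8 w; rewrite (@big_cat_nat _ _ _ n)//= => h.
have h2 : 0 <= \sum_(n <= i < 8 * Q) (Th (iter i F (iter 8 step w)) - Th (iter i F w)).
  apply: sumr_ge0 => i _; rewrite subr_ge0; apply: (dl_homo FD).
  by apply: iter_homo_le; lra.
have : \sum_(0 <= i < n) (Th (iter i F y) - Th (iter i F x)) <=
   \sum_(0 <= i < n) (Th (iter i F (iter 8 step w)) - Th (iter i F w)).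
  by apply: ler_sum => i _.
by move: h; rewrite -[iter 8 step w]/(step (step (step (step (step (step (step (step w)))))))); lra.
Qed.

Lemma V_ge0 : 0 <= V.
Proof.
by have : Th 0 <= Th (0 + 1); [apply: (dl_homo FD); rewrite lerDl ler01|rewrite (dl_period FD); lra].
Qed.

Lemma K_ge1 : 1 <= K.
Proof. by apply: le_trans (expR_ge1Dx _); have := V_ge0; lra. Qed.

Lemma exists_max (f : nat -> R) n : exists2 j, (j <= n)%N & forall i, (i <= n)%N -> f i <= f j.
Proof.
elim: n => [|n [j jn jmax]]; first by exists 0%N => // i; rewrite leqn0 => /eqP ->.
have [h|h] := leP (f n.+1) (f j).
  exists j; first exact: leqW.
  by move=> i; rewrite leq_eqVlt => /predU1P[->//|]; exact: jmax.
exists n.+1 => // i; rewrite leq_eqVlt => /predU1P[->//|i_n].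
exact: le_trans (jmax _ i_n) (ltW h).
Qed.

(** Let [j] be the index of the left end nearest to [z] from below. If its arc stopped before [z], a
    nearer left end would exist: that of index [j + q] when [j < Q], that of index [j - Q]
    otherwise, because the return [Q] moves backwards by less than the length of an arc. *)
Lemma arcs_cover x z : exists i m, (i < Q + q)%N /\
  iter i F x + m%:~R < z <= step (iter i F x) + m%:~R.
Proof.
have [/andP[q0 qltQ] d0 _ /andP[P1 P2]] := qQ.
have mP j : exists m : int, iter j F x + m%:~R < z <= iter j F x + m%:~R + 1.
  by have [m /andP[m1 m2]] := floor_shift (z - 1) (iter j F x); exists m; apply/andP; split; lra.
have [m {}mP] := choice mP.
(* All left ends are first translated into [[z - 1, z)]. *)
have [j jN jmax] := exists_max (fun j => iter j F x + (m j)%:~R) (Q + q).-1.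
have /andP[mj1 mj2] := mP j.
exists j, (m j); split; first lia.
rewrite mj1 leNgt; apply/negP => h.
have big i k : (i <= (Q + q).-1)%N -> iter i F x + k%:~R < z ->
    iter i F x + k%:~R <= iter j F x + (m j)%:~R.
  move=> iN ik; apply: le_trans (jmax i iN); rewrite lerD2l ler_int.
  have /andP[_ mi2] := mP i.
  have : (k%:~R < (m i + 1)%:~R :> R) by rewrite intrD; lra.
  by rewrite ltr_int; lia.
have [jQ|Qj] := ltnP j Q.
  have := big (j + q)%N (m j - p); rewrite addnC iterD intrB => /(_ _ _).
  have e : iter q F (iter j F x) + ((m j)%:~R - p%:~R) = step (iter j F x) + (m j)%:~R.
    by rewrite /step; ring.
  have qj : (q + j <= (Q + q).-1)%N.
    by rewrite -ltnS prednK ?addn_gt0 ?q0 ?orbT// addnC ltn_add2r.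
  rewrite e => /(_ qj h).
  by have := step_gt (iter j F x); lra.
have lt1 : iter j F x + (m j)%:~R < iter (j - Q) F x + (m j + P)%:~R.
  by apply: (orbit_lt _ Fm Fa); rewrite natrB// intrD; lra.
have lt2 : iter (j - Q) F x + (m j + P)%:~R < iter (q + j) F x + (m j - p)%:~R.
  by apply: (orbit_lt _ Fm Fa); rewrite natrB// natrD intrD intrB; lra.
have := big (j - Q)%N (m j + P) (leq_trans (leq_subr _ _) jN).
rewrite iterD intrB in lt2; rewrite /step in h.
have h2 : iter (j - Q) F x + (m j + P)%:~R < z by lra.
by move=> /(_ h2); lra.
Qed.

Lemma gap_min : exists z, forall x, gap z <= gap x.
Proof.
have cg : continuous gap.
  by move=> x; apply: continuousB; [exact: step_continuous|exact: cvg_id].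
have [z z01 zmin] := @EVT_min R gap 0 1 ler01 (continuous_subspaceT cg).
exists z => x; have [m /andP[m1 m2]] := floor_shift 0 x.
rewrite -(gap_int x m); apply: zmin.
by rewrite in_itv/= m1 -[X in _ <= X]add0r ltW.
Qed.

(** [iter i F] maps the arc at [step v] to the shortest arc and its neighbours to arcs that are no
    shorter, so the estimate on three intervals applies on both sides. *)
Lemma gap_near_min z v i m : (forall x, gap z <= gap x) -> (i <= 8 * Q)%N ->
  iter i F (step v) = z + m%:~R ->
  gap (step v) <= 9 * K * gap v /\ gap (step v) <= 9 * K * gap (step (step v)).
Proof.
move=> zmin iQ hi.
have g0 := gap_gt0 z.
have gE u : iter i F (step u) - iter i F u = gap (iter i F u).
  by rewrite iter_step_comm.
have lt3 : step (step (step v)) <= iter 8 step v.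
  by rewrite /=; do 5 apply: (le_trans _ (ltW (step_gt _))).
have bnd : endpoint_bound (iter i F) (diter F dF i) K v (step (step (step v))).
  move=> x y vx xy yv; apply: (endpoint_bound_arcs iQ vx xy).
  exact: le_trans yv lt3.
have K0 : 0 <= K by have := K_ge1; lra.
have h1 : gap z <= iter i F (step v) - iter i F v by rewrite gE.
have h2 : iter i F (step (step v)) - iter i F (step v) = gap z by rewrite gE hi gap_int.
have h3 : gap z <= iter i F (step (step (step v))) - iter i F (step (step v)) by rewrite gE.
split.
  exact: (space_left K0 g0 (step_gt _) (step_gt _) (step_gt _)
    (iter_is_derive i) (@iter_homo_le i) (@diter_ge0 i) bnd h1 h2 h3).
exact: (space_right K0 g0 (step_gt _) (step_gt _) (step_gt _)
  (iter_is_derive i) (@iter_homo_le i) (@diter_ge0 i) bnd h1 h2 h3).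
Qed.

Lemma diter_bound i u : (i <= 8 * Q)%N ->
  diter F dF i u * gap u ^+ 2 * gap (iter i F (step u)) <=
  K * (gap (iter i F u) + gap (iter i F (step u))) ^+ 2 * gap (step u).
Proof.
move=> iQ.
have K0 : 0 <= K by have := K_ge1; lra.
have lt3 : step (step u) <= iter 8 step u.
  by rewrite /=; do 6 apply: (le_trans _ (ltW (step_gt _))).
have bnd : endpoint_bound (iter i F) (diter F dF i) K u (step (step u)).
  move=> x y vx xy yv; apply: (endpoint_bound_arcs iQ vx xy).
  exact: le_trans yv lt3.
have := endpoint_bound_derive K0 (step_gt u) (step_gt (step u)) (iter_is_derive i)
  (@diter_ge0 i) bnd (@iter_homo_le i).
rewrite !iter_step_comm /gap; set v := iter i F u.
by rewrite (_ : step v - v + (step (step v) - step v) = step (step v) - v)//; ring.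
Qed.

Lemma step_surj k y : exists x, iter k step x = y.
Proof.
elim: k y => [|k IH] y; first by exists y.
have [w hw] := iter_surj q (y + p%:~R).
have [x hx] := IH w; exists x.
by rewrite /= hx /step hw addrK.
Qed.

Lemma gap_sandwich t x C : 1 <= C -> t <= x -> x < step t ->
  gap t <= C * gap (step t) ->
  gap (step (step t)) <= C * gap (step t) ->
  gap (step (step (step t))) <= C * gap (step (step t)) ->
  gap (step (step t)) <= C * gap (step (step (step t))) ->
  gap x <= (C + 1) * gap (step t) /\
  gap (step t) <= (K * (1 + C + C ^+ 2) ^+ 2 * C + 1) * gap x.
Proof.
move=> C1 tx xt g01 g21 g32 g23.
have K1 := K_ge1.
have pg0 := gap_gt0 t; have pg1 := gap_gt0 (step t).
have pg2 := gap_gt0 (step (step t)); have pg3 := gap_gt0 (step (step (step t))).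
split.
  have : step x <= step (step t) by apply: step_homo_le; exact: ltW.
  by rewrite mulrDl mul1r; move: g01; rewrite /gap; lra.
set E := K * _ * C.
have K0 : 0 <= K by lra.
have C0 : 0 <= C by lra.
have E0 : 0 <= E by exact: (mulr_ge0 (mulr_ge0 K0 (sqr_ge0 _)) C0).
(* The image of [[u, step (step (step t))]] lies in the three arcs from [step t] on, of lengths at
   most [1], [C] and [C ^+ 2] times [gap (step t)]. *)
have dE u : t <= u -> u <= step t -> diter F dF q u <= E.
  move=> tu ut.
  have lt3 : step (step (step t)) <= iter 8 step t.
    by rewrite /=; do 5 apply: (le_trans _ (ltW (step_gt _))).
  have qQ8 : (q <= 8 * Q)%N.
    have [/andP[_ h] _ _ _] := qQ; apply: leq_trans (ltnW h) _.
    by rewrite leq_pmull.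
  have bnd : endpoint_bound (iter q F) (diter F dF q) K u (step (step (step t))).
    move=> x' y' vx xy yv; apply: (endpoint_bound_arcs qQ8 (w := t)) => //.
      exact: le_trans vx.
    exact: le_trans yv lt3.
  have u2 : u < step (step t) by apply: le_lt_trans ut (step_gt _).
  have := endpoint_bound_derive K0 u2 (step_gt (step (step t))) (iter_is_derive q)
    (@diter_ge0 q) bnd (@iter_homo_le q).
  have eq3 : iter q F (step (step (step t))) - iter q F (step (step t)) = gap (step (step (step t))).
    by rewrite /gap /(step (step (step (step t)))) [in RHS]/step; rewrite /step; ring.
  rewrite eq3 -[step (step (step t)) - step (step t)]/(gap (step (step t))).
  have h1 : (iter q F (step (step (step t))) - iter q F u) ^+ 2 <=
      ((1 + C + C ^+ 2) * gap (step t)) ^+ 2.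
    have h : iter q F t <= iter q F u by exact: iter_homo_le.
    have h' : iter q F u <= iter q F (step (step (step t))).
      by apply: iter_homo_le; apply: le_trans (ltW u2) (ltW (step_gt _)).
    have e1 : iter q F t = step t + p%:~R by rewrite /step subrK.
    have e2 : iter q F (step (step (step t))) = step (step (step (step t))) + p%:~R.
      by rewrite [in RHS]/step subrK.
    have h3 : gap (step (step (step t))) <= C ^+ 2 * gap (step t).
      apply: le_trans g32 _; rewrite expr2 -mulrA ler_wpM2l//; lra.
    rewrite ler_sqr ?nnegrE ?subr_ge0//; last first.
      by rewrite mulr_ge0 ?(ltW pg1)// !addr_ge0 ?sqr_ge0//; lra.
    rewrite e2; move: h3 g21; rewrite /gap !mulrDl; lra.
  move=> h.
  have h2 : diter F dF q u * gap (step t) ^+ 2 * gap (step (step (step t))) <=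
    diter F dF q u * (step (step t) - u) ^+ 2 * gap (step (step (step t))).
    rewrite ler_pM2r// ler_wpM2l ?diter_ge0// ler_sqr ?nnegrE ?(ltW pg1)//;
      move: pg1; rewrite /gap; lra.
  have h4 : K * (iter q F (step (step (step t))) - iter q F u) ^+ 2 * gap (step (step t)) <=
     K * ((1 + C + C ^+ 2) * gap (step t)) ^+ 2 * (C * gap (step (step (step t)))).
    apply: ler_pM => //; [|exact: ltW|].
      by rewrite mulr_ge0// sqr_ge0.
    by rewrite ler_wpM2l.
  have : diter F dF q u * (gap (step t) ^+ 2 * gap (step (step (step t)))) <=
      E * (gap (step t) ^+ 2 * gap (step (step (step t)))).
    rewrite mulrA (le_trans h2)// (le_trans h)// (le_trans h4)// le_eqVlt.
    by apply/orP; left; apply/eqP; rewrite /E; ring.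
  by rewrite ler_pM2r// mulr_gt0// exprn_gt0.
have [c /andP[xc ct] hc] := mean_value xt (fun x _ => iter_is_derive q x).
have dc := dE c (le_trans tx (ltW xc)) (ltW ct).
have e1 : step (step t) - step x = diter F dF q c * (step t - x).
  by rewrite -hc /step; ring.
have h1 : step (step t) - step x <= E * (step t - x).
  by rewrite e1 ler_wpM2r// subr_ge0 ltW.
have h2 : step t <= step x by exact: step_homo_le.
have h3 : E * (step t - x) <= E * (step x - x) by rewrite ler_wpM2l//; lra.
by rewrite mulrDl mul1r /gap; lra.
Qed.

(** Pulled back along consecutive returns, the shortest arc yields five adjacent arcs around [x],
    each at most [C] times as long as either neighbour. The sandwich estimate carries this over to
    the arcs at [x] and [step x]; the constant chains the two sandwiches with one comparison of
    neighbours. *)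
Lemma real_bounds_pair : let C := 9 * K in
  let B := (C + 1) * C * (K * (1 + C + C ^+ 2) ^+ 2 * C + 1) in
  forall x, gap x <= B * gap (step x) /\ gap (step x) <= B * gap x.
Proof.
move=> C B x; have K1 := K_ge1.
have C1 : 1 <= C by rewrite /C; lra.
have [z zmin] := gap_min.
have [i [m [iQ /andP[h1 h2]]]] := arcs_cover (iter 3 step x) z.
(* [t5] lies between the third and fourth returns of [x]. Going back five returns gives [t], so that
   [x] is in the arc at [t1] and [step x] in the arc at [t2]. *)
have [t5 ht5] := iter_surj i (z + (- m)%:~R).
have [t ht] := step_surj 5 t5.
(* [4 - k] further returns followed by [iter i F] bring the arc to the shortest one; the total time
   is at most [4 * q + Q + q], below [8 * Q]. *)
have near k : (k <= 4)%N -> gap (step (iter k step t)) <= C * gap (iter k step t) /\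
    gap (step (iter k step t)) <= C * gap (step (step (iter k step t))).
  move=> k4.
  apply: (@gap_near_min z (iter k step t) ((4 - k) * q + i) ((4 - k)%N%:Z * p - m)) => //.
    have [/andP[_ lt] _ _ _] := qQ.
    have : ((4 - k) * q <= 4 * Q)%N by apply: leq_mul; [exact: leq_subr|exact: ltnW].
    by move: iQ lt; clear; lia.
  rewrite addnC iterD -iterS.
  have -> : iter ((4 - k) * q) F (iter k.+1 step t) =
      iter (4 - k) step (iter k.+1 step t) + ((4 - k)%N%:Z * p)%:~R.
    by rewrite [in RHS]iter_stepE mulrNz subrK.
  rewrite -iterD addnS subnK// ht iter_degree1_int; last exact: Fm.1.
  by rewrite ht5 intrB mulrNz; ring.
have [g10 g12] := near 0%N isT; have [g21 g23] := near 1%N isT.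
have [g32 g34] := near 2%N isT; have [g43 g45] := near 3%N isT.
have [g54 _] := near 4%N isT.
move: g10 g12 g21 g23 g32 g34 g43 g45 g54 => /=.
set t1 := step t; set t2 := step t1; set t3 := step t2; set t4 := step t3.
move=> g10 g12 g21 g23 g32 g34 g43 g45 g54.
have xt2 : x < t2.
  rewrite ltNge; apply/negP => /= c.
  have : step t4 <= iter 3 step x by rewrite /t4 /t3 /=; do 3 apply: step_homo_le.
  move=> /(iter_homo_le i); rewrite -[step t4]/(iter 5 step t) ht ht5 mulrNz; lra.
have t1x : t1 <= x.
  rewrite leNgt; apply/negP => /= c.
  have : step (iter 3 step x) < step t4 by rewrite /t4 /t3 /t2/=; do 4 apply: step_homo_lt.
  move=> /(iter_homo_lt i); rewrite -[step t4]/(iter 5 step t) ht ht5 mulrNz iter_step_comm; lra.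
have [u1 l1] := gap_sandwich C1 t1x xt2 g12 g32 g43 g34.
have t2x : t2 <= step x by exact: step_homo_le.
have xt3 : step x < t3 by exact: step_homo_lt.
have [u2 l2] := gap_sandwich C1 t2x xt3 g23 g43 g54 g45.
rewrite -/t2 -/t3 in u1 l1 u2 l2.
move: (K * _ * C) @B l1 l2 => E B l1 l2.
have pg x' := ltW (gap_gt0 x').
clearbody C.
split.
- apply: le_trans u1 _; rewrite /B -!mulrA ler_wpM2l; [|lra|].
    lra.
  apply: le_trans g23 _; rewrite ler_wpM2l//; lra.
- apply: le_trans u2 _; rewrite /B -!mulrA ler_wpM2l; [|lra|].
    lra.
  apply: le_trans g32 _; rewrite ler_wpM2l//; lra.
Qed.

Definition geometry_cst := let C := 9 * K in
  (C + 1) * C * (K * (1 + C + C ^+ 2) ^+ 2 * C + 1).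
Local Notation B := geometry_cst.

Lemma B_ge1 : 1 <= B.
Proof.
rewrite /B; have K1 := K_ge1; set C := 9 * K.
have C1 : 1 <= C by rewrite /C; lra.
have E0 : 0 <= K * (1 + C + C ^+ 2) ^+ 2 * C.
  have K0 : 0 <= K by lra.
  have C0 : 0 <= C by lra.
  exact: (mulr_ge0 (mulr_ge0 K0 (sqr_ge0 _)) C0).
rewrite -[X in X <= _]mulr1 ler_pM// ?ler01//; last by lra.
by rewrite -[X in X <= _]mulr1 ler_pM// ?ler01//; lra.
Qed.

Lemma gap_step_le x : gap x <= B * gap (step x).
Proof. by have [] := real_bounds_pair x. Qed.

Lemma gap_step_ge x : gap (step x) <= B * gap x.
Proof. by have [] := real_bounds_pair x. Qed.

Lemma gap_arc_le y u : y <= u -> u <= step y -> gap u <= (1 + B) * gap y.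
Proof.
move=> yu uy; have h := step_homo_le uy; have := gap_step_ge y.
by rewrite mulrDl mul1r; move: h; rewrite /gap; lra.
Qed.

Lemma gap_arc_ge y u : y <= u -> u <= step y -> gap y <= B * (1 + B) * gap u.
Proof.
move=> yu uy; apply: le_trans (gap_step_le y) _.
have B1 := B_ge1; rewrite -mulrA ler_wpM2l//; first lra.
apply: gap_arc_le => //; exact: step_homo_le.
Qed.

Definition derivative_cst := K * (1 + B) ^+ 2 * B ^+ 2.

(** Derivatives of iterates are bounded by the ratio of the gaps, from above only: a critical orbit
    excludes a converse. *)
Lemma diter_gap i u : (i <= 8 * Q)%N ->
  diter F dF i u * gap u <= derivative_cst * gap (iter i F u).
Proof.
move=> iQ; have := diter_bound u iQ; rewrite iter_step_comm.
set v := iter i F u; set D := diter F dF i u.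
have B1 := B_ge1; have K1 := K_ge1.
have g0 := gap_gt0 u; have h0 := gap_gt0 v; have h1 := gap_gt0 (step v).
have D0 : 0 <= D by exact: diter_ge0.
move=> h.
have gg : 0 < gap u * gap v by rewrite mulr_gt0.
rewrite -(ler_pM2r gg).
apply: (@le_trans _ _ (D * gap u ^+ 2 * (B * gap (step v)))).
  rewrite [leLHS](_ : _ = D * gap u ^+ 2 * gap v); last by ring.
  by rewrite ler_wpM2l ?gap_step_le// mulr_ge0 ?sqr_ge0.
rewrite mulrCA.
apply: (@le_trans _ _ (B * (K * ((1 + B) * gap v) ^+ 2 * (B * gap u)))).
  rewrite ler_wpM2l//; first lra.
  apply: le_trans h _; apply: ler_pM => //; last exact: gap_step_ge.
  - by rewrite mulr_ge0 ?sqr_ge0//; lra.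
  - exact: ltW (gap_gt0 _).
  - rewrite ler_wpM2l//; first lra.
    rewrite ler_sqr ?nnegrE; [|by rewrite addr_ge0// ltW|by rewrite mulr_ge0 ?ltW//; lra].
    by have := gap_step_ge v; rewrite mulrDl mul1r; lra.
by rewrite le_eqVlt; apply/orP; left; apply/eqP; rewrite /derivative_cst; ring.
Qed.

(** At times less than [Q] apart the left ends are at least one arc apart in the order of the
    rotation, so distinct arcs do not overlap. *)
Lemma arcs_meet x i j m m' : (i < j + Q)%N -> (j < i + Q)%N ->
  iter i F x + m%:~R < step (iter j F x) + m'%:~R ->
  iter j F x + m'%:~R < step (iter i F x) + m%:~R -> i = j.
Proof.
wlog ij : i j m m' / (i <= j)%N.
  move=> W iQ jQ h1 h2; have [ij|ji] := leqP i j; first exact: (W i j m m').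
  by apply/esym; apply: (W j i m' m) => //; exact: ltnW.
move=> iQ jQ h1 h2; apply/eqP; rewrite eqn_leq ij /= leqNgt; apply/negP => lt.
have [_ d0 dmin _] := qQ.
have stepE k k' : step (iter k F x) + k'%:~R = iter (k + q) F x + (k' - p)%:~R.
  by rewrite /step addnC iterD intrB; ring.
rewrite !stepE in h1 h2.
have := dmin (j - i)%N (m - m'); rewrite subn_gt0 lt ltn_subLR// jQ => /(_ isT).
rewrite natrB// intrB ler_normr => /orP[h|h].
  have := @orbit_le R F a x (i + q) j (m - p) m' Fm Fa ia.
  by rewrite natrD intrB => h3; have := h3; lra.
have := @orbit_le R F a x (j + q) i (m' - p) m Fm Fa ia.
by rewrite natrD intrB => h3; have := h3; lra.
Qed.

End return_pair.
End real_bounds.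

Section mesh.
Context {R : realType}.
Variables (F dF Th : R -> R) (V a : R).
Hypothesis FD : distortion_lift F dF Th V.
Hypothesis Fa : tn F a.
Hypothesis ia : irrational a.

(* The next level has rotation less than half of the current one, so that two
   consecutive gaps fit in an old one; as they are comparable, the mesh shrinks
   by a definite factor. This replaces the absence of wandering intervals. *)
Lemma exists_fine_pair e : 0 < e -> exists q p Q P,
  [/\ return_pair a q p Q P, q%:R * a - p%:~R < 10^-1 &
      forall x, gap F q p x < e].
Proof.
move=> e0; pose B := geometry_cst V; have B1 : 1 <= B by exact: (B_ge1 FD).
(* Of two adjacent gaps within a factor [B] of each other, one takes at most this share of their
   sum. *)
pose th := B / (B + 1).
have th0 : 0 <= th by rewrite divr_ge0; lra.
have th1 : th < 1 by rewrite /th ltr_pdivrMr; lra.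
have key n : exists q p Q P, [/\ return_pair a q p Q P, q%:R * a - p%:~R < 10^-1 &
      forall x, gap F q p x <= th ^+ n].
  elim: n => [|n [q [p [Q [P [qQ d10 gle]]]]]].
    have [|q [p [Q [P [qQ d10]]]]] := @exists_return_pair R a 10^-1 ia; first lra.
    exists q, p, Q, P; split=> // x; rewrite expr0.
    exact: (gap_le1 FD Fa ia qQ d10).
  have [_ d0 _ _] := qQ.
  have d2 : 0 < (q%:R * a - p%:~R) / 2 by rewrite divr_gt0.
  have [q' [p' [Q' [P' [qQ' d']]]]] := exists_return_pair ia d2.
  have d10' : q'%:R * a - p'%:~R < 10^-1 by lra.
  exists q', p', Q', P'; split=> // x.
  have h1 := gap_step_le FD Fa ia qQ' d10' x.
  have h2 : gap F q' p' x + gap F q' p' (step F q' p' x) <= gap F q p x.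
    rewrite /gap addrC subrKA lerD2r.
    rewrite -[step F q' p' (step F q' p' x)]/(iter 2 (step F q' p') x) (iter_stepE FD).
    rewrite /step -mulrNz; apply: (orbit_le _ (dl_mono FD) Fa ia).
    by rewrite natrM !mulrNz intrM; lra.
  have h3 := gle x; rewrite exprS.
  have B0 : 0 < B + 1 by lra.
  rewrite -/B in h1.
  suff : (B + 1) * gap F q' p' x <= B * th ^+ n.
    by rewrite -ler_pdivlMl// /th mulrCA mulrA.
  have : B * (gap F q' p' x + gap F q' p' (step F q' p' x)) <= B * th ^+ n.
    by rewrite ler_wpM2l; lra.
  by rewrite mulrDr mulrDl mul1r; lra.
have [n hn] : exists n, th ^+ n < e.
  have /cvgrPdist_lt/(_ _ e0)[n _ hn] := @cvg_expr R th ltac:(by rewrite ger0_norm).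
  by exists n; have := hn n (leqnn n); rewrite /= sub0r normrN ger0_norm ?exprn_ge0.
have [q [p [Q [P [h1 h2 h3]]]]] := key n.
by exists q, p, Q, P; split=> // x; apply: le_lt_trans (h3 x) hn.
Qed.

End mesh.

(** * Uniqueness of states invariant under transfer *)

Section distance.
Context {R : realType}.
Implicit Types (S : set R) (x y a b : R).

Definition distance_to S x := inf [set `|x - s| | s in S].

Lemma distance_to_lb S x : lbound [set `|x - s| | s in S] 0.
Proof. by move=> _ [s _ <-]. Qed.

Lemma distance_to_le S x s : S s -> distance_to S x <= `|x - s|.
Proof. by move=> Ss; apply: ge_inf; [exists 0; exact: distance_to_lb|exists s]. Qed.

Lemma distance_to_ge0 S x : S !=set0 -> 0 <= distance_to S x.
Proof.
move=> [s Ss]; apply: lb_le_inf; last exact: distance_to_lb.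
by exists `|x - s|, s.
Qed.

Lemma distance_to_lt S x e : S !=set0 -> distance_to S x < e ->
  exists2 s, S s & `|x - s| < e.
Proof.
move=> [s0 Ss0] h; have [|_ [s Ss <-] hs] := inf_lt _ h; last by exists s.
by exists `|x - s0|, s0.
Qed.

Lemma distance_to_eq0 S x : S x -> distance_to S x = 0.
Proof.
move=> Sx; apply/eqP; rewrite eq_le distance_to_ge0 ?andbT; last by exists x.
by apply: le_trans (distance_to_le x Sx) _; rewrite subrr normr0.
Qed.

Lemma distance_to_lipschitz S x y : S !=set0 ->
  distance_to S x <= distance_to S y + `|x - y|.
Proof.
move=> [s0 Ss0]; rewrite -lerBlDr; apply: lb_le_inf; first by exists `|y - s0|, s0.
move=> _ [s Ss <-]; rewrite lerBlDr; apply: le_trans (distance_to_le x Ss) _.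
rewrite (_ : x - s = (y - s) + (x - y)); last by ring.
exact: ler_normD.
Qed.

Lemma distance_to_continuous S : S !=set0 -> continuous (distance_to S).
Proof.
move=> S0 x; apply/cvgrPdist_lt => e e0; near=> y.
have h1 := distance_to_lipschitz x y S0; have h2 := distance_to_lipschitz y x S0.
rewrite distrC in h2; have h3 : `|x - y| < e by near: y; exact: cvgr_dist_lt.
by rewrite ltr_norml; apply/andP; split; lra.
Unshelve. all: by end_near. Qed.

Lemma distance_to_periodic S x : S !=set0 -> (forall s (m : int), S s -> S (s + m%:~R)) ->
  distance_to S (x + 1) = distance_to S x.
Proof.
move=> S0 Sp; suff le y (k : int) : distance_to S (y + k%:~R) <= distance_to S y.
  apply/eqP; rewrite eq_le; apply/andP; split; first exact: (le x 1).
  by have := le (x + 1) (-1); rewrite mulrN1z addrK.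
apply: lb_le_inf; first by have [s Ss] := S0; exists `|y - s|, s.
move=> _ [s Ss <-]; have -> : y - s = y + k%:~R - (s + k%:~R) by ring.
by apply: distance_to_le; exact: Sp.
Qed.

End distance.

(** * Continuous periodic functions *)

Section periodic.
Context {R : realType}.
Implicit Types (f g F G : R -> R) (x y a b e : R) (m : int).

Definition cper f := continuous f /\ forall x, f (x + 1) = f x.

Lemma cper_int f x m : cper f -> f (x + m%:~R) = f x.
Proof.
move=> [_ fp]; have := @periodic_int R f 0 _ x m => ->; first by rewrite mulr0 addr0.
by move=> y; rewrite fp addr0.
Qed.

Lemma cper_cst c : cper (fun=> c).
Proof. by split=> // x; exact: cvg_cst. Qed.

Lemma cperD f g : cper f -> cper g -> cper (fun x => f x + g x).
Proof.
move=> [cf pf] [cg pg]; split=> x; last by rewrite pf pg.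
by apply: continuousD; [exact: cf|exact: cg].
Qed.

Lemma cperM f g : cper f -> cper g -> cper (fun x => f x * g x).
Proof.
move=> [cf pf] [cg pg]; split=> x; last by rewrite pf pg.
by apply: continuousM; [exact: cf|exact: cg].
Qed.

Lemma cperZ c f : cper f -> cper (fun x => c * f x).
Proof. by move=> cf; apply: cperM => //; exact: cper_cst. Qed.

Lemma cperN f : cper f -> cper (fun x => - f x).
Proof.
move=> cf; rewrite (_ : (fun x => - f x) = (fun x => -1 * f x)); first exact: cperZ.
by apply/funext => x; rewrite mulN1r.
Qed.

Lemma cperB f g : cper f -> cper g -> cper (fun x => f x - g x).
Proof. by move=> cf cg; apply: cperD => //; exact: cperN. Qed.

Lemma cper_comp f F : cper f -> continuous F -> degree1 F -> cper (fun x => f (F x)).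
Proof.
move=> [cf pf] cF dF; split=> x; last by rewrite dF pf.
by apply: (@continuous_comp _ _ _ F f); [exact: cF|exact: cf].
Qed.

Lemma cper_sum (f : nat -> R -> R) (r : seq nat) : (forall i, cper (f i)) ->
  cper (fun x => \sum_(i <- r) f i x).
Proof.
move=> cf; elim: r => [|i r IH].
  rewrite (_ : (fun x => _) = (fun=> 0)); first exact: cper_cst.
  by apply/funext => x; rewrite big_nil.
rewrite (_ : (fun x => _) = (fun x => f i x + \sum_(j <- r) f j x)); first exact: cperD.
by apply/funext => x; rewrite big_cons.
Qed.

Lemma cper_max f g : cper f -> cper g -> cper (fun x => Num.max (f x) (g x)).
Proof.
move=> [cf pf] [cg pg]; split=> x; last by rewrite pf pg.
by apply: continuous_max; [exact: cf|exact: cg].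
Qed.

Lemma cper_bounded f : cper f -> exists2 M, 0 < M & forall x, `|f x| <= M.
Proof.
move=> [cf pf]; have [M hM] := periodic_bounded cf pf.
exists (M + 1) => [|x]; last by apply: le_trans (hM x) _; rewrite lerDl.
by have := hM 0; have := normr_ge0 (f 0); lra.
Qed.

Lemma cper_unif f e : cper f -> 0 < e ->
  exists2 d, 0 < d & forall x y, `|x - y| < d -> `|f x - f y| < e.
Proof.
move=> [cf pf] e0.
have e2 : 0 < e / 2 by rewrite divr_gt0.
have near01 : near_covering (`[0, 1]%classic : set R).
  by apply/compact_near_coveringP; exact: segment_compact.
have [d0 /= d00 hd] : \forall d \near (0 : R)^'+, `[0, 1]%classic `<=`
    [set x : R | forall y, `|x - y| < d -> `|f x - f y| < e].
  apply: (near01 _ _ (fun d x => forall y, `|x - y| < d -> `|f x - f y| < e)) => x0 _.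
  have /cvgrPdist_lt/(_ _ e2)/nbhs_ballP[r /= r0 hr] := cf x0.
  have r2 : 0 < r / 2 by rewrite divr_gt0.
  exists (ball x0 (r / 2), [set d | d < r / 2]) => /=.
    split; first exact: nbhsx_ballx.
    exact: nbhs_right_lt.
  move=> [x d] /= [xr dr] y xy.
  have h1 : `|f x0 - f x| < e / 2 by apply: hr; rewrite /= /ball/= in xr *; lra.
  have h2 : `|f x0 - f y| < e / 2.
    apply: hr; rewrite /ball/= in xr *.
    rewrite (_ : x0 - y = (x0 - x) + (x - y)); last by ring.
    apply: le_lt_trans (ler_normD _ _) _; lra.
  rewrite (_ : f x - f y = (f x0 - f y) - (f x0 - f x)); last by ring.
  apply: le_lt_trans (ler_normB _ _) _; lra.
exists (d0 / 2) => [|x y xy]; first by rewrite divr_gt0.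
have [m /andP[m1 m2]] := floor_shift 0 x.
have h2 : 0 < d0 / 2 by rewrite divr_gt0.
have := hd (d0 / 2) _ h2 (x + m%:~R); rewrite /ball/= sub0r normrN gtr0_norm//.
have h3 : d0 / 2 < d0 by lra.
have h4 : (`[0, 1]%classic : set R) (x + m%:~R).
  by rewrite /= in_itv/= m1 ltW//; lra.
move=> /(_ h3 h4 (y + m%:~R)).
rewrite !(cper_int _ _ (conj cf pf)); apply.
by rewrite (_ : x + m%:~R - (y + m%:~R) = x - y)//; ring.
Qed.

Lemma periodic_bump a b c d : a < b -> b <= c -> c < d -> exists f,
  [/\ cper f, (forall x, 0 <= f x <= 1),
      (forall x m, b <= x + m%:~R <= c -> f x = 1) &
      (forall x, f x != 0 -> exists m, a < x + m%:~R < d)].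
Proof.
move=> ab bc cd; pose S := [set s : R | exists m, b <= s + m%:~R <= c].
have S0 : S !=set0 by exists b, 0; rewrite mulr0z addr0 lexx.
pose eta := Num.min (b - a) (d - c).
have eta0 : 0 < eta by rewrite lt_min !subr_gt0 ab.
have dp x : distance_to S (x + 1) = distance_to S x.
  apply: distance_to_periodic => // s k [m hs]; exists (m - k); rewrite intrB.
  by rewrite (_ : s + k%:~R + (m%:~R - k%:~R) = s + m%:~R)//; ring.
exists (fun x => Num.max 0 (1 - eta^-1 * distance_to S x)); split.
- apply: cper_max; first exact: cper_cst.
  apply: cperB; first exact: cper_cst.
  apply: cperZ; split=> //; exact: distance_to_continuous.
- move=> x; rewrite le_max lexx/= ge_max ler01/= gerBl.
  by rewrite mulr_ge0 ?invr_ge0 ?(ltW eta0)// distance_to_ge0.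
- move=> x m h; rewrite distance_to_eq0; last by exists m.
  by rewrite mulr0 subr0 max_r.
- move=> x h.
  have hd : distance_to S x < eta.
    rewrite ltNge; apply: contra h => h; apply/eqP/max_l.
    by rewrite subr_le0 ler_pdivlMl// mulr1.
  have [s [m /andP[h1 h2]]] := distance_to_lt S0 hd.
  rewrite /eta lt_min !ltr_norml => /andP[/andP[h3 h4] /andP[h5 h6]].
  by exists m; apply/andP; split; lra.
Qed.

End periodic.

(** * States on continuous periodic functions *)

Section states.
Context {R : realType}.
Implicit Types (L : (R -> R) -> R) (f g : R -> R).

Record state L : Prop := {
  state_lin : forall c f g, cper f -> cper g ->
    L (fun x => c * f x + g x) = c * L f + L g ;
  state_pos : forall f, cper f -> (forall x, 0 <= f x) -> 0 <= L f ;
  state_one : L (fun=> 1) = 1 }.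

Lemma state0 L : state L -> L (fun=> 0) = 0.
Proof.
move=> sL; have := state_lin sL 1 (cper_cst 0) (cper_cst 0).
by rewrite mulr0 addr0 mul1r => h; apply: (addrI (L (fun=> 0))); rewrite addr0.
Qed.

Lemma stateD L f g : state L -> cper f -> cper g ->
  L (fun x => f x + g x) = L f + L g.
Proof.
move=> sL cf cg; rewrite -[L f]mul1r -(state_lin sL)//.
by congr L; apply/funext => x; rewrite mul1r.
Qed.

Lemma stateZ L c f : state L -> cper f -> L (fun x => c * f x) = c * L f.
Proof.
move=> sL cf; rewrite -[RHS]addr0 -(state0 sL) -(state_lin sL)//; last exact: cper_cst.
by congr L; apply/funext => x; rewrite addr0.
Qed.

Lemma stateB L f g : state L -> cper f -> cper g ->
  L (fun x => f x - g x) = L f - L g.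
Proof.
move=> sL cf cg; rewrite addrC -mulN1r -(state_lin sL)//.
by congr L; apply/funext => x; rewrite mulN1r addrC.
Qed.

Lemma state_cst L c : state L -> L (fun=> c) = c.
Proof.
move=> sL; rewrite -[RHS]mulr1 -(state_one sL) -stateZ//; last exact: cper_cst.
by congr L; apply/funext => x; rewrite mulr1.
Qed.

Lemma state_le L f g : state L -> cper f -> cper g -> (forall x, f x <= g x) -> L f <= L g.
Proof.
move=> sL cf cg fg; rewrite -subr_ge0 -stateB//; apply: (state_pos sL).
  exact: cperB.
by move=> x; rewrite subr_ge0.
Qed.

Lemma state_norm L f c : state L -> cper f ->
  (forall x, `|f x| <= c) -> `|L f| <= c.
Proof.
move=> sL cf h; rewrite ler_norml -(state_cst (- c) sL) -[X in _ && (_ <= X)](state_cst c sL).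
by apply/andP; split; apply: state_le => //; try exact: cper_cst;
  move=> x; have := h x; rewrite ler_norml => /andP[].
Qed.

Lemma state_sum L (f : nat -> R -> R) (r : seq nat) : state L -> (forall i, cper (f i)) ->
  L (fun x => \sum_(i <- r) f i x) = \sum_(i <- r) L (f i).
Proof.
move=> sL cf; elim: r => [|i r IH].
  rewrite big_nil; transitivity (L (fun=> 0)); last exact: state0.
  by congr L; apply/funext => x; rewrite big_nil.
rewrite big_cons -IH -stateD//; last exact: cper_sum.
by congr L; apply/funext => x; rewrite big_cons.
Qed.

End states.

Lemma sum_indic_le1 {R : realType} (P : pred nat) (s e : nat) :
  (forall i j, (s <= i < e)%N -> (s <= j < e)%N -> P i -> P j -> i = j) ->
  \sum_(s <= i < e) (P i)%:R <= 1 :> R.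
Proof.
move=> u; have [[i [/andP[si ie] Pi]]|h] := pselect (exists i, (s <= i < e)%N /\ P i).
  rewrite (bigD1_seq i) ?iota_uniq ?mem_index_iota ?si ?ie//= Pi.
  rewrite big_seq_cond big1 ?addr0// => j /andP[]; rewrite mem_index_iota => je ji.
  have -> : P j = false; last by [].
  apply/negP => Pj; move/eqP: ji; apply; apply: u => //; by rewrite si.
rewrite big_seq_cond big1 ?ler01// => i; rewrite andbT mem_index_iota => ie.
by have -> : P i = false by apply/negP => Pi; apply: h; exists i.
Qed.

(** * Masses of return arcs and comparison of states *)

Section transfer_states.
Context {R : realType}.
Variables (F dF Th G : R -> R) (V a : R).
Hypothesis FD : distortion_lift F dF Th V.
Hypothesis Fa : tn F a.
Hypothesis ia : irrational a.
Hypothesis cdF : cper dF.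
Hypothesis FK : cancel F G.
Hypothesis GK : cancel G F.
Hypothesis cG : continuous G.

Let Fm : monotone_lift F := dl_mono FD.

Lemma inverse_degree1 : degree1 G.
Proof. by move=> x; apply: (can_inj FK); rewrite GK Fm.1 GK. Qed.

Lemma iter_inverseK n : cancel (iter n G) (iter n F).
Proof. by elim: n => // n IH x; rewrite iterSr iterS GK IH. Qed.

Lemma iter_inverse_degree1 n : degree1 (iter n G).
Proof. by elim: n => [|n IH] x //=; rewrite IH inverse_degree1. Qed.

Lemma iter_inverse_continuous n : continuous (iter n G).
Proof.
elim: n => [|n IH] x; first exact: cvg_id.
by apply: (@continuous_comp _ _ _ (iter n G) G); [exact: IH|exact: cG].
Qed.

Lemma F_continuous : continuous F.
Proof. by move=> x; exact: is_derive_continuous (dl_der FD x). Qed.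

Lemma diter_cper n : cper (diter F dF n).
Proof.
elim: n => [|n IH].
  rewrite (_ : diter _ _ _ = (fun=> 1)); first exact: cper_cst.
  by apply/funext => x; rewrite /diter big_geq.
rewrite (_ : diter _ _ _ = (fun x => diter F dF n x * dF (iter n F x))).
  apply: cperM => //; apply: cper_comp => //; first exact: (iter_continuous FD).
  exact: (monotone_lift_iter n Fm).1.
by apply/funext => x; rewrite /diter big_nat_recr.
Qed.

(* The image under [F] of the vector field [f]; a (-1)-measure is a state which
   is invariant under this action. *)
Definition push n f x := diter F dF n (iter n G x) * f (iter n G x).

Lemma push_cper n f : cper f -> cper (push n f).
Proof.
move=> cf; apply: cperM; apply: cper_comp => //.
- exact: diter_cper.
- exact: iter_inverse_continuous.
- exact: iter_inverse_degree1.
- exact: iter_inverse_continuous.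
- exact: iter_inverse_degree1.
Qed.

Definition push_state L := state L /\ forall f, cper f -> L f = L (push 1 f).

Lemma push_state_iter L n f : push_state L -> cper f -> L f = L (push n f).
Proof.
move=> [sL invL] cf; elim: n => [|n ->].
  by congr L; apply/funext => x; rewrite /push/= /diter big_geq// mul1r.
rewrite invL; last exact: push_cper.
congr L; apply/funext => x; rewrite /push /= -iterSr /=.
rewrite /diter !big_nat1/= big_nat_recr//= -iterS iterSr iter_inverseK; ring.
Qed.

Section pair.
Variables (q : nat) (p : int) (Q : nat) (P : int).
Hypothesis qQ : return_pair a q p Q P.
Hypothesis d10 : q%:R * a - p%:~R < 10^-1.
Local Notation st := (step F q p).
Local Notation gp := (gap F q p).
Local Notation B := (geometry_cst V).
Local Notation N := (Q + q)%N.

Let gp0 x : 0 < gp x. Proof. exact: (gap_gt0 FD Fa qQ x). Qed.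
Let st_lt : {homo st : x y / x < y}. Proof. exact: (step_homo_lt FD q p). Qed.
Let st_gt x : x < st x. Proof. exact: (step_gt FD Fa qQ x). Qed.
Let gp_int x m : gp (x + m%:~R) = gp x. Proof. exact: (gap_int FD q p x m). Qed.
Let N2Q : (N <= 2 * Q)%N.
Proof. by have [/andP[_ h] _ _ _] := qQ; move: h; clear; lia. Qed.

(** All arcs that start within three adjacent ones are comparable to the middle one; this serves the
    supports of the bumps. *)
Lemma gap_three y u : y <= u -> u <= st (st (st y)) ->
  gp u <= B ^+ 2 * (1 + B) * gp (st y) /\ gp (st y) <= B ^+ 2 * (1 + B) * gp u.
Proof.
move=> yu uy.
have ge x := gap_step_ge FD Fa ia qQ d10 x; have le x := gap_step_le FD Fa ia qQ d10 x.
have al := gap_arc_le FD Fa ia qQ d10; have ag := gap_arc_ge FD Fa ia qQ d10.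
have B1 := B_ge1 FD; have B0 : 0 <= B by lra.
have BB x : 0 <= x -> B * x <= B ^+ 2 * x.
  by move=> x0; rewrite expr2 -mulrA -[X in X <= _]mul1r ler_wpM2r// mulr_ge0.
have BB1 x : 0 <= x -> (1 + B) * x <= B ^+ 2 * (1 + B) * x.
  move=> x0; rewrite ler_wpM2r// -[X in X <= _]mul1r ler_wpM2r//; first lra.
  by rewrite -[X in X <= _]mul1r expr2 ler_pM// ler01.
have [u1|u1] := leP u (st y).
  split.
    apply: le_trans (al y u yu u1) _; apply: le_trans (ler_wpM2l _ (le y)) _; first lra.
    rewrite mulrCA -mulrA; apply: BB.
    by rewrite mulr_ge0 ?ltW//; lra.
  apply: le_trans (ge y) (le_trans (ler_wpM2l B0 (ag _ _ yu u1)) _).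
  by rewrite expr2 !mulrA.
have [u2|u2] := leP u (st (st y)).
  split.
    apply: le_trans (al (st y) u (ltW u1) u2) _.
    by apply: BB1; exact: ltW.
  apply: le_trans (ag (st y) u (ltW u1) u2) _.
  rewrite -[leLHS]mulrA -[leRHS]mulrA; apply: BB; rewrite mulr_ge0 ?ltW//; lra.
split.
  apply: le_trans (al _ u (ltW u2) uy) _; apply: le_trans (ler_wpM2l _ (ge (st y))) _; first lra.
  rewrite mulrCA -mulrA; apply: BB.
  by rewrite mulr_ge0 ?ltW//; lra.
apply: le_trans (le (st y)) (le_trans (ler_wpM2l B0 (ag _ _ (ltW u2) uy)) _).
by rewrite expr2 !mulrA.
Qed.

(** Each of the two blocks of [Q] consecutive times contains at most one hit. *)
Lemma sum_hits (H : pred nat) n : (n <= 2 * Q)%N ->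
  (forall i j, (i < j + Q)%N -> (j < i + Q)%N -> H i -> H j -> i = j) ->
  \sum_(0 <= i < n) (H i)%:R <= 2 :> R.
Proof.
move=> nQ u.
have h1 : \sum_(0 <= i < 2 * Q) (H i)%:R <= 2 :> R.
  rewrite (@big_cat_nat _ _ _ Q)//=; last by rewrite leq_pmull.
  have e : 2 = 1 + 1 :> R by ring.
  rewrite e lerD//; apply: sum_indic_le1 => i j h1 h2; apply: u; move: h1 h2; clear; lia.
apply: le_trans h1; rewrite [leRHS](@big_cat_nat _ _ _ n)//= lerDl.
by rewrite sumr_ge0.
Qed.

(** Each support consists of three adjacent arcs, and each of these meets a given point at most
    twice: [6 = 3 * 2]. *)
Lemma arc_overlap (b : nat -> R) y x n : (n <= 2 * Q)%N -> (forall i, 0 <= b i <= 1) ->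
  (forall i, b i != 0 -> exists m : int, iter i F y < x + m%:~R < st (st (st (iter i F y)))) ->
  \sum_(0 <= i < n) b i <= 6.
Proof.
move=> nQ b01 bP.
pose H k i := `[< exists m : int, iter i F (iter k st y) <= x + m%:~R < st (iter i F (iter k st y)) >].
have Hu k : \sum_(0 <= i < n) (H k i)%:R <= 2 :> R.
  apply: sum_hits => // i j ij ji /asboolP[m /andP[m1 m2]] /asboolP[m' /andP[m1' m2']].
  apply: (arcs_meet FD Fa ia qQ (x := iter k st y) (m := - m) (m' := - m') ij ji);
    rewrite !mulrNz; lra.
have e : 6 = 2 + 2 + 2 :> R by ring.
rewrite e; apply: le_trans (lerD (lerD (Hu 0%N) (Hu 1%N)) (Hu 2%N)).
rewrite -!big_split/=; apply: ler_sum => i _.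
have [->|/bP[m /andP[m1 m2]]] := eqVneq (b i) 0; first by rewrite !addr_ge0.
have /andP[_ /le_trans] := b01 i; apply.
have cm k := iter_iter_step_comm FD q p i k y.
have [u1|u1] := ltP (x + m%:~R) (st (iter i F y)).
  have -> : H 0%N i = true by apply/asboolP; exists m; rewrite /= u1 ltW.
  by rewrite -addrA lerDl addr_ge0.
have [u2|u2] := ltP (x + m%:~R) (st (st (iter i F y))).
  have -> : H 1%N i = true by apply/asboolP; exists m; rewrite (cm 1%N)/= u2 u1.
  by rewrite addrAC lerDr addr_ge0.
have -> : H 2%N i = true by apply/asboolP; exists m; rewrite (cm 2%N)/= m2 u2.
by rewrite lerDr addr_ge0.
Qed.

(** The normalizing constant of a level: an invariant state gives the arc at [y] a mass comparable
    to [(gp y * orbit_sum x)^-1], and the total mass is 1. *)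
Definition orbit_sum x := \sum_(0 <= i < N) (gp (iter i F x))^-1.

Lemma orbit_sum_gt0 x : 0 < orbit_sum x.
Proof.
have [/andP[q0 _] _ _ _] := qQ.
rewrite /orbit_sum big_ltn; last by rewrite addn_gt0 q0 orbT.
by rewrite ltr_wpDr ?invr_gt0// sumr_ge0// => i _; rewrite invr_ge0 ltW.
Qed.

(** Each arc of the orbit of [x] starts in an arc of the orbit of [y], of comparable length, and
    each arc of [y] receives at most two of them. *)
Lemma orbit_sum_le x y : orbit_sum x <= 2 * (B * (1 + B)) * orbit_sum y.
Proof.
pose H i j := `[< exists m : int, iter j F y + m%:~R < iter i F x <= st (iter j F y) + m%:~R >].
have B1 := B_ge1 FD; pose C := B * (1 + B).
have C0 : 0 < C by rewrite /C mulr_gt0; lra.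
rewrite -/C -mulrA /orbit_sum !mulr_sumr.
apply: (@le_trans _ _ (\sum_(0 <= i < N) \sum_(0 <= j < N) (H i j)%:R * (C * (gp (iter j F y))^-1))).
  apply: ler_sum => i _.
  have [j [m [jN jm]]] := arcs_cover FD Fa qQ d10 y (iter i F x).
  have Hij : H i j by apply/asboolP; exists m.
  rewrite (bigD1_seq j) ?iota_uniq ?mem_index_iota//= Hij mul1r.
  apply: ler_wpDr.
    apply: sumr_ge0 => k _; apply: mulr_ge0 => //.
    by apply: mulr_ge0; [exact: ltW|rewrite invr_ge0 ltW].
  have /asboolP[m' /andP[h1 h2]] := Hij.
  have : gp (iter j F y) <= C * gp (iter i F x).
    rewrite -(gp_int _ m'); apply: (gap_arc_ge FD Fa ia qQ d10); first exact: ltW.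
    by rewrite (step_int FD).
  rewrite -ler_pdivrMl// -lef_pV2 ?posrE ?invrK//; last by rewrite mulr_gt0 ?invr_gt0.
  by rewrite invfM invrK.
rewrite exchange_big_nat/=; apply: ler_sum => j _.
rewrite -mulr_suml ler_wpM2r//; first by apply: mulr_ge0; [exact: ltW|rewrite invr_ge0 ltW].
apply: sum_hits => // i i' ii' i'i /asboolP[m /andP[m1 m2]] /asboolP[m' /andP[m1' m2']].
apply: (arcs_meet FD Fa ia qQ (x := x) (m := - m) (m' := - m') ii' i'i).
  have := st_lt m1'; rewrite (step_int FD) mulrNz => ?.
  by rewrite mulrNz; lra.
have := st_lt m1; rewrite (step_int FD) mulrNz => ?.
by rewrite mulrNz; lra.
Qed.

(** The value 1 is taken on the middle arc and the support is spread over three, so that bumps along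
    an orbit add up to at least 1 and still have bounded overlap. *)
Definition bump y f := [/\ cper f, (forall x, 0 <= f x <= 1),
  (forall x (m : int), st y <= x + m%:~R <= st (st y) -> f x = 1) &
  (forall x, f x != 0 -> exists m : int, y < x + m%:~R < st (st (st y)))].

Lemma bump_exists y : exists f, bump y f.
Proof.
by have [f [f1 f2 f3 f4]] := periodic_bump (st_gt y) (ltW (st_gt (st y))) (st_gt (st (st y))); exists f.
Qed.

Let M3 := B ^+ 2 * (1 + B).
Let M2 := 2 * (B * (1 + B)).
Let D := derivative_cst V.

Let D0 : 0 <= D.
Proof.
have B1 := B_ge1 FD; have K1 := K_ge1 FD.
by rewrite /D /derivative_cst mulr_ge0 ?sqr_ge0// mulr_ge0 ?sqr_ge0//; lra.
Qed.

Let M30 : 0 <= M3.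
Proof. by have B1 := B_ge1 FD; rewrite /M3 mulr_ge0 ?sqr_ge0//; lra. Qed.

Let M20 : 0 <= M2.
Proof.
have B1 := B_ge1 FD; have B0 : 0 <= B by exact: le_trans ler01 B1.
exact: (mulr_ge0 (ler0n R 2) (mulr_ge0 B0 (addr_ge0 ler01 B0))).
Qed.

Let N8Q : (N <= 8 * Q)%N.
Proof. by apply: leq_trans N2Q _; rewrite leq_mul2r orbT. Qed.

(** As the arcs cover the circle, the functions [f o iter i F] add up to at least 1. Invariance
    replaces each by its push, which is [f] times a derivative at [iter i G x], and the derivative
    is at most a constant times a ratio of gaps. *)
Lemma bump_lower L y f x0 : push_state L -> bump y f ->
  1 <= D * M3 * M2 * (gp (st y) * orbit_sum x0 * L f).
Proof.
move=> pL; have [sL invL] := pL; move=> [cf f01 f1 fs].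
have c1 i : cper (fun x => f (iter i F x)).
  apply: cper_comp => //; first exact: (iter_continuous FD).
  exact: (monotone_lift_iter i Fm).1.
have cp i : cper (push i (fun x => f (iter i F x))) by exact: push_cper.
have f0 x : 0 <= f x by have /andP[] := f01 x.
apply: (@le_trans _ _ (L (fun x => \sum_(0 <= i < N) f (iter i F x)))).
  rewrite -(state_one sL); apply: state_le => //; [exact: cper_cst|exact: cper_sum|].
  move=> x; have [i [m [iN /andP[h1 h2]]]] := arcs_cover FD Fa qQ d10 x (st (st y)).
  rewrite (bigD1_seq i) ?iota_uniq ?mem_index_iota//= (f1 _ m); last first.
    rewrite (ltW h1) andbT leNgt; apply/negP => /st_lt.
    by rewrite (step_int FD) ltNge h2.
  by rewrite lerDl sumr_ge0.
rewrite state_sum// (eq_bigr (fun i => L (push i (fun x => f (iter i F x))))); last first.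
  by move=> i _; exact: push_state_iter.
rewrite -state_sum// mulrA -stateZ//; apply: state_le => //; [exact: cper_sum|exact: cperZ|].
move=> x; have [fx|fx] := eqVneq (f x) 0.
  rewrite fx mulr0 big1// => i _.
  by rewrite /push iter_inverseK fx mulr0.
have [m /andP[/ltW h1 /ltW h2]] := fs x fx.
have [h3 _] := gap_three h1 h2; rewrite gp_int in h3.
rewrite (eq_bigr (fun i => diter F dF i (iter i G x) * f x)); last first.
  by move=> i _; rewrite /push iter_inverseK.
rewrite -mulr_suml ler_wpM2r//.
apply: (@le_trans _ _ (\sum_(0 <= i < N) D * (M3 * gp (st y)) * (gp (iter i G x))^-1)).
  rewrite big_nat_cond [leRHS]big_nat_cond; apply: ler_sum => i /andP[/andP[_ iN] _].
  rewrite ler_pdivlMr//; apply: le_trans (diter_gap FD Fa ia qQ d10 _ (leq_trans (ltnW iN) N8Q)) _.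
  by rewrite iter_inverseK ler_wpM2l.
rewrite -mulr_sumr.
have -> : D * M3 * M2 * (gp (st y) * orbit_sum x0) = D * (M3 * gp (st y)) * (M2 * orbit_sum x0).
  by ring.
rewrite ler_wpM2l//; first exact: (mulr_ge0 D0 (mulr_ge0 M30 (ltW (gp0 _)))).
apply: le_trans (orbit_sum_le (iter N.-1 G x) x0).
have [/andP[q0 _] _ _ _] := qQ.
have NN : N = N.-1.+1 by rewrite prednK// addn_gt0 q0 orbT.
(* Reversing the sum turns the backward orbit of [x] into the forward orbit of [iter N.-1 G x]. *)
rewrite /orbit_sum big_nat_rev/= add0n big_nat_cond [leRHS]big_nat_cond.
apply: ler_sum => i /andP[/andP[_ iN] _].
rewrite {1}NN subSS.
have -> : iter N.-1 G x = iter i G (iter (N.-1 - i) G x).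
  by rewrite -iterD subnKC// -ltnS -NN.
by rewrite iter_inverseK.
Qed.

(** Now [L f = L (push i f)], where [push i f] is at most [f o iter i G] times a constant and the
    ratio of the gaps at [iter i F (st y)] and [st y]. Weighting by the inverse gap and summing over
    [i] leaves the sum of the [f o iter i G], which is at most 6. *)
Lemma bump_upper L y f x0 : push_state L -> bump y f ->
  gp (st y) * orbit_sum x0 * L f <= D * M3 ^+ 2 * 6 * M2.
Proof.
move=> pL; have [sL invL] := pL; move=> [cf f01 f1 fs].
have f0 x : 0 <= f x by have /andP[] := f01 x.
have c1 i : cper (fun x => f (iter i G x)).
  apply: cper_comp => //; first exact: iter_inverse_continuous.
  exact: iter_inverse_degree1.
have Lf0 : 0 <= L f by apply: (state_pos sL).
have key i : (i < N)%N -> gp (st y) * (gp (iter i F (st y)))^-1 * L f <=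
    D * M3 ^+ 2 * L (fun x => f (iter i G x)).
  move=> iN; rewrite {1}(push_state_iter i pL cf) -!stateZ//; last exact: push_cper.
  apply: state_le => //; [by apply: cperZ; exact: push_cper|exact: cperZ|].
  move=> x; rewrite /push; set u := iter i G x.
  have [->|fu] := eqVneq (f u) 0; first by rewrite !mulr0.
  rewrite mulrA ler_wpM2r//.
  have [m /andP[/ltW h1 /ltW h2]] := fs u fu.
  have [_ h3] := gap_three h1 h2; rewrite gp_int in h3.
  have cm k z : iter i F (iter k st z) = iter k st (iter i F z) := iter_iter_step_comm FD q p i k z.
  have e : iter i F (u + m%:~R) = x + m%:~R.
    by rewrite iter_degree1_int; [rewrite iter_inverseK|exact: Fm.1].
  have h1' := iter_homo_le FD i h1; have h2' := iter_homo_le FD i h2.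
  rewrite e in h1' h2'; rewrite (cm 3%N)/= in h2'.
  have [h4 _] := gap_three h1' h2'; rewrite gp_int in h4.
  have h5 := diter_gap FD Fa ia qQ d10 u (leq_trans (ltnW iN) N8Q).
  rewrite iter_inverseK in h5; rewrite (cm 1%N)/=.
  set w := gp (st (iter i F y)) in h4 *; have w0 : 0 < w by exact: gp0.
  rewrite -mulrA mulrCA -ler_pdivlMl ?invr_gt0// invrK.
  have d0 : 0 <= diter F dF i u by exact: (diter_ge0 FD).
  apply: (@le_trans _ _ (M3 * gp u * diter F dF i u)); first by rewrite ler_wpM2r.
  apply: (@le_trans _ _ (M3 * (D * gp x))).
    by rewrite -mulrA ler_wpM2l// mulrC.
  apply: (@le_trans _ _ (M3 * (D * (M3 * w)))); first by rewrite !ler_wpM2l.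
  by rewrite le_eqVlt; apply/orP; left; apply/eqP; ring.
have h : gp (st y) * orbit_sum (st y) * L f <= D * M3 ^+ 2 * 6.
  rewrite /orbit_sum mulr_sumr mulr_suml.
  apply: (@le_trans _ _ (\sum_(0 <= i < N) D * M3 ^+ 2 * L (fun x => f (iter i G x)))).
    by rewrite big_nat_cond [leRHS]big_nat_cond; apply: ler_sum => i /andP[/andP[_ iN] _]; exact: key.
  rewrite -mulr_sumr ler_wpM2l//; first by rewrite mulr_ge0// sqr_ge0.
  rewrite -state_sum// -[leRHS](state_cst 6 sL); apply: state_le => //.
  - exact: cper_sum.
  - exact: cper_cst.
  - move=> x; apply: (@arc_overlap _ y x) => // i.
    move=> /fs[m /andP[h1 h2]]; exists m.
    have e : iter i F (iter i G x + m%:~R) = x + m%:~R.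
      by rewrite iter_degree1_int; [rewrite iter_inverseK|exact: Fm.1].
    have h1' := iter_homo_lt FD i h1; have h2' := iter_homo_lt FD i h2.
    rewrite e in h1' h2'.
    have := iter_iter_step_comm FD q p i 3 y => /= cm; rewrite cm in h2'.
    by rewrite h1' h2'.
apply: (@le_trans _ _ (M2 * (gp (st y) * orbit_sum (st y) * L f))).
  rewrite [leRHS](_ : _ = gp (st y) * (M2 * orbit_sum (st y)) * L f); last by ring.
  rewrite ler_wpM2r//; apply: ler_wpM2l; first exact: ltW.
  exact: orbit_sum_le.
by rewrite mulrC ler_wpM2r.
Qed.

Lemma bump_compare L L' y f : push_state L -> push_state L' -> bump y f ->
  L f <= (D * M3 ^+ 2 * 6 * M2) * (D * M3 * M2) * L' f.
Proof.
move=> pL pL' bf; have up := bump_upper 0 pL bf; have lo := bump_lower 0 pL' bf.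
have g0 : 0 < gp (st y) * orbit_sum 0 by rewrite mulr_gt0 ?orbit_sum_gt0.
rewrite -(ler_pM2l g0); apply: le_trans up _.
have c0 : 0 <= D * M3 ^+ 2 * 6 * M2.
  exact: (mulr_ge0 (mulr_ge0 (mulr_ge0 D0 (sqr_ge0 _)) (ler0n R 6)) M20).
have := ler_wpM2l c0 lo; rewrite mulr1 => /le_trans; apply.
by rewrite le_eqVlt; apply/orP; left; apply/eqP; ring.
Qed.

(** Discretization at one level: [f] is dominated by a combination of bumps with coefficients close
    to its values. The bumps are compared one by one, and their bounded overlap leads back to
    [f]. *)
Lemma states_compare_pair L L' f e : push_state L -> push_state L' -> cper f ->
  (forall x, 0 <= f x) -> 0 < e ->
  (forall x y, x <= y -> y <= st (st (st x)) -> `|f x - f y| <= e) ->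
  L f <= 6 * ((D * M3 ^+ 2 * 6 * M2) * (D * M3 * M2)) * (L' f + 3 * e).
Proof.
move=> pL pL' cf f0 e0 osc; have [sL _] := pL; have [sL' _] := pL'.
set C := (D * M3 ^+ 2 * 6 * M2) * _.
have C0 : 0 <= C.
  have DM : 0 <= D * M3 ^+ 2 by exact: (mulr_ge0 D0 (sqr_ge0 _)).
  exact: (mulr_ge0 (mulr_ge0 (mulr_ge0 DM (ler0n R 6)) M20) (mulr_ge0 (mulr_ge0 D0 M30) M20)).
have [b bP] := choice (fun i => bump_exists (iter i F 0)).
(* The added [e] covers the oscillation of [f], so that a single bump with value 1 at [x] already
   dominates [f x]. *)
pose w i := f (iter i F (st 0)) + e.
have cb i : cper (b i) by have [] := bP i.
have b01 i x : 0 <= b i x <= 1 by have [_ h _ _] := bP i.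
have w0 i : 0 <= w i by rewrite addr_ge0// ltW.
have oscm i x m : iter i F 0 < x + m%:~R < st (st (st (iter i F 0))) ->
    `|f x - f (iter i F (st 0))| <= 2 * e.
  move=> /andP[h1 h2]; rewrite -(cper_int x m cf).
  have h3 := osc _ _ (ltW h1) (ltW h2).
  have h4 : `|f (iter i F 0) - f (iter i F (st 0))| <= e.
    rewrite (iter_step_comm FD); apply: osc; first exact: ltW.
    by apply: ltW; apply: lt_trans (st_gt _); exact: st_gt.
  rewrite (_ : f (x + m%:~R) - _ = (f (iter i F 0) - f (iter i F (st 0))) -
    (f (iter i F 0) - f (x + m%:~R))); last by ring.
  by apply: le_trans (ler_normB _ _) _; lra.
have cwb i : cper (fun x => w i * b i x) by exact: cperZ.
apply: (@le_trans _ _ (L (fun x => \sum_(0 <= i < N) w i * b i x))).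
  apply: state_le => //; first exact: cper_sum.
  move=> x; have [i [m [iN /andP[h1 h2]]]] := arcs_cover FD Fa qQ d10 (st 0) x.
  have bx : b i x = 1.
    have [_ _ b1 _] := bP i; apply: (b1 x (- m)).
    by rewrite mulrNz -(iter_step_comm FD); apply/andP; split; lra.
  rewrite (bigD1_seq i) ?iota_uniq ?mem_index_iota//= bx mulr1.
  apply: ler_wpDr.
    by apply: sumr_ge0 => k _; rewrite mulr_ge0//; have /andP[] := b01 k x.
  have : `|f (iter i F (st 0)) - f (x + (- m)%:~R)| <= e.
    rewrite mulrNz; apply: osc; first lra.
    apply: (@le_trans _ _ (st (iter i F (st 0)))); first lra.
    by apply: ltW; apply: lt_trans (st_gt _); exact: st_gt.
  by rewrite (cper_int _ _ cf) ler_norml /w => /andP[]; lra.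
rewrite state_sum//.
apply: (@le_trans _ _ (C * L' (fun x => \sum_(0 <= i < N) w i * b i x))).
  rewrite state_sum// mulr_sumr; apply: ler_sum => i _.
  rewrite !stateZ// mulrCA ler_wpM2l//; exact: bump_compare.
rewrite -mulrA mulrCA ler_wpM2l//.
rewrite -(state_cst (3 * e) sL') -stateD//; last exact: cper_cst.
rewrite -stateZ//; last by apply: cperD => //; exact: cper_cst.
apply: state_le => //; first exact: cper_sum.
  by apply: cperZ; apply: cperD => //; exact: cper_cst.
move=> x; have fe0 : 0 <= f x + 3 * e by rewrite addr_ge0// mulr_ge0// ltW.
apply: (@le_trans _ _ ((f x + 3 * e) * \sum_(0 <= i < N) b i x)).
  rewrite mulr_sumr; apply: ler_sum => i _.
  have [->|bx] := eqVneq (b i x) 0; first by rewrite !mulr0.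
  have /andP[bx0 _] := b01 i x; rewrite ler_wpM2r//.
  have [_ _ _ bs] := bP i; have [m hm] := bs x bx.
  by have := oscm i x m hm; rewrite ler_norml /w => /andP[]; lra.
rewrite mulrC ler_wpM2r//; apply: (@arc_overlap _ 0 x) => // i.
by have [_ _ _ bs] := bP i; exact: bs.
Qed.

End pair.
(** The constant [C0] is the same at all levels, so the mesh and [e] can tend to 0 together.
    Enlarging it to at least 2 keeps [C^-1] below 1 for the iteration that follows. *)
Lemma states_compare : exists2 C, 2 <= C & forall L L' f, push_state L -> push_state L' ->
  cper f -> (forall x, 0 <= f x) -> L f <= C * L' f.
Proof.
pose C0 := 6 * (derivative_cst V * (geometry_cst V ^+ 2 * (1 + geometry_cst V)) ^+ 2 * 6 *
  (2 * (geometry_cst V * (1 + geometry_cst V))) *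
  (derivative_cst V * (geometry_cst V ^+ 2 * (1 + geometry_cst V)) *
  (2 * (geometry_cst V * (1 + geometry_cst V))))).
have key L L' f e : push_state L -> push_state L' -> cper f -> (forall x, 0 <= f x) ->
    0 < e -> L f <= C0 * (L' f + 3 * e).
  move=> pL pL' cf f0 e0; have [d d0 hd] := cper_unif cf e0.
  have d3 : 0 < d / 3 by rewrite divr_gt0.
  have [q [p [Q [P [qQ d10 gd]]]]] := exists_fine_pair FD Fa ia d3.
  apply: (states_compare_pair qQ d10 pL pL' cf f0 e0) => x y xy y3.
  apply/ltW/hd; rewrite ler0_norm; last lra.
  by have := gd x; have := gd (step F q p x); have := gd (step F q p (step F q p x)); rewrite /gap; lra.
clearbody C0; exists (2 + `|C0|); first by rewrite lerDl.
move=> L L' f pL pL' cf f0.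
have L'0 : 0 <= L' f by have [sL _] := pL'; exact: (state_pos sL).
apply: (@le_trans _ _ (C0 * L' f)); last first.
  by rewrite ler_wpM2r//; apply: le_trans (ler_norm _) _; rewrite lerDr.
apply/ler_addgt0Pr => e e0; have C1 : 0 < 3 * `|C0| + 1 by rewrite ltr_wpDl// mulr_ge0.
have e1 : 0 < e / (3 * `|C0| + 1) by rewrite divr_gt0.
apply: le_trans (key L L' f _ pL pL' cf f0 e1) _; rewrite mulrDr lerD2l.
rewrite !mulrA ler_pdivrMr// mulrC ler_wpM2l ?(ltW e0)//.
by have := ler_norm C0; lra.
Qed.

(* Iterating [L f <= C * L' f] on the state [(L' - s L) / (1 - s)], [s = 1 / C],
   improves the constant to [1]. *)
Theorem push_state_unique L L' f : push_state L -> push_state L' -> cper f -> L f = L' f.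
Proof.
have [C C2 hC] := states_compare.
pose s := C^-1.
have s0 : 0 < s by rewrite invr_gt0; lra.
have s1 : s < 1 by rewrite invf_lt1; lra.
have key n L1 L2 g : push_state L1 -> push_state L2 -> cper g -> (forall x, 0 <= g x) ->
    (1 - (1 - s) ^+ n) * L1 g <= L2 g.
  elim: n L1 L2 g => [|n IH] L1 L2 g pL1 pL2 cg g0.
    by rewrite expr0 subrr mul0r; have [sL _] := pL2; exact: (state_pos sL).
  have [sL1 iL1] := pL1; have [sL2 iL2] := pL2.
  pose L3 g := (L2 g - s * L1 g) / (1 - s).
  have s10 : 0 < 1 - s by rewrite subr_gt0.
  have pL3 : push_state L3.
    split; first split.
    - move=> c g1 g2 c1 c2; rewrite /L3 !state_lin//; ring.
    - move=> g1 c1 g10; rewrite /L3; apply: divr_ge0; last exact: ltW.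
      rewrite subr_ge0 /s ler_pdivrMl; last lra.
      exact: hC.
    - by rewrite /L3 !state_one// mulr1 divff// gt_eqF.
    - by move=> g1 c1; rewrite /L3 iL1// iL2.
  have := IH _ _ _ pL1 pL3 cg g0; rewrite /L3 ler_pdivlMr// exprS => h.
  rewrite -subr_ge0 in h; rewrite -subr_ge0 (le_trans h)// le_eqVlt.
  by apply/orP; left; apply/eqP; ring.
have le L1 L2 g : push_state L1 -> push_state L2 -> cper g -> (forall x, 0 <= g x) -> L1 g <= L2 g.
  move=> pL1 pL2 cg g0; have [sL1 _] := pL1.
  have L10 : 0 <= L1 g by apply: (state_pos sL1).
  rewrite leNgt; apply/negP => lt.
  have L1g : 0 < L1 g by apply: le_lt_trans lt; have [sL2 _] := pL2; exact: (state_pos sL2).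
  pose e := (L1 g - L2 g) / L1 g; have e0 : 0 < e by rewrite divr_gt0// subr_gt0.
  have [n hn] : exists n, (1 - s) ^+ n < e.
    have := @cvg_expr R (1 - s); rewrite ger0_norm ?subr_ge0 ?ltW// => h.
    have {}h : (1 - s < 1) by lra.
    have /cvgrPdist_lt/(_ _ e0)[n _ hn] := @cvg_expr R (1 - s) ltac:(by rewrite ger0_norm; lra).
    by exists n; have := hn n (leqnn n); rewrite /= sub0r normrN ger0_norm ?exprn_ge0//; lra.
  have := key n L1 L2 g pL1 pL2 cg g0.
  have : (1 - s) ^+ n * L1 g < L1 g - L2 g by rewrite -ltr_pdivlMr.
  by rewrite mulrBl mul1r; lra.
move=> pL pL' cf; have [M M0 hM] := cper_bounded cf.
have cM : cper (fun x => f x + M) by apply: cperD => //; exact: cper_cst.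
have f0 x : 0 <= f x + M by have := hM x; rewrite ler_norml => /andP[]; lra.
have := le L L' _ pL pL' cM f0; have := le L' L _ pL' pL cM f0.
have [sL _] := pL; have [sL' _] := pL'.
rewrite !stateD//; try exact: cper_cst.
rewrite !state_cst// !lerD2r => h1 h2.
by apply/eqP; rewrite eq_le h1 h2.
Qed.

End transfer_states.

(** * Distortion of C^3 maps and of power-law critical points *)

Section local_distortion.
Context {R : realType}.
Implicit Types (g F psi : R -> R) (x y c d : R) (U : set R).

Lemma is_derive_unique g x a b : is_derive x 1 g a -> is_derive x 1 g b -> a = b.
Proof. by move=> [_ <-] [_ <-]. Qed.

Lemma C3_is_derive U g x i : C3_on U g -> U x -> (i < 3)%N ->
  is_derive x 1 (derive1n i g) ((derive1n i.+1 g) x).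
Proof.
move=> g3 Ux i3; have [/(_ i i3) h _] := g3 x Ux.
by apply: (DeriveDef h); rewrite derive1nS derive1E.
Qed.

Lemma C3_is_derive0 U g x : C3_on U g -> U x -> is_derive x 1 g ((derive1n 1 g) x).
Proof. by move=> g3 Ux; have := C3_is_derive g3 Ux (ltn0Sn 2); rewrite derive1n0. Qed.

(* Where [g' <> 0] the geometric mean of [g'] at the ends of an interval is the
   mean slope up to a factor [1 + O(y - x)]. *)
Lemma regular_distortion U g x0 : open U -> U x0 -> C3_on U g -> (derive1n 1 g) x0 != 0 ->
  exists r m C, [/\ 0 < r, 0 < m, 0 <= C, (forall x, `|x - x0| < r -> U x) &
    forall x y, `|x - x0| < r -> `|y - x0| < r -> x < y ->
      `|(derive1n 1 g) x * (derive1n 1 g) y| * (y - x) ^+ 2 <= expR (C * (y - x)) * (g y - g x) ^+ 2 /\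
      m * (y - x) <= `|g y - g x|].
Proof.
move=> oU Ux0 g3 g'0.
have c2 : {for x0, continuous (derive1n 2 g)}.
  exact: is_derive_continuous (C3_is_derive g3 Ux0 (i := 2%N) isT).
have c1 : {for x0, continuous (derive1n 1 g)}.
  exact: is_derive_continuous (C3_is_derive g3 Ux0 (i := 1%N) isT).
have m0 : 0 < `|(derive1n 1 g) x0| / 2 by rewrite divr_gt0// normr_gt0.
set m := `|(derive1n 1 g) x0| / 2 in m0.
have : \forall x \near x0, U x /\ `|(derive1n 2 g) x0 - (derive1n 2 g) x| < 1 /\ `|(derive1n 1 g) x0 - (derive1n 1 g) x| < m.
  near=> x; split; first by near: x; exact: open_nbhs_nbhs.
  by split; near: x; [move/cvgrPdist_lt : c2; apply|move/cvgrPdist_lt : c1; apply].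
move=> /nbhs_ballP[r /= r0 hr].
have hr' x : `|x - x0| < r -> U x /\ `|(derive1n 2 g) x0 - (derive1n 2 g) x| < 1 /\ `|(derive1n 1 g) x0 - (derive1n 1 g) x| < m.
  by rewrite distrC; exact: hr.
pose L := `|(derive1n 2 g) x0| + 1.
have L0 : 0 <= L by rewrite addr_ge0.
have ball_itv x y z : `|x - x0| < r -> `|y - x0| < r -> x <= z <= y -> `|z - x0| < r.
  by rewrite !ltr_norml => /andP[h1 h2] /andP[h3 h4] /andP[h5 h6]; apply/andP; split; lra.
have lip x y : `|x - x0| < r -> `|y - x0| < r -> x < y -> `|(derive1n 1 g) y - (derive1n 1 g) x| <= L * (y - x).
  move=> xr yr xy.
  have [z /andP[xz zy] ->] := @mean_value _ (derive1n 1 g) (derive1n 2 g) x y xy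
    (fun z hz => C3_is_derive g3 (hr' z (ball_itv x y z xr yr hz)).1 (i := 1%N) isT).
  rewrite normrM [X in _ * X]gtr0_norm ?subr_gt0// ler_wpM2r ?subr_ge0 ?(ltW xy)//.
  have zr := ball_itv x y z xr yr; have [_ [h _]] := hr' z (zr ltac:(by rewrite !ltW)).
  rewrite /L -[(derive1n 2 g) z](subKr ((derive1n 2 g) x0)).
  by apply: le_trans (ler_normB _ _) _; lra.
have mle x : `|x - x0| < r -> m <= `|(derive1n 1 g) x|.
  move=> xr; have [_ [_ h]] := hr' x xr.
  have : `|(derive1n 1 g) x0| <= `|(derive1n 1 g) x0 - (derive1n 1 g) x| + `|(derive1n 1 g) x|.
    by rewrite -{1}[(derive1n 1 g) x0](subrK ((derive1n 1 g) x)); exact: ler_normD.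
  by rewrite /m in h *; lra.
exists r, m, (2 * (L / m)); split=> //.
- by rewrite mulr_ge0// divr_ge0// ltW.
- by move=> x /hr'[].
move=> x y xr yr xy.
have [z /andP[xz zy] hz] := @mean_value _ g (derive1n 1 g) x y xy
    (fun z hz => C3_is_derive0 g3 (hr' z (ball_itv x y z xr yr hz)).1).
have zr : `|z - x0| < r by apply: (ball_itv x y) => //; rewrite !ltW.
have mz := mle z zr.
have z0 : 0 < `|(derive1n 1 g) z| by apply: lt_le_trans mz.
have yx0 : 0 < y - x by rewrite subr_gt0.
split; last by rewrite hz normrM (gtr0_norm yx0) ler_wpM2r// ltW.
have step w : `|w - x0| < r -> `|(derive1n 1 g) w - (derive1n 1 g) z| <= L * (y - x) ->
    `|(derive1n 1 g) w| <= `|(derive1n 1 g) z| * expR (L / m * (y - x)).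
  move=> wr hw; apply: (@le_trans _ _ (`|(derive1n 1 g) z| * (1 + L / m * (y - x)))).
    rewrite mulrDr mulr1.
    have : `|(derive1n 1 g) w| <= `|(derive1n 1 g) z| + `|(derive1n 1 g) w - (derive1n 1 g) z|.
      by rewrite -{1}[(derive1n 1 g) w](subrK ((derive1n 1 g) z)) addrC; exact: ler_normD.
    have : L * (y - x) <= `|(derive1n 1 g) z| * (L / m * (y - x)).
      rewrite mulrA ler_wpM2r ?(ltW yx0)// mulrCA -[leLHS]mulr1 ler_wpM2l//.
      by rewrite ler_pdivlMr// mul1r.
    by lra.
  by rewrite ler_wpM2l// expR_ge1Dx.
have hx := step x xr; have hy := step y yr.
have {}hx : `|(derive1n 1 g) x| <= `|(derive1n 1 g) z| * expR (L / m * (y - x)).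
  apply: hx; rewrite distrC; apply: le_trans (lip x z xr zr xz) _.
  by rewrite ler_wpM2l//; lra.
have {}hy : `|(derive1n 1 g) y| <= `|(derive1n 1 g) z| * expR (L / m * (y - x)).
  apply: hy; apply: le_trans (lip z y zr yr zy) _.
  by rewrite ler_wpM2l//; lra.
rewrite hz exprMn -[(derive1n 1 g) z ^+ 2]real_normK ?num_real// [leRHS]mulrA ler_wpM2r ?sqr_ge0// normrM.
apply: le_trans (ler_pM _ _ hx hy) _ => //.
have -> : 2 * (L / m) * (y - x) = L / m * (y - x) + L / m * (y - x) by ring.
by rewrite expRD le_eqVlt; apply/orP; left; apply/eqP; ring.
Unshelve. all: by end_near. Qed.

(** This is [d * sinh s <= sinh (d * s)], up to the factor 2; for the derivatives it says that
    [cosh t <= cosh (d * t)]. *)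
Lemma sinh_le d s : 1 <= d -> 0 <= s ->
  d * (expR s - expR (- s)) <= expR (d * s) - expR (- (d * s)).
Proof.
move=> d1 s0.
pose h (t : R) := expR (d * t) - expR (- (d * t)) - d * (expR t - expR (- t)).
pose h' (t : R) := d * (expR (d * t) + expR (- (d * t))) - d * (expR t + expR (- t)).
have dh (t : R) : is_derive t 1 h (h' t).
  rewrite /h /h'.
  have e1 : is_derive t 1 (fun t : R => d * t) d.
    have -> : (fun t : R => d * t) = d \*: id by [].
    by apply: is_derive_eq; rewrite /GRing.scale/= mulr1.
  have e2 := is_deriveN e1.
  have e3 : is_derive t 1 (fun t : R => expR (d * t)) (expR (d * t) * d).
    exact: (@is_derive1_comp _ expR (fun t : R => d * t)).
  have e4 : is_derive t 1 (fun t : R => expR (- (d * t))) (expR (- (d * t)) * (- d)).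
    exact: (@is_derive1_comp _ expR (fun t : R => - (d * t))).
  have e5 : is_derive t 1 (fun t : R => expR (- t)) (expR (- t) * (- 1)).
    exact: (@is_derive1_comp _ expR (fun t : R => - t)).
  have e6 := is_deriveB (is_deriveB e3 e4) (is_deriveZ d (is_deriveB (is_derive_expR t) e5)).
  by apply: (is_derive_eq e6); rewrite /GRing.scale/=; ring.
have h'0 t : 0 <= t -> 0 <= h' t.
  move=> t0; rewrite /h' -mulrBr mulr_ge0//; first lra.
  have t1 : 1 <= expR t by apply: le_trans (expR_ge1Dx _); lra.
  have t2 : expR t <= expR (d * t) by rewrite ler_expR -[X in X <= _]mul1r ler_wpM2r.
  rewrite !expRN; move: (expR t) (expR (d * t)) t1 t2 => u v u1 uv.
  have u0 : 0 < u by lra. have v0 : 0 < v by lra.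
  have -> : v + v^-1 - (u + u^-1) = (v - u) * (u * v - 1) / (u * v).
    by field; rewrite !gt_eqF.
  rewrite divr_ge0 ?mulr_ge0 ?subr_ge0//; try exact: ltW.
  by rewrite -[X in X <= _]mulr1 ler_pM//; lra.
have := @le_of_derive _ h h' 0 s s0 (fun t _ => dh t) (fun t ht => h'0 t (andP ht).1).
by rewrite /h !mulr0 oppr0 expR0 !subrr mulr0 subrr; lra.
Qed.

(** With [u = exp (M + s)] and [v = exp (M - s)] the powers of [exp M] cancel and the inequality of
    hyperbolic sines remains. *)
Lemma power_distortion_lt d u v : 1 <= d -> 0 < v -> v <= u ->
  d ^+ 2 * (u `^ (d - 1) * v `^ (d - 1)) * (u - v) ^+ 2 <= (u `^ d - v `^ d) ^+ 2.
Proof.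
move=> d1 v0 vu; have u0 : 0 < u by lra.
rewrite /powR !gt_eqF//.
pose s := (ln u - ln v) / 2; pose M := (ln u + ln v) / 2.
have s0 : 0 <= s by rewrite divr_ge0// subr_ge0 ler_ln.
have eu : ln u = M + s by rewrite /M /s; field.
have ev : ln v = M - s by rewrite /M /s; field.
rewrite -{2}[u]lnK ?posrE// -{2}[v]lnK ?posrE// eu ev -expRD.
have -> : (d - 1) * (M + s) + (d - 1) * (M - s) = (d - 1) * M + (d - 1) * M by ring.
have -> : d * (M + s) = d * M + d * s by ring.
have -> : d * (M - s) = d * M + - (d * s) by ring.
rewrite !expRD.
have -> : d ^+ 2 * (expR ((d - 1) * M) * expR ((d - 1) * M)) *
    (expR M * expR s - expR M * expR (- s)) ^+ 2 =
  ((expR ((d - 1) * M) * expR M) * (d * (expR s - expR (- s)))) ^+ 2 by ring.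
have -> : expR ((d - 1) * M) * expR M = expR (d * M).
  by rewrite -expRD; congr expR; ring.
have -> : expR (d * M) * expR (d * s) - expR (d * M) * expR (- (d * s)) =
  expR (d * M) * (expR (d * s) - expR (- (d * s))) by ring.
rewrite !exprMn ler_wpM2l ?sqr_ge0//.
have h := sinh_le d1 s0.
have h0 : 0 <= expR s - expR (- s) by rewrite subr_ge0 ler_expR; lra.
have h1 : 0 <= d * (expR s - expR (- s)) by rewrite mulr_ge0//; lra.
by rewrite -exprMn ler_sqr ?nnegrE// (le_trans h1 h).
Qed.

Lemma power_distortion d u v : 1 <= d -> 0 < u -> 0 < v ->
  d ^+ 2 * (u `^ (d - 1) * v `^ (d - 1)) * (u - v) ^+ 2 <= (u `^ d - v `^ d) ^+ 2.
Proof.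
move=> d1 u0 v0; have [vu|uv] := leP v u; first exact: power_distortion_lt.
have := power_distortion_lt d1 u0 (ltW uv).
by rewrite -(sqrrN (v - u)) -(sqrrN (v `^ d - u `^ d)) !opprB [v `^ _ * _]mulrC.
Qed.

(** Everything is estimated by the larger of the two numbers; the 4 comes from [u + v <= 2 * u]. *)
Lemma power_distortion_opp d u v : 1 <= d -> 0 < u -> 0 < v ->
  u `^ (d - 1) * v `^ (d - 1) * (u + v) ^+ 2 <= 4 * (u `^ d + v `^ d) ^+ 2.
Proof.
move=> d1; wlog vu : u v / v <= u.
  move=> W u0 v0; have [vu|uv] := leP v u; first exact: W.
  by rewrite [X in X * _]mulrC [u + v]addrC [u `^ d + _]addrC; apply: W => //; exact: ltW.
move=> u0 v0.
have e : u `^ d = u `^ (d - 1) * u.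
  rewrite -[X in _ * X](powRr1 (ltW u0)) -powRD; first by rewrite subrK.
  by rewrite (gt_eqF u0) implybT.
apply: (@le_trans _ _ (4 * (u `^ d) ^+ 2)); last first.
  by rewrite ler_wpM2l// ler_sqr ?nnegrE ?addr_ge0 ?powR_ge0// lerDl powR_ge0.
have h1 : v `^ (d - 1) <= u `^ (d - 1).
  have d0 : 0 <= d - 1 by lra.
  by apply: (ge0_ler_powR d0) => //; rewrite nnegrE; exact: ltW.
have h2 : (u + v) ^+ 2 <= (2 * u) ^+ 2 by rewrite ler_sqr ?nnegrE; lra.
apply: (@le_trans _ _ (u `^ (d - 1) * u `^ (d - 1) * (2 * u) ^+ 2)).
  apply: ler_pM; [|exact: sqr_ge0| |exact: h2].
    exact: (mulr_ge0 (powR_ge0 _ _) (powR_ge0 _ _)).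
  by rewrite ler_wpM2l ?powR_ge0.
by rewrite e le_eqVlt; apply/orP; left; apply/eqP; ring.
Qed.

Definition signed_power d u := u * `|u| `^ (d - 1).

Lemma signed_power_gt0 d u : 0 < u -> signed_power d u = u `^ d.
Proof.
move=> u0; rewrite /signed_power gtr0_norm// -[X in X * _](powRr1 (ltW u0)) -powRD.
  by congr (_ `^ _); ring.
by rewrite (gt_eqF u0) implybT.
Qed.

Lemma signed_powerN d u : signed_power d (- u) = - signed_power d u.
Proof. by rewrite /signed_power normrN mulNr. Qed.

(** On one side of the critical point the power map loses nothing; crossing it costs the factor
    [4 * d ^+ 2], which becomes the atom of [Th]. *)
Lemma signed_power_distortion d u v : 1 <= d -> u != 0 -> v != 0 ->
  d ^+ 2 * (`|u| `^ (d - 1) * `|v| `^ (d - 1)) * (v - u) ^+ 2 <=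
  (if 0 < u * v then 1 else 4 * d ^+ 2) * (signed_power d v - signed_power d u) ^+ 2.
Proof.
move=> d1; wlog u0 : u v / 0 < u.
  move=> W u0 v0; have [lt|lt|e] := ltgtP u 0; last by rewrite e eqxx in u0.
    have := W (- u) (- v); rewrite oppr_gt0 oppr_eq0 => /(_ lt u0).
    rewrite oppr_eq0 => /(_ v0); rewrite !normrN !signed_powerN mulrNN.
    by rewrite -(sqrrN (v - u)) -(sqrrN (signed_power d v - _)) !opprB ![- _ - - _]addrC !opprK.
  exact: W.
move=> _ v0; have [lt|lt|e] := ltgtP v 0; last by rewrite e eqxx in v0.
  have -> : (0 < u * v) = false by rewrite pmulr_rgt0// ltNge (ltW lt).
  have w0 : 0 < - v by rewrite oppr_gt0.
  have := power_distortion_opp d1 u0 w0.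
  rewrite (gtr0_norm u0) (ltr0_norm lt) -[in signed_power d v](opprK v) signed_powerN.
  rewrite !signed_power_gt0// => h.
  have -> : (v - u) ^+ 2 = (u + - v) ^+ 2 by ring.
  have -> : (- (- v) `^ d - u `^ d) ^+ 2 = (u `^ d + (- v) `^ d) ^+ 2 by ring.
  have := ler_wpM2l (sqr_ge0 d) h.
  by rewrite -[X in _ -> X <= _]mulrA -[X in _ -> _ <= X]mulrA [X in _ -> _ <= X]mulrCA.
rewrite pmulr_rgt0// lt mul1r !gtr0_norm// !signed_power_gt0//.
have := power_distortion d1 lt u0.
by rewrite [v `^ _ * _]mulrC.
Qed.

Lemma signed_power_is_derive (d u : R) : u != 0 ->
  is_derive u (1 : R) (signed_power d) (d * `|u| `^ (d - 1)).
Proof.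
have pos (w : R) : 0 < w -> is_derive w (1 : R) (signed_power d) (d * `|w| `^ (d - 1)).
  move=> w0; rewrite gtr0_norm//.
  apply: (near_eq_is_derive _ (is_derive1_powR d w0)).
  by near=> z; rewrite signed_power_gt0//; near: z; exact: lt_nbhsr.
move=> u0; have [lt|lt|e] := ltgtP u 0; last by rewrite e eqxx in u0.
  have w0 : 0 < - u by rewrite oppr_gt0.
  have := is_derive_opp (pos _ w0); rewrite normrN.
  by have -> : (fun y => - signed_power d (- y)) = signed_power d
    by apply/funext => y; rewrite signed_powerN opprK.
exact: pos.
Unshelve. all: by end_near. Qed.

Lemma C3_diffeo_derive_neq0 U psi c : open U -> U c -> C3_diffeo_on U psi ->
  derive1n 1 psi c != 0.
Proof.
move=> oU Uc [p3 [chi [_ chi3 chiK]]]; apply/eqP => p0.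
have h1 := C3_is_derive0 p3 Uc.
have h2 : is_derive (psi c) 1 chi (derive1n 1 chi (psi c)).
  by apply: (C3_is_derive0 chi3); exists c.
have h3 := @is_derive1_comp _ chi psi c _ _ h2 h1.
have h4 : is_derive c 1 (chi \o psi) 1.
  apply: (near_eq_is_derive _ (is_derive_id c (1 : R))).
  by near=> z; rewrite /= chiK//; near: z; exact: open_nbhs_nbhs.
have := is_derive_unique h4 h3; rewrite p0 mulr0.
by move/eqP; rewrite oner_eq0.
Unshelve. all: by end_near. Qed.

Lemma signed_power_sign d u : 0 < signed_power d u -> 0 < u.
Proof.
rewrite /signed_power => h; rewrite ltNge; apply/negP => u0.
by move: h; rewrite ltNge mulr_le0_ge0// powR_ge0.
Qed.

(** The normal form composes a power, which only loses at a crossing of [c], with a diffeomorphism,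
    which loses in proportion to the length of the interval. *)
Lemma critical_distortion F c U psi d : C3_on setT F -> {homo F : x y / x < y} ->
  derive1n 1 F c = 0 -> open U -> U c -> C3_diffeo_on U psi ->
  (forall x, U x -> F x = F c + psi x * `|psi x| `^ (d - 1)) ->
  exists r C b, [/\ 0 < r, 0 <= C, 0 <= b & forall x y, `|x - c| < r -> `|y - c| < r -> x < y ->
    derive1n 1 F x * derive1n 1 F y * (y - x) ^+ 2 <=
    expR (C * (y - x) + b * (x < c <= y)%R%:R) * (F y - F x) ^+ 2].
Proof.
move=> F3 Fh F'c oU Uc pdiff FE; have p3 := pdiff.1.
have dF x : is_derive x 1 F (derive1n 1 F x) by exact: (C3_is_derive0 F3).
(* At [x = c] the normal form says that [psi c * |psi c| ^ (d - 1)] vanishes. *)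
have pc0 : psi c = 0.
  have /eqP := FE c Uc; rewrite -subr_eq0 opprD addNKr oppr_eq0 mulf_eq0.
  by case/orP => [/eqP//|]; rewrite powR_eq0 normr_eq0 => /andP[/eqP].
have [r [m [C [r0 m0 C0 rU reg]]]] :=
  regular_distortion oU Uc p3 (C3_diffeo_derive_neq0 oU Uc pdiff).
have FP x y : `|x - c| < r -> `|y - c| < r ->
    F y - F x = signed_power d (psi y) - signed_power d (psi x).
  by move=> /rU xU /rU yU; rewrite (FE y yU) (FE x xU) /signed_power; ring.
have cr : `|c - c| < r by rewrite subrr normr0.
have sp0 : signed_power d (psi c) = 0 by rewrite pc0 /signed_power mul0r.
have pos x : `|x - c| < r -> c < x -> 0 < psi x.
  move=> xr cx; apply: (@signed_power_sign d).
  by have := FP c x cr xr; rewrite sp0; have := Fh _ _ cx; lra.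
have neg x : `|x - c| < r -> x < c -> psi x < 0.
  move=> xr cx; rewrite -oppr_gt0; apply: (@signed_power_sign d).
  by rewrite signed_powerN; have := FP c x cr xr; rewrite sp0; have := Fh _ _ cx; lra.
(* If [d < 1], then just right of [c] one has [psi x <= F x - F c], whereas [psi x] is at least
   [m * (x - c)] and the slope of [F] tends to 0. *)
have d1 : 1 <= d.
  rewrite leNgt; apply/negP => d1.
  have c1 : {for c, continuous (derive1n 1 F)}.
    by apply: (@C3_continuous _ F 1%N).
  have cp : {for c, continuous psi} := is_derive_continuous (C3_is_derive0 p3 Uc).
  have : \forall x \near c, `|psi c - psi x| < 1 /\ `|derive1n 1 F c - derive1n 1 F x| < m.
    by near=> x; split; near: x; [move/cvgrPdist_lt : cp; apply|move/cvgrPdist_lt : c1; apply].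
  move=> /nbhs_ballP[e /= e0 he].
  pose x := c + Num.min e r / 2.
  have mer : 0 < Num.min e r by rewrite lt_min e0.
  have xe : Num.min e r <= e by rewrite ge_min lexx.
  have xr : Num.min e r <= r by rewrite ge_min lexx orbT.
  have cx : c < x by rewrite /x; lra.
  have xcr : `|x - c| < r by rewrite gtr0_norm /x; lra.
  have xce z : c < z -> z <= x -> `|psi c - psi z| < 1 /\ `|derive1n 1 F c - derive1n 1 F z| < m.
    move=> cz zx; apply: he; rewrite /ball/= ltr0_norm; last lra.
    by rewrite /x in zx; lra.
  have [p1 _] := xce x cx (lexx _).
  rewrite pc0 sub0r normrN gtr0_norm ?pos// in p1.
  have := FP c x cr xcr; rewrite sp0 subr0 signed_power_gt0 ?pos// => e1.
  have h1 : psi x <= psi x `^ d.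
    rewrite -[X in X <= _](powRr1 (ltW (pos x xcr cx))).
    by rewrite ger_powR ?(ltW d1)// pos//= ltW.
  have [_ h2] := reg c x cr xcr cx.
  rewrite pc0 subr0 gtr0_norm ?pos// in h2.
  have [z /andP[cz zx] hz] := mean_value cx (fun y _ => dF y).
  have [_ h3] := xce z cz (ltW zx).
  rewrite F'c sub0r normrN in h3.
  have : derive1n 1 F z * (x - c) < m * (x - c).
    by rewrite ltr_pM2r ?subr_gt0// (le_lt_trans (ler_norm _) h3).
  by lra.
have F'E x : `|x - c| < r -> x != c ->
    derive1n 1 F x = d * `|psi x| `^ (d - 1) * derive1n 1 psi x.
  move=> xr xc.
  have px : psi x != 0.
    have [lt|lt|e] := ltgtP x c; last by rewrite e eqxx in xc.
      by rewrite lt_eqF// neg.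
    by rewrite gt_eqF// pos.
  have h1 := @is_derive1_comp _ (signed_power d) psi x _ _ (signed_power_is_derive d px)
    (C3_is_derive0 p3 (rU _ xr)).
  have h2 : is_derive x 1 (cst (F c) + (signed_power d \o psi)) (d * `|psi x| `^ (d - 1) * derive1n 1 psi x).
    by apply: is_derive_eq; rewrite add0r.
  have h3 : is_derive x 1 F (d * `|psi x| `^ (d - 1) * derive1n 1 psi x).
    apply: (near_eq_is_derive _ h2).
    near=> z; rewrite -[LHS]/(F c + signed_power d (psi z)) [RHS]FE//.
    near: z; apply: open_nbhs_nbhs; split=> //; exact: rU.
  exact: is_derive_unique (dF x) h3.
have k1 : 1 <= 4 * d ^+ 2.
  have : 1 <= d ^+ 2 by rewrite expr_ge1//; lra.
  by lra.
(* The cost of a crossing, turned into an exponent. *)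
exists r, C, (ln (4 * d ^+ 2)); split=> //; first exact: ln_ge0.
move=> x y xr yr xy.
have [xc|xc] := eqVneq x c.
  by rewrite xc F'c !mul0r mulr_ge0 ?sqr_ge0 ?expR_ge0.
have [yc|yc] := eqVneq y c.
  by rewrite yc F'c mulr0 mul0r mulr_ge0 ?sqr_ge0 ?expR_ge0.
have [h1 _] := reg x y xr yr xy.
have sgn : (0 < psi x * psi y) = ~~ (x < c <= y).
  have [lx|lx] := ltP x c.
    have px := neg x xr lx; have [ly|ly] := leP c y.
      have py : 0 < psi y by apply: pos; rewrite // lt_neqAle eq_sym yc.
      by rewrite nmulr_rgt0// ltNge (ltW py).
    by rewrite nmulr_rgt0// neg.
  have px : 0 < psi x by apply: pos; rewrite // lt_neqAle eq_sym xc.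
  by rewrite pmulr_rgt0//= pos//; lra.
have px : psi x != 0.
  by have [lt|lt|e] := ltgtP x c; [rewrite lt_eqF// neg|rewrite gt_eqF// pos|rewrite e eqxx in xc].
have py : psi y != 0.
  by have [lt|lt|e] := ltgtP y c; [rewrite lt_eqF// neg|rewrite gt_eqF// pos|rewrite e eqxx in yc].
have h2 := signed_power_distortion d1 px py.
rewrite (F'E x)// (F'E y)// (FP x y)//.
set A := d ^+ 2 * (`|psi x| `^ (d - 1) * `|psi y| `^ (d - 1)) in h2.
have A0 : 0 <= A by rewrite /A mulr_ge0 ?sqr_ge0// mulr_ge0 ?powR_ge0.
apply: (@le_trans _ _ (A * (`|derive1n 1 psi x * derive1n 1 psi y| * (y - x) ^+ 2))).
  rewrite [leLHS](_ : _ = A * (derive1n 1 psi x * derive1n 1 psi y * (y - x) ^+ 2)); last first.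
    by rewrite /A; ring.
  by rewrite ler_wpM2l// ler_wpM2r ?sqr_ge0// ler_norm.
apply: (@le_trans _ _ (A * (expR (C * (y - x)) * (psi y - psi x) ^+ 2))).
  by rewrite ler_wpM2l.
rewrite mulrCA expRD -mulrA ler_wpM2l ?expR_ge0//.
apply: (le_trans h2); rewrite ler_wpM2r ?sqr_ge0// sgn.
case: (x < c <= y) => /=; last by rewrite mulr0 expR0.
by rewrite mulr1 lnK ?posrE//; lra.
Unshelve. all: by end_near. Qed.

End local_distortion.

(** * From local to global distortion *)

Section global_distortion.
Context {R : realType}.
Implicit Types (F psi : R -> R) (x y c d : R) (U : set R).
Local Arguments derive1n : simpl never.

(** A distribution function of unit masses at all integer translates of the points of [cs]. *)
Definition crossings (cs : seq R) x : R := \sum_(c <- cs) (Num.floor (x - c))%:~R.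

Lemma crossings_homo cs : {homo crossings cs : x y / x <= y}.
Proof.
move=> x y xy; apply: ler_sum => c _; rewrite ler_int.
by apply: le_floor; rewrite lerD2r.
Qed.

Lemma crossingsD1 cs x : crossings cs (x + 1) = crossings cs x + (size cs)%:R.
Proof.
rewrite /crossings; elim: cs => [|c cs IH]; first by rewrite !big_nil addr0.
rewrite !big_cons IH -[(size (c :: cs))%:R]natr1 (_ : x + 1 - c = (x - c) + 1%:~R); last by ring.
by rewrite floorDrz ?intr_int// intrD intrKfloor; ring.
Qed.

Lemma crossings_gt cs c m x y : c \in cs -> x < c + m%:~R -> c + m%:~R <= y ->
  1 <= crossings cs y - crossings cs x.
Proof.
move=> cs_c xc cy; rewrite /crossings -sumrB (big_rem c)//=.
apply: ler_wpDr.
  apply: sumr_ge0 => c' _; rewrite subr_ge0 ler_int.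
  by apply: le_floor; rewrite lerD2r; lra.
have h1 : m <= Num.floor (y - c) by rewrite floor_ge_int lerBrDl.
have h2 : Num.floor (x - c) < m by rewrite floor_lt_int ltrBlDl.
rewrite -intrB -[X in X <= _]/(1%:~R) ler_int; lia.
Qed.

Lemma increasing_derive_ge0 F x : C3_on setT F -> {homo F : x y / x < y} ->
  0 <= derive1n 1 F x.
Proof.
move=> F3 Fh; rewrite leNgt; apply/negP => F'x.
have c1 : {for x, continuous (derive1n 1 F)} by apply: (@C3_continuous _ F 1%N).
have e0 : 0 < - derive1n 1 F x by rewrite oppr_gt0.
have /cvgrPdist_lt/(_ _ e0)/nbhs_ballP[r /= r0 hr] := c1.
have xr : x < x + r / 2 by rewrite ltrDl divr_gt0.
have [z /andP[xz zx] hz] := mean_value xr (fun y _ => C3_is_derive0 F3 (I : setT y)).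
have := hr z; rewrite /ball/= => /(_ ltac:(rewrite ltr0_norm; lra)).
rewrite ltr_norml => /andP[h1 _].
have := Fh _ _ xr; rewrite -subr_gt0 hz pmulr_lgt0 ?subr_gt0//; lra.
Qed.

Definition normal_form F c := exists (U : set R) psi d,
  [/\ open U, U c, C3_diffeo_on U psi &
      forall x, U x -> F x = F c + psi x * `|psi x| `^ (d - 1)].

Lemma local_distortion F cs x0 : C3_on setT F -> {homo F : x y / x < y} ->
  (forall c, ~ 0 < derive1n 1 F c ->
     (exists2 c0, c0 \in cs & exists m : int, c = c0 + m%:~R) /\ normal_form F c) ->
  exists r C, [/\ 0 < r, 0 <= C & forall x y, `|x - x0| < r -> `|y - x0| < r -> x < y ->
    derive1n 1 F x * derive1n 1 F y * (y - x) ^+ 2 <=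
    expR (C * (y - x + (crossings cs y - crossings cs x))) * (F y - F x) ^+ 2].
Proof.
move=> F3 Fh crit.
have mono x y : x < y -> 0 <= crossings cs y - crossings cs x.
  by move=> xy; rewrite subr_ge0; apply: crossings_homo; exact: ltW.
have [reg|] := pselect (0 < derive1n 1 F x0).
  have [|r [m [C [r0 _ C0 _ h]]]] := @regular_distortion R setT F x0 openT I F3.
    by rewrite gt_eqF.
  exists r, C; split=> // x y xr yr xy; have [{}h _] := h x y xr yr xy.
  apply: (@le_trans _ _ (`|derive1n 1 F x * derive1n 1 F y| * (y - x) ^+ 2)).
    by rewrite ler_wpM2r ?sqr_ge0// ler_norm.
  apply: (le_trans h); rewrite ler_wpM2r ?sqr_ge0// ler_expR ler_wpM2l//.
  by rewrite lerDl mono.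
move=> cr; have [[c0 c0s [m x0E]] [U [psi [d [oU Ux0 pd FE]]]]] := crit x0 cr.
have F'0 : derive1n 1 F x0 = 0.
  apply/eqP; rewrite eq_le increasing_derive_ge0// andbT leNgt; exact/negP.
have [r [C [b [r0 C0 b0 h]]]] := critical_distortion F3 Fh F'0 oU Ux0 pd FE.
exists r, (C + b); split=> //; first exact: addr_ge0.
move=> x y xr yr xy; apply: (le_trans (h x y xr yr xy)).
rewrite ler_wpM2r ?sqr_ge0// ler_expR.
have cr0 := mono x y xy.
have h1 : (x < x0 <= y)%R%:R <= crossings cs y - crossings cs x.
  have [/andP[h1 h2]|_] := boolP (x < x0 <= y)%R; last exact: cr0.
  by apply: (crossings_gt (m := m) c0s); rewrite -x0E.
have := ler_wpM2l b0 h1; have := mulr_ge0 C0 cr0.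
have : 0 <= b * (y - x) by rewrite mulr_ge0// subr_ge0 ltW.
by rewrite mulrDl !mulrDr; lra.
Qed.

(** Short intervals are handled by compactness of a period. Intervals of length at least [rho] have
    images bounded below, so that a crude bound on the derivative suffices there, absorbed in the
    Lebesgue part of [Th]. *)
Theorem distortion_lift_exists F (cs : seq R) : C3_on setT F -> degree1 F -> {homo F : x y / x < y} ->
  (forall c, ~ 0 < derive1n 1 F c ->
     (exists2 c0, c0 \in cs & exists m : int, c = c0 + m%:~R) /\ normal_form F c) ->
  exists Th V, distortion_lift F (derive1n 1 F) Th V.
Proof.
move=> F3 F1 Fh crit; pose dF := derive1n 1 F.
have Fle : {homo F : x y / x <= y}.
  by move=> x y; rewrite le_eqVlt => /predU1P[->//|/Fh/ltW].
have dF_per x : dF (x + 1) = dF x.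
  have h1 : is_derive x 1 (F \o (fun y : R => y + 1)) (dF (x + 1) * 1).
    have h : is_derive x 1 (fun y : R => y + 1) 1.
      have -> : (fun y : R => y + 1) = id + cst 1 by [].
      by apply: is_derive_eq; rewrite addr0.
    exact: (@is_derive1_comp _ F (fun y : R => y + 1) x _ _ (C3_is_derive0 F3 I) h).
  have h2 : is_derive x 1 (F \o (fun y : R => y + 1)) (dF x).
    have -> : F \o (fun y : R => y + 1) = F + cst 1 by apply/funext => y /=; rewrite F1.
    have hF : is_derive x 1 F (dF x) by exact: (C3_is_derive0 F3).
    by apply: is_derive_eq; rewrite addr0.
  by rewrite -[RHS](is_derive_unique h1 h2) mulr1.
have dF0 x : 0 <= dF x by exact: increasing_derive_ge0.
have cdF : continuous dF by apply: (@C3_continuous _ F 1%N).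
have cF : continuous F by have := @C3_continuous _ F 0%N F3 isT.
pose Cr := crossings cs.
have Cr_homo x y : x <= y -> 0 <= Cr y - Cr x by move=> xy; rewrite subr_ge0 crossings_homo.
(* A single parameter is both the range and the inverse of the constant, so that the local estimates
   hold for all small [rho] and compactness applies. *)
pose P (rho : R) x := forall y, x < y -> y < x + rho ->
  dF x * dF y * (y - x) ^+ 2 <= expR (rho^-1 * (y - x + (Cr y - Cr x))) * (F y - F x) ^+ 2.
have near01 : near_covering (`[0, 1]%classic : set R).
  by apply/compact_near_coveringP; exact: segment_compact.
have : \forall rho \near (0 : R)^'+, `[0, 1]%classic `<=` [set x : R | P rho x].
  apply: (near01 _ _ P) => x0 _.
  have [r [C [r0 C0 h]]] := local_distortion x0 F3 Fh crit.
  have r2 : 0 < r / 2 by rewrite divr_gt0.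
  have C1 : 0 < C + 1 by lra.
  have m0 : 0 < Num.min (r / 2) (C + 1)^-1 by rewrite lt_min r2 invr_gt0.
  exists (ball x0 (r / 2), [set rho : R | 0 < rho < Num.min (r / 2) (C + 1)^-1]) => /=.
    split; first exact: nbhsx_ballx.
    near=> rho; apply/andP; split; near: rho; [exact: nbhs_right_gt|exact: nbhs_right_lt].
  move=> [x rho] /= [xr /andP[rho0]]; rewrite lt_min => /andP[h1 h2] y xy yx.
  have xr' : `|x - x0| < r / 2 by rewrite distrC.
  have xr2 : `|x - x0| < r by lra.
  have yr2 : `|y - x0| < r.
    by move: xr'; rewrite !ltr_norml => /andP[h3 h4]; apply/andP; split; lra.
  apply: (le_trans (h x y xr2 yr2 xy)); rewrite ler_wpM2r ?sqr_ge0// ler_expR ler_wpM2r//.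
    by rewrite addr_ge0 ?Cr_homo ?ltW// subr_gt0.
  apply: (@le_trans _ _ (C + 1)); first lra.
  by rewrite -[C + 1]invrK lef_pV2 ?posrE ?invr_gt0// ltW.
case=> e /= e0 he; pose rho := e / 2.
have rho0 : 0 < rho by rewrite divr_gt0.
have Prho x : P rho x.
  have [m /andP[m1 m2]] := floor_shift 0 x.
  have x01 : (`[0, 1]%classic : set R) (x + m%:~R) by rewrite /= in_itv/= m1; lra.
  have := he rho _ rho0 _ x01; rewrite /ball/= sub0r normrN gtr0_norm// => /(_ ltac:(rewrite /rho; lra)).
  move=> hm y xy yx; have := hm (y + m%:~R); rewrite !ltrD2r.
  move=> /(_ xy); rewrite addrAC ltrD2r => /(_ yx).
  have dFm z : dF (z + m%:~R) = dF z.
    by have := @periodic_int R dF 0 _ z m => ->; [rewrite mulr0 addr0|move=> w; rewrite dF_per addr0].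
  have Crm z : Cr (z + m%:~R) = Cr z + m%:~R * (size cs)%:R.
    by apply: periodic_int => w; exact: crossingsD1.
  rewrite !dFm !(degree1_int _ _ F1) !Crm.
  have -> : y + m%:~R - (x + m%:~R) = y - x by ring.
  have -> : Cr y + m%:~R * (size cs)%:R - (Cr x + m%:~R * (size cs)%:R) = Cr y - Cr x by ring.
  by have -> : F y + m%:~R - (F x + m%:~R) = F y - F x by ring.
pose g x := F (x + rho) - F x.
have cg : continuous g.
  move=> x; apply: continuousB; last exact: cF.
  apply: (@continuous_comp _ _ _ (fun x : R => x + rho) F); last exact: cF.
  by apply: continuousD; [exact: cvg_id|exact: cst_continuous].
have [z z01 zmin] := @EVT_min R g 0 1 ler01 (continuous_subspaceT cg).
have gz : 0 < g z by rewrite subr_gt0; apply: Fh; rewrite ltrDl.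
have gmin x : g z <= g x.
  have [m /andP[m1 m2]] := floor_shift 0 x.
  have -> : g x = g (x + m%:~R) by rewrite /g addrAC !(degree1_int _ _ F1); ring.
  by apply: zmin; rewrite in_itv/= m1; lra.
have [M M0] := cper_bounded (conj cdF dF_per); move=> hM.
(* Chosen so that [C2 * rho = M ^+ 2 / g z ^+ 2], where [g z] is the shortest image of an interval
   of length [rho]; then [1 + t <= exp t] suffices. *)
pose C2 := M ^+ 2 / g z ^+ 2 / rho.
have C20 : 0 <= C2 by rewrite !divr_ge0 ?sqr_ge0// ltW.
pose C := rho^-1 + C2.
have C0 : 0 <= C by rewrite addr_ge0// invr_ge0 ltW.
exists (fun x => C * (x + Cr x)), (C * (1 + (size cs)%:R)); split=> //.
- by move=> x; exact: (C3_is_derive0 F3).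
- by move=> x y xy; rewrite ler_wpM2l// lerD// crossings_homo.
- by move=> x; rewrite /Cr crossingsD1; ring.
move=> x y xy yx1; rewrite -/dF.
have -> : C * (y + Cr y) - C * (x + Cr x) = C * (y - x + (Cr y - Cr x)) by ring.
have D0 : 0 <= y - x + (Cr y - Cr x) by rewrite addr_ge0 ?Cr_homo ?ltW// subr_gt0.
have [near|far] := ltP y (x + rho).
  apply: (le_trans (Prho x y xy near)); rewrite ler_wpM2r ?sqr_ge0// ler_expR ler_wpM2r//.
  by rewrite lerDl.
apply: (@le_trans _ _ (M ^+ 2)).
  have h1 : dF x * dF y <= M ^+ 2.
    by rewrite expr2 ler_pM// (le_trans (ler_norm _))//; exact: hM.
  rewrite -[X in _ <= X]mulr1 ler_pM//; first by rewrite mulr_ge0.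
    exact: sqr_ge0.
  by rewrite expr_le1//; lra.
apply: (@le_trans _ _ (expR (C * (y - x + (Cr y - Cr x))) * g z ^+ 2)); last first.
  rewrite ler_wpM2l ?expR_ge0// ler_sqr ?nnegrE; [|exact: ltW|by rewrite subr_ge0 Fle// ltW].
  by apply: le_trans (gmin x) _; rewrite /g lerD2r Fle.
rewrite -ler_pdivrMr; last by rewrite exprn_gt0.
apply: le_trans (expR_ge1Dx _).
have -> : M ^+ 2 / g z ^+ 2 = C2 * rho by rewrite /C2 divfK// gt_eqF.
have : C2 * rho <= C * (y - x + (Cr y - Cr x)).
  apply: ler_pM => //; first exact: ltW.
    by rewrite /C lerDr invr_ge0 ltW.
  by have := Cr_homo x y (ltW xy); lra.
by lra.
Unshelve. all: by end_near. Qed.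

End global_distortion.

(** * Existence of invariant states *)

Section bounded_functions.
Context {R : realType}.

(** The domain of Hahn-Banach is larger than the continuous functions so that the functional has
    values at indicators of half-lines. *)
Definition bounded_pred : {pred R -> R} :=
  fun f => `[< exists M, forall x, `|f x| <= M >].

Lemma bounded_pred_submod : submod_closed bounded_pred.
Proof.
split=> [|a f g /asboolP[M hM] /asboolP[N hN]]; apply/asboolP.
  by exists 0 => x; rewrite normr0.
exists (`|a| * M + N) => x.
by apply: le_trans (ler_normD _ _) _; rewrite normrM lerD// ler_wpM2l.
Qed.

HB.instance Definition _ :=
  GRing.isSubmodClosed.Build R (R -> R) bounded_pred bounded_pred_submod.

Record bfun := BFun {
  bfun_val :> R -> R ;
  bfun_subproof : bfun_val \in bounded_pred }.

HB.instance Definition _ := [isSub for bfun_val].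
HB.instance Definition _ := [Choice of bfun by <:].
HB.instance Definition _ := [SubChoice_isSubLmodule of bfun by <:].

Definition to_bfun (f : R -> R) : bfun := insubd 0 f.

Lemma to_bfunE f : (exists M, forall x, `|f x| <= M) -> to_bfun f = f :> (R -> R).
Proof. by move=> h; rewrite /to_bfun /insubd insubT//; apply/asboolP. Qed.

Lemma bfun_bounded (f : bfun) : exists M, forall x, `|f x| <= M.
Proof. by have /asboolP := bfun_subproof f. Qed.

Lemma cper_to_bfunE f : cper f -> to_bfun f = f :> (R -> R).
Proof. by move=> /cper_bounded[M _ hM]; apply: to_bfunE; exists M. Qed.

End bounded_functions.

(** * Semiconjugacies and translation numbers *)

Section comparison.
Context {R : realType}.
Implicit Types (F G k : R -> R) (a b : R).

Lemma iter_semiconj_le F G k n x : monotone_lift G -> (forall x, k (F x) <= G (k x)) ->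
  k (iter n F x) <= iter n G (k x).
Proof.
move=> Gm h; elim: n => //= n IH.
exact: le_trans (h _) (Gm.2 _ _ IH).
Qed.

Lemma iter_semiconj_ge F G k n x : monotone_lift G -> (forall x, G (k x) <= k (F x)) ->
  iter n G (k x) <= k (iter n F x).
Proof.
move=> Gm h; elim: n => //= n IH.
exact: le_trans (Gm.2 _ _ IH) (h _).
Qed.

(** A map [k] at bounded distance from the identity does not alter linear growth rates; neither
    continuity nor monotonicity of [k] enters. *)
Lemma tn_semiconj_le F G k M a b : monotone_lift G -> tn F a -> tn G b ->
  (forall x, `|k x - x| <= M) -> (forall x, k (F x) <= G (k x)) -> a <= b.
Proof.
move=> Gm Fa Gb kM h; rewrite -subr_le0; apply: (@le0_archimedean _ _ (2 + 2 * M)) => n.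
have := iter_semiconj_le n 0 Gm h; have := Fa n 0; have := Gb n (k 0).
have := kM 0; have := kM (iter n F 0).
rewrite !ler_norml => /andP[? _] /andP[_ ?] /andP[_ ?] /andP[? _] ?.
by rewrite mulrBr; lra.
Qed.

Lemma tn_semiconj_ge F G k M a b : monotone_lift G -> tn F a -> tn G b ->
  (forall x, `|k x - x| <= M) -> (forall x, G (k x) <= k (F x)) -> b <= a.
Proof.
move=> Gm Fa Gb kM h; rewrite -subr_le0; apply: (@le0_archimedean _ _ (2 + 2 * M)) => n.
have := iter_semiconj_ge n 0 Gm h; have := Fa n 0; have := Gb n (k 0).
have := kM 0; have := kM (iter n F 0).
rewrite !ler_norml => /andP[_ ?] /andP[? _] /andP[? _] /andP[_ ?] ?.
by rewrite mulrBr; lra.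
Qed.

Lemma monotone_liftD G t : monotone_lift G -> monotone_lift (fun x => G x + t).
Proof.
move=> [G1 Gh]; split=> [x|x y xy]; first by rewrite G1 addrAC.
by rewrite lerD2r Gh.
Qed.

End comparison.

(** * The sublinear functional of coboundaries *)

Section invariant_states.
Context {R : realType}.
Variables (F dF : R -> R) (a C : R).
Hypothesis Fm : monotone_lift F.
Hypothesis cF : continuous F.
Hypothesis Fa : tn F a.
Hypothesis ia : irrational a.
Hypothesis cdF : cper dF.
Hypothesis taylor : forall x h, `|F (x + h) - F x - dF x * h| <= C * h ^+ 2.

(* A state of the circle whose image under [F] is a (-1)-measure. *)
Definition invariant_state (M : (R -> R) -> R) := state M /\
  forall f, cper f -> M (fun x => f (F x)) = M (fun x => dF x * f x).

Let C0 : 0 <= C.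
Proof.
have := taylor 0 1; rewrite expr1n !mulr1; exact: le_trans (normr_ge0 _).
Qed.

(* If [f o F - dF f >= e > 0], then [id + s f] semiconjugates [F] to a map above
   [F] by a constant, although the rotation number strictly increases. *)
Lemma coboundary_le (f : R -> R) c : cper f -> (forall x, dF x * f x - f (F x) <= c) -> 0 <= c.
Proof.
move=> cf h; rewrite leNgt; apply/negP => c0.
have [B B0 hB] := cper_bounded cf.
(* So small that the quadratic Taylor error is at most half of the linear gain [s * (- c)]; the
   other half is [t]. *)
pose s := - c / (2 * (C * B ^+ 2 + 1)).
have D0 : 0 < C * B ^+ 2 + 1 by rewrite ltr_wpDl// mulr_ge0// sqr_ge0.
have s0 : 0 < s by rewrite divr_gt0 ?oppr_gt0// mulr_gt0.
pose k x := x + s * f x.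
pose t := s * (- c) / 2.
have t0 : 0 < t by rewrite divr_gt0// mulr_gt0// oppr_gt0.
have Gm := monotone_liftD t Fm.
have [b Gb] := tn_exists Gm.
have : b <= a.
  apply: (tn_semiconj_ge (k := k) (M := s * B) Gm Fa Gb) => x.
    by rewrite /k addrC addKr normrM gtr0_norm// ler_wpM2l// ltW.
  have := taylor x (s * f x); rewrite ler_norml => /andP[_ h1].
  have h2 : C * (s * f x) ^+ 2 <= s * (- c) / 2.
    rewrite exprMn.
    have h3 : f x ^+ 2 <= B ^+ 2.
      by rewrite -[f x ^+ 2]real_normK ?num_real// ler_sqr ?nnegrE// ltW.
    apply: (@le_trans _ _ (s * (s * (C * B ^+ 2 + 1)))).
      rewrite mulrCA expr2 -mulrA ler_wpM2l ?(ltW s0)//.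
      rewrite ler_wpM2l ?(ltW s0)//.
      by apply: le_trans (ler_wpM2l C0 h3) _; rewrite lerDl.
    rewrite -mulrA ler_wpM2l ?(ltW s0)// /s le_eqVlt; apply/orP; left; apply/eqP.
    by field; rewrite gt_eqF.
  have := ler_wpM2l (ltW s0) (h x).
  by rewrite /k /t mulrBr; lra.
have : a < b by apply: (tn_strict Fm Gm Fa Gb ia t0) => x.
by lra.
Qed.

(** The inequality is asked on one period only, since indicators of half-lines are not periodic.
    Functionals dominated by [upper_state] thus see only the values on [[0, 1]]. *)
Definition coboundary_set (u : @bfun R) : set R :=
  [set c | exists2 f, cper f & forall x, 0 <= x <= 1 -> u x - f (F x) + dF x * f x <= c].

Definition upper_state (u : bfun) : R := inf (coboundary_set u).

Lemma coboundary_set_lb (u : bfun) (B c : R) : (forall x, - B <= u x) -> coboundary_set u c -> - B <= c.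
Proof.
move=> uB [f cf h].
have : 0 <= c + B; last by lra.
apply: (coboundary_le cf) => x.
have [m /andP[m1 m2]] := floor_shift 0 x.
rewrite add0r in m2; have := h (x + m%:~R); rewrite m1 (ltW m2) => /(_ isT).
rewrite (degree1_int x m Fm.1).
rewrite !(cper_int _ _ cf) (cper_int _ _ cdF).
by have := uB (x + m%:~R); lra.
Qed.

Lemma coboundary_set_cst (u : bfun) B : (forall x, 0 <= x <= 1 -> u x <= B) -> coboundary_set u B.
Proof.
move=> uB; exists (fun=> 0); first exact: cper_cst.
by move=> x x01; rewrite subr0 mulr0 addr0 uB.
Qed.

Lemma coboundary_set_inf u : has_inf (coboundary_set u).
Proof.
have [B uB] := bfun_bounded u; split.
  by exists B; apply: coboundary_set_cst => x _; apply: le_trans (ler_norm _) (uB x).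
exists (- B) => c; apply: coboundary_set_lb => x.
by have := uB x; rewrite ler_norml => /andP[].
Qed.

Lemma upper_state_le u c : coboundary_set u c -> upper_state u <= c.
Proof. by move=> h; apply: ge_inf => //; exact: (coboundary_set_inf u).2. Qed.

Lemma upper_state_sublinear : sublinear upper_state.
Proof.
apply: sublinear_intro => [u v||t u t0].
- rewrite -lerBlDr; apply: lb_le_inf; first exact: (coboundary_set_inf u).1.
  move=> c1 [f1 cf1 h1]; rewrite lerBlDr -lerBlDl.
  apply: lb_le_inf; first exact: (coboundary_set_inf v).1.
  move=> c2 [f2 cf2 h2]; rewrite lerBlDl; apply: upper_state_le.
  exists (fun x => f1 x + f2 x); first exact: cperD.
  move=> x x01; have := h1 x x01; have := h2 x x01.
  have -> : (u + v : bfun) x = u x + v x by [].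
  by rewrite mulrDr; lra.
- apply/eqP; rewrite eq_le; apply/andP; split.
    by apply: upper_state_le; apply: coboundary_set_cst => x _.
  apply: lb_le_inf; first exact: (coboundary_set_inf 0).1.
  move=> c hc; rewrite -oppr0; apply: coboundary_set_lb hc => x.
  by rewrite oppr0.
- rewrite -ler_pdivrMl//; apply: lb_le_inf; first exact: (coboundary_set_inf u).1.
  move=> c [f cf h]; rewrite ler_pdivrMl//; apply: upper_state_le.
  exists (fun x => t * f x); first exact: cperZ.
  move=> x x01; have -> : (t *: u : bfun) x = t * u x by [].
  by rewrite mulrCA -!mulrBr -mulrDr ler_wpM2l ?(ltW t0)// h.
Qed.

Lemma dominated_pos (L : bfun -> R) (u : bfun) : (forall c u v, L (c *: u + v) = c * L u + L v) ->
  (forall u, L u <= upper_state u) -> (forall x, 0 <= x <= 1 -> 0 <= u x) -> 0 <= L u.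
Proof.
move=> Llin Lle u0.
have L0 := linear_functional0 Llin.
have : L (- u) <= 0.
  apply: le_trans (Lle _) _; apply: upper_state_le; apply: coboundary_set_cst => x x01.
  have -> : (- u : bfun) x = - u x by [].
  by rewrite oppr_le0 u0.
by rewrite -[- u]addr0 -scaleN1r Llin L0; lra.
Qed.

Lemma dominated_cst (L : bfun -> R) (u : bfun) (c : R) : (forall c u v, L (c *: u + v) = c * L u + L v) ->
  (forall u, L u <= upper_state u) -> (forall x, 0 <= x <= 1 -> u x = c) -> L u = c.
Proof.
move=> Llin Lle uc.
have L0 := linear_functional0 Llin.
have h1 : L u <= c.
  apply: le_trans (Lle _) _; apply: upper_state_le; apply: coboundary_set_cst => x x01.
  by rewrite uc.
have : L (- u) <= - c.
  apply: le_trans (Lle _) _; apply: upper_state_le; apply: coboundary_set_cst => x x01.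
  have -> : (- u : bfun) x = - u x by [].
  by rewrite uc.
rewrite -[- u]addr0 -scaleN1r Llin L0 => h2.
by apply/eqP; rewrite eq_le h1; lra.
Qed.

(** On [f o F - dF * f] the functional [upper_state] is at most 0, with [f] itself as the
    coboundary; applied to [f] and [- f] this gives equality. *)
Lemma dominated_invariant (L : bfun -> R) : (forall c u v, L (c *: u + v) = c * L u + L v) ->
  (forall u, L u <= upper_state u) -> invariant_state (fun f => L (to_bfun f)).
Proof.
move=> Llin Lle.
have L0 := linear_functional0 Llin.
have lin c f g : cper f -> cper g ->
    L (to_bfun (fun x => c * f x + g x)) = c * L (to_bfun f) + L (to_bfun g).
  move=> cf cg; rewrite -Llin; congr L; apply/val_inj => /=.
  rewrite cper_to_bfunE; last by apply: cperD => //; exact: cperZ.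
  by apply/funext => x; rewrite -[LHS]/(c * f x + g x) -{1}(cper_to_bfunE cf) -{1}(cper_to_bfunE cg).
split; first split => //.
- by move=> f cf f0; apply: dominated_pos => // x _; rewrite cper_to_bfunE.
- apply: dominated_cst => // x _; rewrite cper_to_bfunE//; exact: cper_cst.
have le f : cper f -> L (to_bfun (fun x => f (F x))) <= L (to_bfun (fun x => dF x * f x)).
  move=> cf; have cfF : cper (fun x => f (F x)) by apply: cper_comp => //; exact: Fm.1.
  have cdf : cper (fun x => dF x * f x) by exact: cperM.
  have := lin (-1) _ _ cdf cfF.
  rewrite mulN1r addrC => /eqP; rewrite eq_sym subr_eq => /eqP ->.
  rewrite gerDr; apply: le_trans (Lle _) _; apply: upper_state_le.
  exists f => // x _; rewrite cper_to_bfunE; last by apply: cperD => //; exact: cperZ.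
  by rewrite mulN1r; lra.
move=> f cf; apply/eqP; rewrite eq_le le//=.
have cfF : cper (fun x => f (F x)) by apply: cper_comp => //; exact: Fm.1.
have cdf : cper (fun x => dF x * f x) by exact: cperM.
have := le _ (cperN cf).
have neg g : cper g -> L (to_bfun (fun x => - g x)) = - L (to_bfun g).
  move=> cg; have := lin (-1) _ _ cg (cper_cst 0).
  have -> : to_bfun (fun=> 0 : R) = 0 :> @bfun R.
    by apply/val_inj => /=; rewrite cper_to_bfunE//; exact: cper_cst.
  rewrite L0 addr0 mulN1r => <-; congr (L (to_bfun _)).
  by apply/funext => x; rewrite mulN1r addr0.
rewrite neg// (_ : (fun x => dF x * - f x) = (fun x => - (dF x * f x))); last first.
  by apply/funext => x; rewrite mulrN.
by rewrite neg// lerN2.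
Qed.

Hypothesis unique : forall M M' f, invariant_state M -> invariant_state M' ->
  cper f -> M f = M' f.

(** Hahn-Banach yields an invariant state that attains [upper_state] at [f]. By uniqueness this
    state is [M], so the infimum equals [M f] and is nearly attained by some coboundary. *)
Lemma invariant_state_approx M f e : invariant_state M -> cper f -> 0 < e ->
  exists2 g, cper g & forall x, f x - g (F x) + dF x * g x <= M f + e.
Proof.
move=> iM cf e0.
have [L [Llin Lle Lf]] := Hahn_Banach (to_bfun f) upper_state_sublinear.
have iL := dominated_invariant Llin Lle.
have Mf : M f = upper_state (to_bfun f) by rewrite (unique iM iL cf) Lf.
have [c [g cg h] hc] := @inf_adherent _ _ e e0 (coboundary_set_inf (to_bfun f)).
exists g => // x; rewrite Mf.
have [m /andP[m1 m2]] := floor_shift 0 x.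
rewrite add0r in m2; have := h (x + m%:~R); rewrite m1 (ltW m2) => /(_ isT).
rewrite (degree1_int x m Fm.1).
rewrite !(cper_int _ _ cg) (cper_int _ _ cdF) cper_to_bfunE// (cper_int _ _ cf).
by move=> /le_trans; apply; exact: ltW.
Qed.

End invariant_states.

Section invariant_state_unique.
Context {R : realType}.

Lemma increasing_inverse (F : R -> R) : continuous F -> degree1 F -> {homo F : x y / x < y} ->
  exists G, [/\ cancel F G, cancel G F & continuous G].
Proof.
move=> cF F1 Flt.
have Fs y : exists x, F x = y.
  have [m /andP[m1 m2]] := floor_shift (F 0) y.
  have [|x _ hx] := @intermediate_value _ F 0 1 (y + m%:~R) ler01 cF.
    by rewrite m1/= -[X in F X]add0r F1 ltW.
  by exists (x + (- m)%:~R); rewrite (degree1_int _ _ F1) hx mulrNz addrK.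
have [G GK] := choice Fs.
have FK : cancel F G by move=> x; apply: (inc_inj (le_mono Flt)); rewrite GK.
exists G; split=> // x; apply/cvgrPdist_lt => e e0.
have Gle y z : y <= z -> G y <= G z.
  by move=> yz; rewrite leNgt; apply/negP => /Flt; rewrite !GK; lra.
have h1 : F (G x - e / 2) < x by rewrite -{2}(GK x) Flt//; lra.
have h2 : x < F (G x + e / 2) by rewrite -{1}(GK x) Flt//; lra.
near=> y.
have h3 : F (G x - e / 2) < y by near: y; exact: lt_nbhsr.
have h4 : y < F (G x + e / 2) by near: y; exact: lt_nbhsl.
have := Gle _ _ (ltW h3); have := Gle _ _ (ltW h4); rewrite !FK.
by rewrite ltr_norml => ? ?; apply/andP; split; lra.
Unshelve. all: by end_near. Qed.

Variables (F dF Th : R -> R) (V a : R).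
Hypothesis FD : distortion_lift F dF Th V.
Hypothesis Fa : tn F a.
Hypothesis ia : irrational a.
Hypothesis cdF : cper dF.

(** Precomposition with [F] turns the relation between [f o F] and [dF * f] into invariance under
    [push]. As [f = (f o G) o F], uniqueness passes back to [M]. *)
Lemma invariant_state_unique M M' f : invariant_state F dF M -> invariant_state F dF M' ->
  cper f -> M f = M' f.
Proof.
have [F1 _] := dl_mono FD; have cF : continuous F by exact: F_continuous FD.
have [G [FK GK cG]] := increasing_inverse cF F1 (dl_inj FD).
have key M1 : invariant_state F dF M1 -> push_state F dF G (fun g => M1 (fun x => g (F x))).
  move=> [sM iM]; split; first split.
  - by move=> c g1 g2 c1 c2; rewrite state_lin//; exact: cper_comp.
  - by move=> g cg g0; apply: (state_pos sM) => //; exact: cper_comp.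
  - exact: state_one.
  - move=> g cg; rewrite iM//; congr M1; apply/funext => x.
    by rewrite /push /diter big_nat1 /= FK.
move=> iM iM' cf.
have cfG : cper (fun x => f (G x)) by apply: cper_comp => //; exact: (inverse_degree1 FD FK GK).
have := push_state_unique FD Fa ia cdF FK GK cG (key _ iM) (key _ iM') cfG.
by rewrite (_ : (fun x => f (G (F x))) = f)//; apply/funext => x; rewrite FK.
Qed.

End invariant_state_unique.

(** * Riesz representation on the circle *)

Section riesz.
Context {R : realType}.
Local Notation bfun := (@bfun R).

Lemma probability_of_cdf (D : R -> R) : {homo D : x y / x <= y} ->
  right_continuous D -> (forall t, t < 0 -> D t = 0) -> (forall t, 1 <= t -> D t = 1) ->
  exists P : probability (measurableTypeR R) R,
    forall a b, a <= b -> P `]a, b]%classic = (D b - D a)%:E.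
Proof.
move=> Dh Dr D0 D1.
have DNy : D @ -oo --> (0 : R).
  apply: cvg_near_cst; near=> t; apply: D0; near: t; exact: nbhs_ninfty_lt.
have Dy : D @ +oo --> (1 : R).
  apply: cvg_near_cst; near=> t; apply: D1; near: t; exact: nbhs_pinfty_ge.
have [f fE] : exists f : cumulativeBounded (0 : R) (1 : R), f = D :> (R -> R).
  pose f : cumulativeBounded (0 : R) (1 : R) := HB.pack D
    (isCumulative.Build R _ R D Dh Dr) (isCumulativeBounded.Build R 0 1 D DNy Dy).
  by exists f.
exists (lebesgue_stieltjes_measure f) => a b ab; rewrite -fE.
rewrite /= /lebesgue_stieltjes_measure /= /measure_extension/=.
by rewrite measurable_mu_extE/= ?wlength_itv_bnd//; exact: is_ocitv.
Unshelve. all: by end_near. Qed.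

Lemma cper_integrable (P : probability (measurableTypeR R) R) (f : R -> R)
    (A : set (measurableTypeR R)) : measurable A -> cper f -> P.-integrable A (EFin \o f).
Proof.
move=> mA cf; apply: measurable_bounded_integrable => //.
- by apply: le_lt_trans (probability_le1 P mA) _; exact: ltry.
- by apply: measurable_funTS; apply: measurable_realfun.continuous_measurable_fun; have [] := cf.
- by have [M _ hM] := cper_bounded cf; exists M; split=> [|y My x _]; rewrite ?num_real//;
    apply: le_trans (hM x) (ltW My).
Qed.

(* The shift by [1] makes the first interval catch a possible atom at [0]. *)
Definition stieltjes_sum (f D : R -> R) (n m : nat) :=
  \sum_(0 <= k < m) f ((k%:R - 1) / n.+1%:R) *
    (D ((k.+1%:R - 1) / n.+1%:R) - D ((k%:R - 1) / n.+1%:R)).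

Lemma stieltjes_sum_integral (D f : R -> R) (P : probability (measurableTypeR R) R) n e :
  (forall a b, a <= b -> P `]a, b]%classic = (D b - D a)%:E) ->
  (forall t, t < 0 -> D t = 0) -> (forall t, 1 <= t -> D t = 1) -> cper f ->
  (forall x y, `|x - y| <= n.+1%:R^-1 -> `|f x - f y| <= e) ->
  `|\int[P]_x f x - stieltjes_sum f D n n.+2| <= e.
Proof.
move=> PD D0 D1 cf osc.
pose t k : R := (k%:R - 1) / n.+1%:R.
have n0 : 0 < n.+1%:R :> R by rewrite ltr0n.
have t_le k l : (k <= l)%N -> t k <= t l.
  by move=> kl; rewrite /t ler_pM2r ?invr_gt0// lerD2r ler_nat.
have mI a b : measurable (`]a, b]%classic : set (measurableTypeR R)) by exact: measurable_itv.
have iI (A : set (measurableTypeR R)) (mA : measurable A) := cper_integrable P mA cf.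
have key m : `|\int[P]_(x in `]t 0%N, t m]) f x - stieltjes_sum f D n m| <= e * (D (t m) - D (t 0%N)).
  elim: m => [|m IH].
    by rewrite set_itvoc0 Rintegral_set0 /stieltjes_sum big_geq// !subrr mulr0 normr0.
  have -> : `]t 0%N, t m.+1]%classic = `]t 0%N, t m] `|` `]t m, t m.+1] :> set R.
    rewrite -itv_bndbnd_setU// bnd_simp; [exact: t_le|exact: t_le].
  rewrite Rintegral_setU//; last 2 first.
  - exact: (iI _ (measurableU _ _ (mI _ _) (mI _ _))).
  - apply/disj_setPS => x /= [].
    by rewrite !in_itv/= => /andP[_ h1] /andP[h2 _]; lra.
  rewrite /stieltjes_sum big_nat_recr//= -/(stieltjes_sum f D n m) -/(t m) -/(t m.+1).
  have : `|\int[P]_(x in `]t m, t m.+1]) f x - f (t m) * (D (t m.+1) - D (t m))| <=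
      e * (D (t m.+1) - D (t m)).
    have Pm : fine (P `]t m, t m.+1]%classic) = D (t m.+1) - D (t m).
      by rewrite PD//; exact: t_le.
    have cst c : \int[P]_(x in `]t m, t m.+1]) c = c * (D (t m.+1) - D (t m)).
      by rewrite Rintegral_cst// Pm.
    have h x : x \in `]t m, t m.+1]%R -> `|f x - f (t m)| <= e.
      rewrite in_itv/= => /andP[h1 h2]; apply: osc.
      rewrite gtr0_norm; last by rewrite subr_gt0.
      rewrite lerBlDr; apply: le_trans h2 _.
      by rewrite /t -natr1 le_eqVlt; apply/orP; left; apply/eqP; field; rewrite gt_eqF.
    have icst c := cper_integrable P (mI (t m) (t m.+1)) (cper_cst c).
    have h1 : \int[P]_(x in `]t m, t m.+1]) f x <= \int[P]_(x in `]t m, t m.+1]) (f (t m) + e).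
      apply: le_Rintegral => //; first exact: iI.
      by move=> x /h; rewrite ler_norml => /andP[_]; lra.
    have h2 : \int[P]_(x in `]t m, t m.+1]) (f (t m) - e) <= \int[P]_(x in `]t m, t m.+1]) f x.
      apply: le_Rintegral => //; first exact: iI.
      by move=> x /h; rewrite ler_norml => /andP[+ _]; lra.
    by rewrite !cst mulrDl mulrBl in h1 h2; rewrite ler_norml; apply/andP; split; lra.
  have := IH; rewrite !ler_norml => /andP[? ?] /andP[? ?].
  by apply/andP; split; lra.
have t0 : t 0%N < 0 by rewrite /t sub0r mulN1r oppr_lt0 invr_gt0.
have t1 : t n.+2 = 1 by rewrite /t -natr1 addrK divff// gt_eqF.
have := key n.+2; rewrite t1 D1// D0// subr0 mulr1.
(* The interval from [t 0 < 0] to 1 already has full mass. *)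
suff -> : \int[P]_x f x = \int[P]_(x in `]t 0%N, 1]) f x by [].
have P1 : P `]t 0%N, 1]%classic = 1%E.
  have t01 : t 0%N <= 1 by apply/ltW/(lt_trans t0).
  by rewrite PD// D1// D0// subr0.
rewrite -[in LHS](setUv (`]t 0%N, 1]%classic : set (measurableTypeR R))).
rewrite Rintegral_setU//; first last.
- by apply/disj_setPS; rewrite setICr.
- by apply: iI; rewrite setUv.
- exact: measurableC.
rewrite [X in _ + X](_ : _ = 0) ?addr0//.
apply/eqP; rewrite -normr_le0.
apply: le_trans (le_normr_Rintegral _ _) _; [exact: measurableC|by apply: iI; exact: measurableC|].
have [M M0 hM] := cper_bounded cf.
apply: (@le_trans _ _ (\int[P]_(x in ~` `]t 0%N, 1]) M)).
  have mC : measurable (~` `]t 0%N, 1]%classic : set (measurableTypeR R)) by exact: measurableC.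
  have cM := cper_integrable P mC (cper_cst M).
  apply: le_Rintegral => //.
  apply: (@cper_integrable P (fun x => `|f x|)) => //.
  split=> [x|x]; last by have [_ ->] := cf.
  by apply: (@continuous_comp _ _ _ f); [have [+ _] := cf; exact|exact: norm_continuous].
rewrite Rintegral_cst; last exact: measurableC.
have := probability_setC P (mI (t 0%N) 1); rewrite P1 subee// => PC.
by rewrite [fine _](congr1 fine PC) mulr0.
Qed.

Variable L : bfun -> R.
Hypothesis Llin : forall c u v, L (c *: u + v) = c * L u + L v.
Hypothesis Lpos : forall u : bfun, (forall x, 0 <= x <= 1 -> 0 <= u x) -> 0 <= L u.
Hypothesis Lcst : forall (u : bfun) c, (forall x, 0 <= x <= 1 -> u x = c) -> L u = c.

Definition half_line s : bfun := to_bfun (fun x => (x <= s)%R%:R).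

Lemma half_lineE s x : half_line s x = (x <= s)%R%:R.
Proof.
rewrite to_bfunE//; exists 1 => y.
by case: (y <= s)%R; rewrite ?normr0 ?normr1.
Qed.

Lemma functional0 : L 0 = 0.
Proof. exact: Lcst. Qed.

Lemma functionalD (u v : bfun) : L (u + v) = L u + L v.
Proof. by rewrite -[u]scale1r Llin mul1r scale1r. Qed.

Lemma functionalZ c u : L (c *: u) = c * L u.
Proof. by rewrite -[c *: u]addr0 Llin functional0 addr0. Qed.

Lemma functionalB (u v : bfun) : L (u - v) = L u - L v.
Proof. by rewrite functionalD -scaleN1r functionalZ mulN1r. Qed.

Lemma functional_le (u v : bfun) : (forall x, 0 <= x <= 1 -> u x <= v x) -> L u <= L v.
Proof.
move=> uv; rewrite -subr_ge0 -functionalB; apply: Lpos => x x01.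
by have -> : (v - u : bfun) x = v x - u x by []; rewrite subr_ge0 uv.
Qed.

Lemma functional_dist (u v : bfun) e : (forall x, 0 <= x <= 1 -> `|u x - v x| <= e) -> `|L u - L v| <= e.
Proof.
move=> uv; have ce c x : to_bfun (fun=> c) x = c.
  by rewrite cper_to_bfunE//; exact: cper_cst.
have Lc c : L (to_bfun (fun=> c)) = c by apply: Lcst => x _.
rewrite -functionalB ler_norml -(Lc (- e)) -[X in _ && (_ <= X)](Lc e); apply/andP; split; apply: functional_le => x x01.
  rewrite ce; have -> : (u - v : bfun) x = u x - v x by [].
  by have := uv x x01; rewrite ler_norml => /andP[].
rewrite ce; have -> : (u - v : bfun) x = u x - v x by [].
by have := uv x x01; rewrite ler_norml => /andP[].
Qed.

Let N s := L (half_line s).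

Let N_homo s t : s <= t -> N s <= N t.
Proof.
move=> st; apply: functional_le => x _; rewrite !half_lineE ler_nat.
by case: (leP x s) => // xs; rewrite (le_trans xs st).
Qed.

Let N0 s : s < 0 -> N s = 0.
Proof.
move=> s0; apply: Lcst => x /andP[x0 _]; rewrite half_lineE leNgt.
by rewrite (lt_le_trans s0 x0).
Qed.

Let N1 s : 1 <= s -> N s = 1.
Proof.
by move=> s1; apply: Lcst => x /andP[_ x1]; rewrite half_lineE (le_trans x1 s1).
Qed.

Let N_ge0 s : 0 <= N s.
Proof. by apply: Lpos => x _; rewrite half_lineE ler0n. Qed.

(* The infimum makes the distribution function right-continuous. *)
Let D t := inf [set N s | s in `]t, +oo[%classic].

Let D_inf t : has_inf [set N s | s in `]t, +oo[%classic].
Proof.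
split; first by exists (N (t + 1)), (t + 1) => //=; rewrite in_itv/= andbT ltrDl.
by exists 0 => _ [s _ <-].
Qed.

Let D_le s t : s < t -> D s <= N t.
Proof.
move=> st; apply: ge_inf; first exact: (D_inf s).2.
by exists t => //=; rewrite in_itv/= andbT.
Qed.

Let D_ge s : N s <= D s.
Proof.
apply: lb_le_inf; first exact: (D_inf s).1.
by move=> _ [t /=] + <-; rewrite in_itv/= andbT => /ltW /N_homo.
Qed.

Let D_homo : {homo D : x y / x <= y}.
Proof.
move=> x y xy; apply: lb_le_inf; first exact: (D_inf y).1.
move=> _ [t /=] + <-; rewrite in_itv/= andbT => yt.
exact/D_le/(le_lt_trans xy).
Qed.

Let D_right : right_continuous D.
Proof.
move=> x; apply/cvgrPdist_lt => e e0.
have [_ [s /= + <-]] := inf_adherent e0 (D_inf x).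
rewrite in_itv/= andbT => xs h.
near=> y.
have xy : x < y by near: y; exact: nbhs_right_gt.
have ys : y < s by near: y; exact: nbhs_right_lt.
have h1 := D_homo (ltW xy); have h2 := D_le ys.
rewrite distrC ger0_norm ?subr_ge0// ltrBlDl; apply: le_lt_trans h2 _.
by move: h; rewrite /D addrC.
Unshelve. all: by end_near. Qed.

Let D0 t : t < 0 -> D t = 0.
Proof.
move=> t0; apply/eqP; rewrite eq_le; apply/andP; split.
  rewrite -(@N0 (t / 2)); last by lra.
  by apply: D_le; lra.
by rewrite -(N0 t0); exact: D_ge.
Qed.

Let D1 t : 1 <= t -> D t = 1.
Proof.
move=> t1; apply/eqP; rewrite eq_le; apply/andP; split.
  rewrite -(@N1 (t + 1)); last by lra.
  by apply: D_le; lra.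
by rewrite -(N1 t1); exact: D_ge.
Qed.

Lemma stieltjes_sum_functional (f : R -> R) n e : cper f ->
  (forall x y, `|x - y| <= n.+1%:R^-1 -> `|f x - f y| <= e) ->
  `|L (to_bfun f) - stieltjes_sum f N n n.+2| <= e.
Proof.
move=> cf osc.
pose t k : R := (k%:R - 1) / n.+1%:R.
have n0 : 0 < n.+1%:R :> R by rewrite ltr0n.
have t_le k l : (k <= l)%N -> t k <= t l.
  by move=> kl; rewrite /t ler_pM2r ?invr_gt0// lerD2r ler_nat.
pose u m : bfun := \sum_(0 <= k < m) f (t k) *: (half_line (t k.+1) - half_line (t k)).
have Lu m : L (u m) = stieltjes_sum f N n m.
  elim: m => [|m IH]; first by rewrite /u /stieltjes_sum !big_geq// functional0.
  by rewrite /u /stieltjes_sum !big_nat_recr//= functionalD IH functionalZ functionalB.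
have uS m x : u m.+1 x = u m x + f (t m) * ((x <= t m.+1)%R%:R - (x <= t m)%R%:R).
  rewrite /u big_nat_recr//= -!half_lineE.
  by [].
have key m x : t 0%N < x -> (x <= t m -> `|f x - u m x| <= e) /\ (t m < x -> u m x = 0).
  move=> x0; elim: m => [|m [IH1 IH2]].
    split=> [|_]; first by rewrite leNgt x0.
    by rewrite /u big_geq.
  rewrite uS; have tm := t_le _ _ (leqnSn m).
  split=> h.
    rewrite h; case: (leP x (t m)) => xm; first by rewrite subrr mulr0 addr0 IH1.
    rewrite IH2// add0r subr0 mulr1; apply: osc.
    rewrite gtr0_norm ?subr_gt0// lerBlDr; apply: le_trans h _.
    by rewrite /t -natr1 le_eqVlt; apply/orP; left; apply/eqP; field; rewrite gt_eqF.
  rewrite !leNgt h (le_lt_trans tm h) subrr mulr0 addr0 IH2//.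
  exact: le_lt_trans tm h.
rewrite -Lu; apply: functional_dist => x /andP[x0 x1].
have t0 : t 0%N < x.
  by apply: lt_le_trans x0; rewrite /t sub0r mulN1r oppr_lt0 invr_gt0.
rewrite cper_to_bfunE//; have [+ _] := key n.+2 x t0; apply.
by rewrite /t -natr1 addrK divff// gt_eqF.
Qed.

(** Summation by parts moves the differences onto [f]: these are at most [e], and the jumps [D - N]
    at the nodes add up to at most the total mass 1. *)
Lemma stieltjes_sumB f n e : 0 <= e ->
  (forall x y, `|x - y| <= n.+1%:R^-1 -> `|f x - f y| <= e) ->
  `|stieltjes_sum f D n n.+2 - stieltjes_sum f N n n.+2| <= e.
Proof.
move=> e0 osc.
pose t k : R := (k%:R - 1) / n.+1%:R.
have n0 : 0 < n.+1%:R :> R by rewrite ltr0n.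
have t_lt k : t k < t k.+1.
  by rewrite /t ltr_pM2r ?invr_gt0// ltrD2r ltr_nat.
pose J k := D (t k) - N (t k).
have J0 k : 0 <= J k by rewrite subr_ge0.
have J1 k : J k <= N (t k.+1) - N (t k) by rewrite lerD2r D_le.
have t0 : t 0%N < 0 by rewrite /t sub0r mulN1r oppr_lt0 invr_gt0.
have t1 : t n.+2 = 1 by rewrite /t -natr1 addrK divff// gt_eqF.
have key m : `|stieltjes_sum f D n m - stieltjes_sum f N n m - f (t m) * J m| <= e * N (t m.+1).
  elim: m => [|m IH].
    rewrite /stieltjes_sum !big_geq// /J D0// N0// !subrr mulr0 subrr normr0.
    by rewrite mulr_ge0.
  rewrite /stieltjes_sum !big_nat_recr//= -/(stieltjes_sum f D n m) -/(stieltjes_sum f N n m).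
  rewrite -!/(t _).
  have ft : `|f (t m) - f (t m.+1)| <= e.
    apply: osc; rewrite ltr0_norm ?subr_lt0// opprB.
    by rewrite /t -natr1 le_eqVlt; apply/orP; left; apply/eqP; field; rewrite gt_eqF.
  have h1 : `|(f (t m) - f (t m.+1)) * J m.+1| <= e * (N (t m.+2) - N (t m.+1)).
    by rewrite normrM (ger0_norm (J0 _)) ler_pM.
  rewrite (_ : _ - _ - _ = (stieltjes_sum f D n m - stieltjes_sum f N n m - f (t m) * J m) +
    (f (t m) - f (t m.+1)) * J m.+1); last by rewrite /J; ring.
  by apply: le_trans (ler_normD _ _) _; lra.
have := key n.+2; rewrite /J t1 D1// N1// subrr mulr0 subr0 N1 ?mulr1//.
by rewrite -t1 ltW.
Qed.

Theorem riesz_representation : exists P : probability (measurableTypeR R) R,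
  forall f : R -> R, cper f -> \int[P]_x f x = L (to_bfun f).
Proof.
have [P PD] := probability_of_cdf D_homo D_right D0 D1.
exists P => f cf; apply/eqP; rewrite -subr_eq0 -normr_le0; apply/ler_addgt0Pr => e e0.
rewrite add0r; have e3 : 0 < e / 3 by rewrite divr_gt0.
have [d d0 hd] := cper_unif cf e3.
have [n hn] : exists n, n.+1%:R^-1 < d.
  by exists (Num.truncn d^-1); rewrite invf_plt ?posrE// truncnS_gt.
have osc x y : `|x - y| <= n.+1%:R^-1 -> `|f x - f y| <= e / 3.
  by move=> xy; apply/ltW/hd/(le_lt_trans xy).
have h1 := stieltjes_sum_integral PD D0 D1 cf osc.
have h2 := stieltjes_sum_functional cf osc.
have h3 := stieltjes_sumB (ltW e3) osc.
move: h1 h2 h3; rewrite !ler_norml => /andP[? ?] /andP[? ?] /andP[? ?].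
by apply/andP; split; lra.
Qed.

End riesz.

(** * Functions and measures on the circle *)

Section circle_functions.
Context {R : realType}.
Implicit Types (x y : R) (p : circle R) (f : R -> R) (phi : circle R -> R).

Lemma circle_proj_eqP x y : circle_proj x = circle_proj y <-> exists m : int, x = y + m%:~R.
Proof.
split=> [|[m ->]]; last by rewrite circle_projD (@circle_proj_int _ m%:~R) ?addr0 ?intr_int.
move=> h; have : x - y \in integers R by rewrite Quotient.idealrBE; apply/eqP.
rewrite -[_ \in _]/(x - y \is a Num.int).
by move=> /intrP[m hm]; exists m; rewrite -hm addrC subrK.
Qed.

Lemma repr_circle_proj x : exists m : int, repr (circle_proj x) = x + m%:~R.
Proof. by apply/circle_proj_eqP; rewrite circle_reprK. Qed.

Lemma cper_repr f x : cper f -> f (repr (circle_proj x)) = f x.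
Proof. by move=> cf; have [m ->] := repr_circle_proj x; rewrite cper_int. Qed.

Lemma circle_proj_continuous : continuous (@circle_proj R).
Proof. exact: pi_continuous. Qed.

Lemma circle_continuousP (Z : topologicalType) (f : circle R -> Z) :
  continuous f <-> continuous (f \o @circle_proj R).
Proof. exact: quotient_continuous. Qed.

Lemma continuous_repr f : cper f -> continuous (fun p : circle R => f (repr p)).
Proof.
move=> cf; apply/circle_continuousP; have [c _] := cf.
by rewrite (_ : _ \o _ = f)//; apply/funext => x /=; rewrite cper_repr.
Qed.

Lemma cper_circle phi : continuous phi -> cper (fun x => phi (circle_proj x)).
Proof.
by move=> /circle_continuousP cp; split=> // x; rewrite circle_projD1.
Qed.

Lemma circle_measurable_fun phi : continuous phi -> measurable_fun setT phi.
Proof.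
move=> /continuousP cp.
apply: (measurability _ (measurable_realfun.RGenOpens.measurableE R)).
move=> _ [_ [a [b ->] <-]]; rewrite setTI; apply: sub_sigma_algebra.
by apply: cp; exact: interval_open.
Qed.

Lemma measurable_circle_proj (X : R -> circle R) : continuous X ->
  measurable_fun (setT : set (measurableTypeR R)) X.
Proof.
move=> /continuousP cX; apply: (@measurability _ _ _ _ setT X (@open (circle R))) => //.
move=> _ [U oU <-]; rewrite setTI; apply: measurable_realfun.open_measurable; exact: cX.
Qed.

Lemma measurable_circle_map (X : circle R -> circle R) : continuous X ->
  measurable_fun setT X.
Proof.
move=> /continuousP cX; apply: (@measurability _ _ _ _ setT X (@open (circle R))) => //.
move=> _ [U oU <-]; rewrite setTI; apply: sub_sigma_algebra; exact: cX.
Qed.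

Lemma circle_integrable (mu : probability (circle R) R) phi : continuous phi ->
  mu.-integrable setT (EFin \o phi).
Proof.
move=> cp; apply: measurable_bounded_integrable => //.
- by apply: le_lt_trans (probability_le1 mu measurableT) _; exact: ltry.
- exact: circle_measurable_fun.
- have [M _ hM] := cper_bounded (cper_circle cp); exists M; split=> [|y My p _].
    by rewrite num_real.
  by rewrite -(circle_reprK p); apply: le_trans (hM _) (ltW My).
Qed.

Lemma circle_state (mu : probability (circle R) R) (X : circle R -> circle R) : continuous X ->
  state (fun f => \int[mu]_p f (repr (X p))).
Proof.
move=> cX.
have cc f : cper f -> continuous (fun p => f (repr (X p))).
  move=> cf p; apply: (@continuous_comp _ _ _ X (fun p => f (repr p))); first exact: cX.
  exact: continuous_repr.
split.
- move=> c f g cf cg.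
  rewrite RintegralD//; [|exact: (circle_integrable mu (cc _ (cperZ c cf)))|exact: circle_integrable (cc _ cg)].
  by rewrite RintegralZl//; exact: circle_integrable (cc _ cf).
- by move=> f cf f0; apply: Rintegral_ge0.
- rewrite Rintegral_cst// [X in fine X](_ : _ = 1%E) ?mulr1//; exact: probability_setT.
Qed.

(** The indicator of an open set is the increasing limit of [min 1 (n * distance)] to the
    complement. Open sets form a generating class stable under intersection. *)
Lemma circle_measure_unique (mu nu : probability (circle R) R) :
  (forall f, cper f -> \int[mu]_p f (repr p) = \int[nu]_p f (repr p)) ->
  forall A, measurable A -> mu A = nu A.
Proof.
move=> h.
have hO (O : set (circle R)) : open O -> mu O = nu O.
  move=> oO; have [->|/setTPn[p0 Op0]] := eqVneq O setT; first by rewrite !probability_setT.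
  pose S := [set x : R | ~ O (circle_proj x)].
  have S0 : S !=set0 by exists (repr p0); rewrite /S/= circle_reprK.
  have dp x : distance_to S (x + 1) = distance_to S x.
    apply: distance_to_periodic => // s k Ss; rewrite /S /=.
    by have -> : circle_proj (s + k%:~R) = circle_proj s by apply/circle_proj_eqP; exists k.
  pose f n x := Num.min 1 (n%:R * distance_to S x).
  have cf n : cper (fun x => Num.min 1 (n%:R * distance_to S x)).
    split=> x; last by rewrite dp.
    apply: (@continuous_min _ _ (fun=> 1) (fun y => n%:R * distance_to S y)); first exact: cst_continuous.
    by apply: continuousM; [exact: cst_continuous|exact: distance_to_continuous].
  have f0 n x : 0 <= f n x by rewrite le_min ler01 mulr_ge0// distance_to_ge0.
  have key (m : probability (circle R) R) :
      (fun n => \int[m]_p (f n (repr p))%:E)%E @ \oo --> m O.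
    have mO : measurable O by exact: sub_sigma_algebra.
    have -> : m O = (\int[m]_p (limn (fun n => (f n (repr p))%:E)))%E.
      rewrite -[in LHS](setIT O) -integral_indic//; apply: eq_integral => p _.
      apply/esym/cvg_lim => //; have [Op|Op] := pselect (O p).
        have [r r0 rS] : exists2 r : R, 0 < r & r <= distance_to S (repr p).
          have oO' : open ((@circle_proj R) @^-1` O).
            by move/continuousP: circle_proj_continuous; exact.
          have /nbhs_ballP[r /= r0 hr] : nbhs (repr p) ((@circle_proj R) @^-1` O).
            by apply: open_nbhs_nbhs; split=> //; rewrite /= circle_reprK.
          exists r => //; rewrite leNgt; apply/negP => /(distance_to_lt S0)[s Ss].
          by move/(hr s); exact: Ss.
        rewrite indicE mem_set//; apply: cvg_near_cst; near=> n.
        congr EFin; apply/min_idPl; apply: (@le_trans _ _ (n%:R * r)); last by rewrite ler_wpM2l.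
        rewrite -ler_pdivrMr// div1r; near: n; exact: nbhs_infty_ger.
      rewrite indicE memNset//; apply: cvg_near_cst; near=> n.
      rewrite /f distance_to_eq0 ?mulr0 ?min_r//.
      by rewrite /S /= circle_reprK.
    apply: cvg_monotone_convergence => //.
    - move=> n; have := circle_measurable_fun (continuous_repr (cf n)).
      by move/measurable_realfun.measurable_EFinP.
    - by move=> n p _; rewrite lee_fin.
    - move=> p _ n n' nn'; rewrite lee_fin /f le_min ge_min lexx/= ge_min.
      by apply/orP; right; rewrite ler_wpM2r ?ler_nat// distance_to_ge0.
  have eqi n : (\int[mu]_p (f n (repr p))%:E = \int[nu]_p (f n (repr p))%:E)%E.
    have fi (m : probability (circle R) R) : (\int[m]_p (f n (repr p))%:E)%E \is a fin_num.
      by apply: integrable_fin_num => //; exact: circle_integrable (continuous_repr (cf n)).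
    by rewrite -(fineK (fi mu)) -(fineK (fi nu)); exact: (congr1 EFin (h _ (cf n))).
  apply: (cvg_unique _ (key mu)) => //.
  by rewrite (funext eqi); exact: key.
move=> A mA; apply: (measure_unique (@open (circle R)) (fun=> setT)) => //.
- by move=> B C oB oC; exact: openI.
- by move=> _; exact: openT.
- by rewrite bigcup_const//; exists 0%N.
- by move=> _; rewrite [X in (X < _)%E](_ : _ = 1%E) ?ltry//; exact: probability_setT.
Unshelve. all: by end_near. Qed.

End circle_functions.

(** * Lifts of circle maps *)

Section circle_lifts.
Context {R : realType}.
Implicit Types (x y a : R) (F K G : R -> R) (f g : cmap R) (v w : vfield R).
Local Arguments derive1n : simpl never.

(** Two lifts differ by a continuous function with integer values. *)
Lemma lift_unique F K : continuous F -> continuous K ->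
  (forall x, circle_proj (F x) = circle_proj (K x)) ->
  exists m : int, forall x, K x = F x + m%:~R.
Proof.
move=> cF cK FK.
have h x : exists m : int, K x = F x + m%:~R by apply/circle_proj_eqP; rewrite FK.
have [m hm] := h 0; exists m => x; have [n hn] := h x; rewrite hn; congr (_ + _%:~R).
apply/eqP; rewrite -subr_eq0 -sqrf_eq0; apply/negPn/negP => nm.
(* On the segment from [0] to [x], the square of an integer would go continuously from 0 to at least
   1 and take the value [1 / 4]. *)
pose E y := (K (x * y) - F (x * y) - m%:~R) ^+ 2.
have cE : continuous E.
  move=> y; have cxy : {for y, continuous (fun y => x * y)}.
    by apply: continuousM; [exact: cst_continuous|exact: cvg_id].
  have cD : {for y, continuous (fun y => K (x * y) - F (x * y) - m%:~R)}.
    apply: continuousB; last exact: cst_continuous.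
    apply: continuousB.
      by apply: (@continuous_comp _ _ _ (fun y => x * y) K); [exact: cxy|exact: cK].
    by apply: (@continuous_comp _ _ _ (fun y => x * y) F); [exact: cxy|exact: cF].
  exact: (continuousM cD cD).
have [|c _ hc] := @intermediate_value _ E 0 1 4^-1 ler01 cE.
  have -> : E 0 = 0 by rewrite /E mulr0 hm; ring.
  have -> : E 1 = ((n - m) ^+ 2)%:~R by rewrite /E mulr1 hn rmorphXn/= intrB; ring.
  rewrite invr_ge0 ler0n/=; apply: (@le_trans _ _ 1); first by rewrite invf_le1 ?ler1n.
  rewrite -[1]/(1%:~R) ler_int -gtz0_ge1 lt_neqAle eq_sym nm.
  exact: sqr_ge0.
have [k hk] := h (x * c); move: hc.
rewrite /E hk => h4.
have : ((k - m) ^+ 2 * 4)%:~R = 1%:~R :> R.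
  rewrite intrM rmorphXn/= intrB -[RHS](mulVf (x := 4)) ?pnatr_eq0// -h4; ring.
by move/intr_inj; move: ((k - m) ^+ 2) => z; lia.
Qed.

Lemma lipschitz_of_derive (g dg : R -> R) B x y : (forall z : R, is_derive z 1 g (dg z)) ->
  (forall z, `|dg z| <= B) -> `|g x - g y| <= B * `|x - y|.
Proof.
move=> g' hB; wlog xy : x y / x < y.
  move=> W; have [xy|xy|->] := ltgtP x y; [exact: W| |by rewrite !subrr normr0 mulr0].
  by rewrite distrC [`|x - y|]distrC; exact: W.
have [c _ h] := mean_value xy (fun z _ => g' z).
by rewrite distrC h normrM [`|x - y|]distrC ler_wpM2r.
Qed.

(** If [F y <= F x] with [x < y], the value [F x] is taken again on some [[y, y + m]], against
    injectivity. *)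
Lemma injective_degree1_increasing F : continuous F -> degree1 F -> injective F ->
  {homo F : x y / x < y}.
Proof.
move=> cF F1 Fi x y xy; rewrite ltNge; apply/negP => Fyx.
have [m /andP[m1 m2]] := floor_shift (F x) (F y).
have m0 : 0 <= m%:~R :> R by lra.
have yx : y <= y + m%:~R by rewrite lerDl.
have [|z /andP[yz _] /Fi h] := intermediate_value (v := F x) yx cF.
  by rewrite Fyx (degree1_int _ _ F1).
by rewrite h in yz; lra.
Qed.

Lemma degree1_lift_continuous f F : degree1_lift f F -> continuous F.
Proof. by case=> _ _ F3; have := @C3_continuous _ F 0%N F3 isT. Qed.

Lemma degree1_lift_unique f F K : degree1_lift f F -> degree1_lift f K ->
  exists m : int, forall x, K x = F x + m%:~R.
Proof.
move=> fF fK; have [Ff _ _] := fF; have [Kf _ _] := fK.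
apply: lift_unique => [||x]; [exact: degree1_lift_continuous fF|exact: degree1_lift_continuous fK|].
by rewrite Ff Kf.
Qed.

Lemma injective_lift_increasing f F : degree1_lift f F -> injective f ->
  {homo F : x y / x < y}.
Proof.
move=> fF fi; have cF := degree1_lift_continuous fF; have [Ff F1 F3] := fF.
apply: injective_degree1_increasing => // x y e.
have /circle_proj_eqP[m h] : circle_proj x = circle_proj y by apply: fi; rewrite -!Ff e.
move: e; rewrite h (degree1_int _ _ F1) => /eqP; rewrite -subr_eq0 addrAC subrr add0r => /eqP ->.
by rewrite addr0.
Qed.

Lemma degree1_lift_translate f F v : degree1_lift f F ->
  degree1_lift (translate f v) (fun x => F x + v (circle_proj x)).
Proof.
move=> [Ff F1 F3]; split=> [x|x|].
- by rewrite circle_projD Ff.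
- by rewrite F1 circle_projD1 addrAC.
- by have := C3_lin 1 F3 (vfieldP v); rewrite scale1r.
Qed.

Lemma sup_norm_le_norm v i : (i < 4)%N -> sup_norm (vderiv i v) <= `|v|.
Proof.
move=> i4; rewrite [`|v|]/(C3_norm v) /C3_norm (bigD1 (Ordinal i4))//= lerDl.
by apply: sumr_ge0 => j _; exact: sup_norm_ge0.
Qed.

Lemma vderiv_le_norm v i x : (i < 4)%N -> `|vderiv i v x| <= `|v|.
Proof. by move=> i4; apply: le_trans (sup_norm_ub v x i4) (sup_norm_le_norm v i4). Qed.

Lemma vfield_le_norm v p : `|v p| <= `|v|.
Proof. by rewrite -(circle_reprK p); exact: (@vderiv_le_norm v 0%N (repr p)). Qed.

Lemma vfield_is_derive v x :
  is_derive x (1 : R) (fun x => v (circle_proj x)) (vderiv 1 v x).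
Proof. exact: C3_is_derive0 (vfieldP v) I. Qed.

Lemma vfield_lipschitz v x y : `|v (circle_proj x) - v (circle_proj y)| <= `|v| * `|x - y|.
Proof.
by apply: lipschitz_of_derive (vfield_is_derive v) _ => z; exact: vderiv_le_norm.
Qed.

Lemma vfield_cper v : cper (fun x => v (circle_proj x)).
Proof.
split=> x; last by rewrite circle_projD1.
exact: is_derive_continuous (vfield_is_derive v x).
Qed.

(** A nearby diffeomorphism is [f + v] with [v] small, and [F + v] is a strictly increasing lift of
    it; let [v] tend to 0. *)
Lemma closure_diffeo_monotone f F : closure (@circle_diffeo R) f -> degree1_lift f F ->
  monotone_lift F.
Proof.
move=> cf fF; have [Ff F1 F3] := fF; split=> // x y; rewrite le_eqVlt => /predU1P[->//|xy].
apply/ler_addgt0Pr => e e0; have e2 : 0 < e / 2 by rewrite divr_gt0.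
have [h [[g [hg _]] [v ve hE]]] := cf _ (nbhsx_ballx f _ e2).
have := injective_lift_increasing (degree1_lift_translate v fF); rewrite -hE => inc.
have := inc (can_inj hg) _ _ xy.
have := vfield_le_norm v (circle_proj x); have := vfield_le_norm v (circle_proj y).
by rewrite !ler_norml => /andP[? ?] /andP[? ?] ?; lra.
Qed.

Lemma tnDint G a (m : int) : degree1 G -> tn G a -> tn (fun x => G x + m%:~R) (a + m%:~R).
Proof.
move=> G1 Ga n x; have -> : iter n (fun x => G x + m%:~R) x = iter n G x + n%:R * m%:~R.
  elim: n => [|n IH]; first by rewrite mul0r addr0.
  rewrite iterS IH -[n%:R]/((Posz n)%:~R) -intrM (degree1_int _ _ G1) iterS intrM.
  by rewrite -natr1 mulrDl mul1r addrA.
have -> : iter n G x + n%:R * m%:~R - x - n%:R * (a + m%:~R) = iter n G x - x - n%:R * a by ring.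
exact: Ga.
Qed.

Lemma tn_limn G a : tn G a -> limn (fun n => iter n G 0 / n%:R) = a.
Proof.
move=> Ga; apply/cvg_lim => //; apply/cvgrPdist_le => e e0; near=> n.
have n0 : 0 < n%:R :> R by rewrite ltr0n; near: n; exact: nbhs_infty_gt.
have := Ga n 0; rewrite subr0 distrC => h.
have -> : a - iter n G 0 / n%:R = (n%:R * a - iter n G 0) / n%:R.
  by field; rewrite gt_eqF.
rewrite normrM normfV (gtr0_norm n0) ler_pdivrMr//; apply: le_trans h _.
rewrite mulrC -ler_pdivrMr// div1r; near: n; exact: nbhs_infty_ger.
Unshelve. all: by end_near. Qed.

Lemma rotation_numberE f F a : degree1_lift f F -> tn F a ->
  rotation_number f = circle_proj a.
Proof.
move=> fF Fa; have [m hm] := degree1_lift_unique fF (rliftP f).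
have [_ F1 _] := fF.
rewrite /rotation_number (_ : rlift f = fun x => F x + m%:~R); last exact/funext.
by rewrite (tn_limn (tnDint m F1 Fa)); apply/circle_proj_eqP; exists m.
Qed.

Lemma cancel_cinv f g : cancel f g -> cancel g f -> cinv f = g.
Proof.
move=> fg gf; apply/funext => p; apply: (can_inj fg).
rewrite gf /cinv; apply: pinvK; rewrite inE; exists (g p) => //.
Qed.

Lemma cmap_continuous f : continuous f.
Proof.
apply/circle_continuousP; have [Ff _ _] := rliftP f.
have -> : f \o @circle_proj R = @circle_proj R \o rlift f by apply/funext => x /=; rewrite Ff.
move=> x; apply: (@continuous_comp _ _ _ (rlift f) (@circle_proj R)).
  exact: (degree1_lift_continuous (rliftP f)).
exact: circle_proj_continuous.
Qed.

Lemma bijective_cinv f : (@circle_diffeo R `|` @multicritical R) f ->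
  [/\ cancel f (cinv f), cancel (cinv f) f & continuous (cinv f)].
Proof.
case=> [[g [fg gf]]|[[g [fg gf _ cg]] _ _]]; rewrite (cancel_cinv fg gf); split=> //.
exact: cmap_continuous.
Qed.

Lemma rlift_derive_periodic f x : derive1n 1 (rlift f) (x + 1) = derive1n 1 (rlift f) x.
Proof.
have [_ F1 F3] := rliftP f.
have per y : (rlift f \- id) (y + 1) = (rlift f \- id) y by rewrite /= F1; ring.
have := @periodic_derive1n R (rlift f \- id) 1 per x.
have dE y : derive1n 1 (rlift f \- id) y = derive1n 1 (rlift f) y - 1.
  have hF : is_derive y 1 (rlift f) (derive1n 1 (rlift f) y) by exact: (C3_is_derive0 F3).
  have h : is_derive y 1 (rlift f \- id) (derive1n 1 (rlift f) y - 1).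
    have -> : rlift f \- id = rlift f - id by [].
    exact: is_deriveB.
  have h2 : is_derive y 1 (rlift f \- id) (derive1n 1 (rlift f \- id) y).
    by apply: DeriveDef; [exact: (@ex_derive _ _ _ _ _ _ _ h)|rewrite derive1nS derive1n0 derive1E].
  exact: is_derive_unique h2 h.
by rewrite !dE => /addIr.
Qed.

Lemma rlift_derive_cper f : cper (derive1n 1 (rlift f)).
Proof.
split; last exact: rlift_derive_periodic.
by have [_ _ F3] := rliftP f; apply: (@C3_continuous _ (rlift f) 1%N).
Qed.

Lemma cderivE f x : cderiv f (circle_proj x) = derive1n 1 (rlift f) x.
Proof. exact: cper_repr (rlift_derive_cper f). Qed.

Lemma diffeo_derive_gt0 f x : circle_diffeo f -> 0 < derive1n 1 (rlift f) x.
Proof.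
move=> [g [fg gf]]; have [Ff F1 F3] := rliftP f; have [Gg G1 G3] := rliftP g.
have inc := injective_lift_increasing (rliftP f) (can_inj fg).
rewrite lt_neqAle (increasing_derive_ge0 x F3 inc) andbT eq_sym; apply/eqP => d0.
have cF := degree1_lift_continuous (rliftP f); have cG := degree1_lift_continuous (rliftP g).
have [m hm] : exists m : int, forall x, (rlift g \o rlift f) x = id x + m%:~R.
  apply: lift_unique => [y|y|y]; first exact: cvg_id.
    by apply: (@continuous_comp _ _ _ (rlift f) (rlift g)); [exact: cF|exact: cG].
  by rewrite /= Gg Ff fg.
have h1 : is_derive x 1 (rlift g \o rlift f) (derive1n 1 (rlift g) (rlift f x) * 0).
  have h : is_derive x 1 (rlift f) 0 by rewrite -d0; exact: (C3_is_derive0 F3).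
  exact: (@is_derive1_comp _ (rlift g) (rlift f) x _ _ (C3_is_derive0 G3 I) h).
have h2 : is_derive x 1 (rlift g \o rlift f) 1.
  rewrite (_ : rlift g \o rlift f = id + cst m%:~R); last by apply/funext => y; rewrite hm.
  by apply: is_derive_eq; rewrite addr0.
by have := is_derive_unique h1 h2; rewrite mulr0 => /eqP; rewrite eq_sym oner_eq0.
Qed.

Lemma star_distortion f : (@circle_diffeo R `|` @multicritical R) f ->
  exists Th V, distortion_lift (rlift f) (derive1n 1 (rlift f)) Th V.
Proof.
move=> sf; have [fK _ _] := bijective_cinv sf; have [_ F1 F3] := rliftP f.
have inc := injective_lift_increasing (rliftP f) (can_inj fK).
case: sf => [df|[_ /finite_seqP[s hs] nf]].
  apply: (distortion_lift_exists (cs := [::])) => // c.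
  by case; exact: diffeo_derive_gt0.
apply: (distortion_lift_exists (cs := [seq repr p | p <- s])) => // c hc.
have hc' : ~ 0 < cderiv f (circle_proj c) by rewrite cderivE.
split; last exact: nf.
have : [set` s] (circle_proj c) by rewrite -hs.
move=> /= cs; exists (repr (circle_proj c)); first exact: map_f.
have [m hm] := repr_circle_proj c; exists (- m).
by rewrite hm mulrNz addrK.
Qed.

End circle_lifts.

(** * (-1)-measures as invariant states *)

Section minus_one_measures.
Context {R : realType}.
Implicit Types (x y a : R) (f : cmap R) (mu : probability (circle R) R).
Local Arguments derive1n : simpl never.

Lemma rlift_taylor f : exists C, forall x h,
  `|rlift f (x + h) - rlift f x - derive1n 1 (rlift f) x * h| <= C * h ^+ 2.
Proof.
have [_ _ F3] := rliftP f; set F := rlift f in F3 *.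
have c2 : cper (derive1n 2 F).
  split; first exact: (@C3_continuous _ F 2%N).
  by move=> x; rewrite -[derive1n 2 F]/(derive1n 1 (derive1n 1 F));
    apply: periodic_derive1n => y; exact: rlift_derive_periodic.
have [B B0 hB] := cper_bounded c2; exists B => x h.
have F1 (z : R) : is_derive z 1 F (derive1n 1 F z) by exact: C3_is_derive0 F3 I.
have F2 (z : R) : is_derive z 1 (derive1n 1 F) (derive1n 2 F z) by exact: (@C3_is_derive _ setT).
have key c : `|c - x| <= `|h| -> `|derive1n 1 F c - derive1n 1 F x| <= B * `|h|.
  by move=> ch; apply: le_trans (lipschitz_of_derive c x F2 hB) _; rewrite ler_wpM2l// ltW.
have fin c : F (x + h) - F x = derive1n 1 F c * h -> `|c - x| <= `|h| ->
    `|F (x + h) - F x - derive1n 1 F x * h| <= B * h ^+ 2.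
  move=> -> /key hc; rewrite -mulrBl normrM.
  by rewrite -[h ^+ 2]real_normK ?num_real// expr2 mulrA ler_wpM2r.
have [h0|h0|->] := ltgtP h 0.
- have xh : x + h < x by rewrite gtrDl.
  have [c /andP[c1 c2'] hc] := mean_value xh (fun z _ => F1 z).
  apply: (fin c); first by rewrite -opprB hc; ring.
  by rewrite !ltr0_norm//; lra.
- have xh : x < x + h by rewrite ltrDl.
  have [c /andP[c1 c2'] hc] := mean_value xh (fun z _ => F1 z).
  apply: (fin c); first by rewrite hc; ring.
  by rewrite !gtr0_norm//; lra.
- by rewrite addr0 subrr mulr0 subrr normr0 expr0n/= mulr0.
Qed.

(** Integration against the measure of part (2) of the theorem. Through [cinv f] the defining
    relation of a (-1)-measure becomes the invariance of a state under [F], with no inverse left. *)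
Definition tilde_state f mu (phi : R -> R) := \int[mu]_p phi (repr (cinv f p)).

Variable f : cmap R.
Hypothesis sf : (@circle_diffeo R `|` @multicritical R) f.
Local Notation F := (rlift f).
Local Notation dF := (derive1n 1 (rlift f)).

Lemma tilde_state_circle mu (phi : circle R -> R) :
  tilde_state f mu (fun x => phi (circle_proj x)) = \int[mu]_p phi (cinv f p).
Proof. by apply: eq_Rintegral => p _; rewrite circle_reprK. Qed.

Lemma tilde_state_lift mu phi : cper phi ->
  tilde_state f mu (fun x => phi (F x)) = \int[mu]_p phi (repr p).
Proof.
move=> cphi; apply: eq_Rintegral => p _; have [_ fK _] := bijective_cinv sf.
have [Ff _ _] := rliftP f.
by rewrite -(cper_repr _ cphi) Ff circle_reprK fK.
Qed.

Lemma minus_one_invariant mu : minus_one_measure f mu ->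
  invariant_state F dF (tilde_state f mu).
Proof.
move=> hmu; have [_ _ cc] := bijective_cinv sf; split; first exact: circle_state.
move=> phi cphi; rewrite tilde_state_lift// (hmu _ (continuous_repr cphi)).
exact: eq_Rintegral.
Qed.

Variable a : R.
Hypothesis Fm : monotone_lift F.
Hypothesis Fa : tn F a.
Hypothesis ia : irrational a.

Lemma minus_one_unique mu nu : minus_one_measure f mu -> minus_one_measure f nu ->
  forall A, measurable A -> mu A = nu A.
Proof.
move=> hmu hnu; apply: circle_measure_unique => phi cphi.
have [Th [V FD]] := star_distortion sf.
rewrite -!tilde_state_lift//.
apply: (invariant_state_unique FD Fa ia (rlift_derive_cper f)); try exact: minus_one_invariant.
apply: cper_comp => //; first exact: degree1_lift_continuous (rliftP f).
exact: Fm.1.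
Qed.

Lemma tilde_state_approx mu phi e : minus_one_measure f mu -> cper phi -> 0 < e ->
  exists2 xi, cper xi &
    forall x, phi x - xi (F x) + dF x * xi x <= tilde_state f mu phi + e.
Proof.
move=> /minus_one_invariant imu cphi e0; have [C taylor] := rlift_taylor f.
have [Th [V FD]] := star_distortion sf.
apply: (invariant_state_approx Fm (degree1_lift_continuous (rliftP f)) Fa ia
  (rlift_derive_cper f) taylor _ imu cphi e0).
exact: (invariant_state_unique FD Fa ia (rlift_derive_cper f)).
Qed.

(** Any functional dominated by [upper_state] is an invariant state. Riesz represents it by a
    probability on the line, whose image under [circle_proj o F] is the (-1)-measure. *)
Lemma minus_one_exists : exists mu, minus_one_measure f mu.
Proof.
have [C taylor] := rlift_taylor f; have cF := degree1_lift_continuous (rliftP f).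
have cdF := rlift_derive_cper f; have [fK cK cc] := bijective_cinv sf.
have [Ff _ _] := rliftP f.
have [L [Llin Lle _]] := Hahn_Banach (0 : bfun) (upper_state_sublinear Fm Fa ia cdF taylor).
have [_ iL] := dominated_invariant Fm cF Fa ia cdF taylor Llin Lle.
have [P hP] := riesz_representation Llin
  (fun u => @dominated_pos _ F dF a C Fm Fa ia cdF taylor L u Llin Lle)
  (fun u c => @dominated_cst _ F dF a C Fm Fa ia cdF taylor L u c Llin Lle).
have cX : continuous (@circle_proj R \o F).
  move=> x; apply: (@continuous_comp _ _ _ F (@circle_proj R)); first exact: cF.
  exact: circle_proj_continuous.
pose X : {mfun (measurableTypeR R) >-> circle R} :=
  HB.pack (@circle_proj R \o F) (@isMeasurableFun.Build _ _ (measurableTypeR R) (circle R)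
    (@circle_proj R \o F) (measurable_circle_proj cX)).
pose mu : probability (circle R) R := distribution P X.
have key (phi : circle R -> R) : continuous phi ->
    \int[mu]_p phi p = L (to_bfun (fun x => phi (circle_proj (F x)))).
  move=> cphi; have c1 := cper_circle cphi.
  have c2 : cper (fun x => phi (circle_proj (F x))) by apply: cper_comp c1 cF Fm.1.
  rewrite -hP// /Rintegral; congr fine; rewrite /mu integral_distribution//.
    apply/measurable_realfun.measurable_EFinP; exact: circle_measurable_fun.
  exact: cper_integrable.
exists mu => phi cphi; rewrite key//.
rewrite [LHS](iL (fun x => phi (circle_proj x)))//; last exact: cper_circle.
rewrite key; last first.
  have cd : continuous (cderiv f) by exact: continuous_repr cdF.
  move=> p; apply: (@continuous_comp _ _ _ (cinv f) (fun p => cderiv f p * phi p)); first exact: cc.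
  by apply: continuousM; [exact: cd|exact: cphi].
by congr (L (to_bfun _)); apply/funext => x; rewrite Ff fK cderivE.
Qed.

End minus_one_measures.

(** * Perturbations of a lift *)

Section shifts.
Context {R : realType}.
Implicit Types (F G xi w : R -> R) (a b t c l B : R).

(** A single iterate of order [n] determines the translation number up to [1 / n] and depends
    continuously on the shift. *)
Lemma tn_shift_continuous G (b : R -> R) : continuous G -> monotone_lift G ->
  (forall t, tn (fun x => G x + t) (b t)) -> continuous b.
Proof.
move=> cG Gm hb t; apply/cvgrPdist_lt => e e0.
(* Two deviations from the translation number and one variation of the iterate, each at most 1. *)
have [n ne] : exists n : nat, 3 < n%:R * e.
  exists (Num.bound (3 / e)); rewrite -ltr_pdivrMr//.
  by apply: archi_boundP; rewrite divr_ge0// ltW.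
have ci : continuous (fun s => iter n (fun x => G x + s) 0).
  elim: n {ne} => [|n IH] s; first exact: cst_continuous.
  apply: continuousD; last exact: cvg_id.
  by apply: (@continuous_comp _ _ _ (fun s => iter n (fun x => G x + s) 0) G); [exact: IH|exact: cG].
near=> s.
have : `|iter n (fun x => G x + t) 0 - iter n (fun x => G x + s) 0| < 1.
  by near: s; apply: cvgr_dist_lt => //; exact: ci.
have := hb t n 0; have := hb s n 0; rewrite !subr0 => h1 h2 h3.
have n0 : 0 < n%:R :> R.
  by rewrite ltr0n lt0n; apply/eqP => n0; move: ne; rewrite n0 mul0r; lra.
rewrite -(ltr_pM2l n0); apply: lt_trans ne; rewrite -[X in X * `|_|](gtr0_norm n0) -normrM.
move: h1 h2 h3; rewrite mulrBr ltr_norml !ler_norml ltr_norml.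
by move=> /andP[? ?] /andP[? ?] /andP[? ?]; apply/andP; split; lra.
Unshelve. all: by end_near. Qed.

Lemma tn_shift_exists F G a s : monotone_lift F -> tn F a -> continuous G ->
  monotone_lift G -> (forall x, `|G x - F x| <= s) ->
  exists2 t, `|t| <= s & tn (fun x => G x + t) a.
Proof.
move=> Fm Fa cG Gm FG; have s0 : 0 <= s by apply: le_trans (FG 0).
have [b hb] := choice (fun t => tn_exists (monotone_liftD t Gm)).
have cb := tn_shift_continuous cG Gm hb.
have [||t /andP[t1 t2] ht] := @intermediate_value _ b (- s) s a _ cb.
- lra.
- apply/andP; split.
    apply: (tn_mono (monotone_liftD (- s) Gm) Fm (hb _) Fa) => x.
    by have := FG x; rewrite ler_norml => /andP[]; lra.
  apply: (tn_mono Fm (monotone_liftD s Gm) Fa (hb _)) => x.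
  by have := FG x; rewrite ler_norml => /andP[]; lra.
by exists t; [rewrite ler_norml t1|rewrite -ht].
Qed.

Lemma tn_shift_le G H a s t e : monotone_lift G -> monotone_lift H ->
  tn (fun x => G x + s) a -> tn (fun x => H x + t) a -> irrational a ->
  (forall x, G x <= H x + e) -> t <= s + e.
Proof.
move=> Gm Hm Gs Ht ia GH; rewrite leNgt; apply/negP => st.
have d0 : 0 < t - (s + e) by rewrite subr_gt0.
suff : a < a by rewrite ltxx.
apply: (tn_strict (monotone_liftD s Gm) (monotone_liftD t Hm) Gs Ht ia d0) => x.
by have := GH x; lra.
Qed.

(** Rotation numbers are known mod 1 only; a perturbation smaller than 1 cannot change an irrational
    translation number by a nonzero integer. *)
Lemma tn_near F G a r (m : int) : monotone_lift F -> tn F a -> irrational a ->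
  monotone_lift G -> tn G (a + m%:~R) -> (forall x, `|G x - F x| <= r) -> r < 1 -> m = 0.
Proof.
move=> Fm Fa ia Gm Gb FG r1; have iam := irrationalDint (m := m) ia.
have d0 : 0 < 1 - r by rewrite subr_gt0.
have [m0|m0|->//] := ltgtP m 0; exfalso.
- have F1 := tnDint (-1) Fm.1 Fa.
  have i1 := irrationalDint (m := -1) ia.
  have : a + (-1)%:~R < a + m%:~R.
    apply: (tn_strict (monotone_liftD _ Fm) Gm F1 Gb i1 d0) => x.
    by have := FG x; rewrite ler_norml mulrN1z => /andP[]; lra.
  by rewrite ltrD2l ltr_int; lia.
- have F1 := tnDint 1 Fm.1 Fa.
  have : a + m%:~R < a + 1%:~R.
    apply: (tn_strict Gm (monotone_liftD _ Fm) Gb F1 iam d0) => x.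
    by have := FG x; rewrite ler_norml => /andP[]; lra.
  by rewrite ltrD2l ltr_int; lia.
Qed.

Lemma tn_strict_r F G a b t : monotone_lift F -> monotone_lift G ->
  tn F a -> tn G b -> irrational b -> 0 < t -> (forall x, F x + t <= G x) -> a < b.
Proof.
move=> Fm Gm Fa Gb ib t0 FG; rewrite -ltrN2.
apply: (tn_strict (monotone_lift_opp Gm) (monotone_lift_opp Fm) (tn_opp Gb) (tn_opp Fa)
  (irrationalN ib) t0) => x.
by have := FG (- x); lra.
Qed.

Lemma bounded_displacement xi B x : (forall x, `|xi x| <= B) -> `|x + xi x - x| <= B.
Proof. by move=> hB; rewrite addrAC subrr add0r. Qed.

Section conjugacy.
Variables (F dF : R -> R) (C a : R).
Hypothesis Fa : tn F a.
Hypothesis ia : irrational a.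
Hypothesis taylor : forall x h, `|F (x + h) - F x - dF x * h| <= C * h ^+ 2.

Lemma taylor_bound x h B : `|h| <= B -> `|F (x + h) - F x - dF x * h| <= C * B ^+ 2.
Proof.
move=> hB; apply: le_trans (taylor x h) _.
have C0 : 0 <= C by have := taylor 0 1; rewrite expr1n !mulr1; exact: le_trans (normr_ge0 _).
rewrite ler_wpM2l// -[h ^+ 2]real_normK ?num_real// ler_sqr ?nnegrE//.
exact: le_trans hB.
Qed.

(* [id + xi] semiconjugates [F] to [F + w] shifted down by the right-hand side,
   so that a negative right-hand side would force the rotation number up. *)
Lemma shift_bound_below w xi l B c : monotone_lift (fun x => F x + w x) ->
  tn (fun x => F x + w x) a -> (forall x y, `|w x - w y| <= l * `|x - y|) -> 0 <= l ->
  (forall x, `|xi x| <= B) -> (forall x, w x - xi (F x) + dF x * xi x <= c) ->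
  0 <= c + C * B ^+ 2 + l * B.
Proof.
move=> Gm Ga wl l0 hB h; rewrite leNgt; apply/negP => neg.
set t := - (c + C * B ^+ 2 + l * B); have t0 : 0 < t by rewrite oppr_gt0.
have Gm' := monotone_liftD t Gm; have [b Gb] := tn_exists Gm'.
have : a < b by apply: (tn_strict Gm Gm' Ga Gb ia t0) => x.
suff : b <= a by lra.
apply: (tn_semiconj_ge (k := fun x => x + xi x) Gm' Fa Gb) => [x|x].
  exact: bounded_displacement.
have := taylor_bound x (hB x); have := wl (x + xi x) x; have := h x.
have := ler_wpM2l l0 (hB x); rewrite [x + xi x - x]addrAC subrr add0r.
by rewrite !ler_norml /t => ? ? /andP[? ?] /andP[? ?]; lra.
Qed.

(** The mirror image: [id - xi] semiconjugates [F] to a map below [F + w] shifted up, and a negative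
    right-hand side would force the rotation number down. *)
Lemma shift_bound_above w xi l B c : monotone_lift (fun x => F x + w x) ->
  tn (fun x => F x + w x) a -> (forall x y, `|w x - w y| <= l * `|x - y|) -> 0 <= l ->
  (forall x, `|xi x| <= B) -> (forall x, - w x - xi (F x) + dF x * xi x <= c) ->
  0 <= c + C * B ^+ 2 + l * B.
Proof.
move=> Gm Ga wl l0 hB h; rewrite leNgt; apply/negP => neg.
set t := - (c + C * B ^+ 2 + l * B); have t0 : 0 < t by rewrite oppr_gt0.
have Gm' := monotone_liftD (- t) Gm; have [b Gb] := tn_exists Gm'.
have : b < a by apply: (tn_strict_r Gm' Gm Gb Ga ia t0) => x; lra.
suff : a <= b by lra.
have hB' x : `|- xi x| <= B by rewrite normrN.
apply: (tn_semiconj_le (k := fun x => x + - xi x) Gm' Fa Gb) => [x|x].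
  exact: (bounded_displacement (xi := fun x => - xi x)).
have := taylor_bound x (hB' x); have := wl (x + - xi x) x; have := h x.
have := ler_wpM2l l0 (hB' x); rewrite [x + - xi x - x]addrAC subrr add0r.
by rewrite !ler_norml /t mulrN => ? ? /andP[? ?] /andP[? ?]; lra.
Qed.

End conjugacy.

End shifts.

(** * Coboundary approximation uniform on Lipschitz functions *)

Section uniform_approximation.
Context {R : realType}.
Implicit Types (x y c e l : R) (f xi : R -> R).

Lemma periodic_partition (n : nat) : exists psi : nat -> R -> R,
  [/\ forall k, cper (psi k), forall k x, 0 <= psi k x,
      forall x, \sum_(0 <= k < n.+1) psi k x = 1 &
      forall k x, psi k x != 0 -> exists m : int, `|x + m%:~R - k%:R / n.+1%:R| <= 2 / n.+1%:R].
Proof.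
have n0 : 0 < n.+1%:R :> R by rewrite ltr0n.
have d0 : 0 < n.+1%:R^-1 :> R by rewrite invr_gt0.
set d : R := n.+1%:R^-1 in d0 *.
have bump (k : nat) : exists f, [/\ cper f, (forall x, 0 <= f x <= 1),
    (forall x m, k%:R * d <= x + m%:~R <= k%:R * d + d -> f x = 1) &
    (forall x, f x != 0 -> exists m, k%:R * d - d < x + m%:~R < k%:R * d + 2 * d)].
  by apply: periodic_bump; lra.
have [b bP] := choice bump.
pose S x := \sum_(0 <= k < n.+1) b k x.
have b0 k x : 0 <= b k x by have [_ /(_ x)/andP[]] := bP k.
have S0 x : 0 < S x.
  have [m /andP[m1 m2]] := floor_shift 0 x; rewrite add0r in m2.
  pose k := Num.truncn ((x + m%:~R) * n.+1%:R).
  have k1 : k%:R <= (x + m%:~R) * n.+1%:R by rewrite truncn_le mulr_ge0// ltW.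
  have k2 : (x + m%:~R) * n.+1%:R < k.+1%:R by exact: truncnS_gt.
  have kn : (k < n.+1)%N by rewrite -(ltr_nat R); apply: le_lt_trans k1 _; rewrite gtr_pMl.
  have bk : b k x = 1.
    have [_ _ h _] := bP k; apply: (h x m).
    have := ler_wpM2r (ltW d0) k1; have := ler_wpM2r (ltW d0) (ltW k2).
    have -> : k.+1%:R * d = k%:R * d + d by rewrite -natr1 mulrDl mul1r.
    by rewrite -mulrA mulfV ?gt_eqF// mulr1 => -> ->.
  apply: lt_le_trans (ltr01) _; rewrite -bk /S (bigD1_seq k) ?iota_uniq ?mem_index_iota//=.
  by rewrite lerDl; apply: sumr_ge0 => j _.
have cb k : cper (b k) by have [] := bP k.
have cS : cper S by exact: cper_sum.
exists (fun k x => b k x / S x); split.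
- move=> k; split=> x; last by rewrite (cb k).2 cS.2.
  have cV : {for x, continuous (fun y => (S y)^-1)}.
    by apply: continuousV; [rewrite gt_eqF|exact: cS.1].
  exact: continuousM ((cb k).1 x) cV.
- by move=> k x; rewrite divr_ge0// ltW.
- by move=> x; rewrite -mulr_suml -/(S x) divff ?gt_eqF.
- move=> k x; rewrite mulf_eq0 negb_or => /andP[bk _].
  have [_ _ _ h] := bP k; have [m /andP[h1 h2]] := h x bk; exists m.
  by rewrite ler_norml; apply/andP; split; rewrite -/d; lra.
Qed.

Variables (F dF : R -> R) (M : (R -> R) -> R).
Hypothesis sM : state M.
Hypothesis approx : forall f e, cper f -> 0 < e -> exists2 xi, cper xi &
  forall x, f x - xi (F x) + dF x * xi x <= M f + e.

Lemma ray_approx f e : cper f -> 0 < e -> exists2 B, 0 <= B & forall c, exists xi,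
  [/\ cper xi, forall x, `|xi x| <= B * `|c| &
      forall x, c * f x - xi (F x) + dF x * xi x <= c * M f + e * `|c|].
Proof.
move=> cf e0; have [p cp hp] := approx cf e0; have [q cq hq] := approx (cperN cf) e0.
have [P P0 hP] := cper_bounded cp; have [Q Q0 hQ] := cper_bounded cq.
have MN : M (fun x => - f x) = - M f.
  by rewrite -mulN1r -stateZ//; congr M; apply/funext => x; rewrite mulN1r.
exists (P + Q); first by rewrite addr_ge0// ltW.
move=> c; have [c0|c0] := leP 0 c.
  exists (fun x => c * p x); split; first exact: cperZ.
    move=> x; rewrite normrM mulrC ler_wpM2r//.
    by apply: le_trans (hP x) _; rewrite lerDl ltW.
  move=> x; have := ler_wpM2l c0 (hp x); rewrite (ger0_norm c0); lra.
have c0' : 0 <= - c by rewrite oppr_ge0 ltW.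
exists (fun x => - c * q x); split; first exact: cperZ.
  move=> x; rewrite normrM normrN mulrC ler_wpM2r//.
  by apply: le_trans (hQ x) _; rewrite lerDr ltW.
by move=> x; have := ler_wpM2l c0' (hq x); rewrite MN (ltr0_norm c0); lra.
Qed.

(* Lipschitz functions are uniformly close to finite combinations of a fixed
   partition of unity, so finitely many coboundaries serve all of them. *)
Lemma uniform_approx e : 0 < e -> exists2 B, 0 <= B & forall f l, cper f ->
  (forall x, `|f x| <= l) -> (forall x y, `|f x - f y| <= l * `|x - y|) ->
  exists xi, [/\ cper xi, forall x, `|xi x| <= B * l &
    forall x, f x - xi (F x) + dF x * xi x <= M f + e * l].
Proof.
(* A mesh below [e / 8] keeps the supports within [e / 4], so [f] and [w] differ by at most
   [e / 4 * l]. This is paid once for [f] and once for [M f]; the coboundaries take the remaining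
   [e / 2 * l]. *)
move=> e0; have e8 : 0 < e / 8 by rewrite divr_gt0.
have [n hn] : exists n : nat, n.+1%:R^-1 < e / 8.
  by exists (Num.truncn (e / 8)^-1); rewrite invf_plt ?posrE// truncnS_gt.
have n0 : 0 < n.+1%:R :> R by rewrite ltr0n.
have [psi [cpsi psi0 psi1 psi_supp]] := periodic_partition n.
have d0 : 0 < e / 2 / n.+1%:R by rewrite !divr_gt0.
have ray k : exists B, 0 <= B /\ forall c, exists xi,
  [/\ cper xi, forall x, `|xi x| <= B * `|c| &
      forall x, c * psi k x - xi (F x) + dF x * xi x <= c * M (psi k) + e / 2 / n.+1%:R * `|c|].
  by have [B B0 hB] := ray_approx (cpsi k) d0; exists B.
have [B hB] := choice ray; exists (\sum_(0 <= k < n.+1) B k).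
  by apply: sumr_ge0 => k _; have [] := hB k.
move=> f l cf fl flip; have l0 : 0 <= l by apply: le_trans (fl 0).
pose t k : R := k%:R / n.+1%:R.
have [xi hxi] := choice (fun k => (hB k).2 (f (t k))).
pose w x := \sum_(0 <= k < n.+1) f (t k) * psi k x.
have cw : cper w by apply: cper_sum => k; exact: cperZ.
have fw x : `|f x - w x| <= e / 4 * l.
  have -> : f x - w x = \sum_(0 <= k < n.+1) (f x - f (t k)) * psi k x.
    have fx : f x = \sum_(0 <= k < n.+1) f x * psi k x by rewrite -mulr_sumr psi1 mulr1.
    by rewrite {1}fx -sumrB; apply: eq_bigr => k _; rewrite mulrBl.
  apply: le_trans (ler_norm_sum _ _ _) _.
  rewrite -[leRHS]mulr1 -[X in _ <= _ * X](psi1 x) mulr_sumr; apply: ler_sum => k _.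
  rewrite normrM (ger0_norm (psi0 k x)).
  have [->|nz] := eqVneq (psi k x) 0; first by rewrite !mulr0.
  rewrite ler_wpM2r//; have [m hm] := psi_supp k x nz.
  rewrite -(cper_int x m cf); apply: le_trans (flip _ _) _; rewrite mulrC ler_wpM2r//.
  by apply: le_trans hm _; rewrite ler_pdivrMr//; move: hn; rewrite -(ltr_pM2r n0) mulVf ?gt_eqF//; lra.
have Mw : M w = \sum_(0 <= k < n.+1) f (t k) * M (psi k).
  rewrite /w state_sum//; last by move=> k; exact: cperZ.
  by apply: eq_bigr => k _; rewrite stateZ.
have Mfw : M w <= M f + e / 4 * l.
  rewrite -(state_cst (e / 4 * l) sM) -stateD//; last exact: cper_cst.
  apply: state_le => //; first by apply: cperD => //; exact: cper_cst.
  by move=> x; have := fw x; rewrite ler_norml => /andP[]; lra.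
exists (fun x => \sum_(0 <= k < n.+1) xi k x); split.
- by apply: cper_sum => k; have [] := hxi k.
- move=> x; apply: le_trans (ler_norm_sum _ _ _) _; rewrite mulr_suml; apply: ler_sum => k _.
  have [_ /(_ x) h _] := hxi k; apply: le_trans h _; rewrite ler_wpM2l//.
  by have [] := hB k.
- move=> x; have : w x - \sum_(0 <= k < n.+1) xi k (F x) + dF x * (\sum_(0 <= k < n.+1) xi k x)
      <= M w + e / 2 * l.
    rewrite Mw mulr_sumr /w -sumrB -big_split /=.
    apply: (@le_trans _ _ (\sum_(0 <= k < n.+1) (f (t k) * M (psi k) + e / 2 / n.+1%:R * l))).
      apply: ler_sum => k _; have [_ _ /(_ x) h] := hxi k; apply: le_trans h _.
      by rewrite lerD2l ler_wpM2l// ltW.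
    rewrite big_split/= lerD2l sumr_const_nat subn0 -mulr_natr.
    by rewrite le_eqVlt; apply/orP; left; apply/eqP; field; rewrite gt_eqF.
  by have := fw x; rewrite ler_norml => /andP[]; lra.
Qed.

End uniform_approximation.

(** * Circle diffeomorphisms from lifts *)

Section diffeomorphisms.
Context {R : realType}.
Local Arguments derive1n : simpl never.
Implicit Types (F H K : R -> R) (f : cmap R).

Lemma is_derive_derive1n (g g1 : R -> R) n : (forall x : R, is_derive x 1 (derive1n n g) (g1 x)) ->
  derive1n n.+1 g = g1.
Proof. by move=> h; apply/funext => x; rewrite derive1nS derive1E derive_val. Qed.

Lemma C3_of_derivatives (g g1 g2 g3 : R -> R) : (forall x : R, is_derive x 1 g (g1 x)) ->
  (forall x : R, is_derive x 1 g1 (g2 x)) -> (forall x : R, is_derive x 1 g2 (g3 x)) ->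
  continuous g3 -> C3_on setT g.
Proof.
move=> h1 h2 h3 c3.
have e1 : derive1n 1 g = g1 by apply: is_derive_derive1n; rewrite derive1n0.
have e2 : derive1n 2 g = g2 by apply: is_derive_derive1n; rewrite e1.
have e3 : derive1n 3 g = g3 by apply: is_derive_derive1n; rewrite e2.
move=> x _; rewrite e3; split=> [i|]; last exact: c3.
case: i => [|[|[|//]]] _.
- by rewrite derive1n0; case: (h1 x).
- by rewrite e1; case: (h2 x).
- by rewrite e2; case: (h3 x).
Qed.

(** [K' = 1 / H' (K)] and [K'' = - H'' (K) * K' ^+ 3]; one more differentiation involves only
    continuous functions. *)
Lemma inverse_C3 H : C3_on setT H -> degree1 H -> (forall x, 0 < derive1n 1 H x) ->
  exists K, [/\ cancel H K, cancel K H & C3_on setT K].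
Proof.
move=> H3 H1 H'0.
have dH i (x : R) : (i < 3)%N -> is_derive x 1 (derive1n i H) (derive1n i.+1 H x).
  exact: (@C3_is_derive _ setT H x i H3 I).
have dH0 (x : R) : is_derive x 1 H (derive1n 1 H x) by have := dH 0%N x isT; rewrite derive1n0.
have cH : continuous H by have := @C3_continuous _ H 0%N H3 isT.
have inc : {homo H : x y / x < y}.
  move=> x y xy; have [c _ h] := mean_value xy (fun z _ => dH0 z).
  by rewrite -subr_gt0 h mulr_gt0// subr_gt0.
have [K [HK KH cK]] := increasing_inverse cH H1 inc.
exists K; split; [exact: HK|exact: KH|].
pose K1 x := (derive1n 1 H (K x))^-1.
have H'K x : derive1n 1 H (K x) != 0 by rewrite gt_eqF.
have dK (x : R) : is_derive x 1 K (K1 x).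
  rewrite -{1}(KH x); apply: (@is_derive_inverse R H K) => //.
  - exact: filterE.
  - exact: filterE.
have dHK i (x : R) : (i < 3)%N ->
    is_derive x 1 (fun y => derive1n i H (K y)) (derive1n i.+1 H (K x) * K1 x).
  move=> i3; exact: (@is_derive1_comp _ (derive1n i H) K x _ _ (dH i (K x) i3) (dK x)).
pose K2 x := - (derive1n 2 H (K x) * K1 x ^+ 3).
have dK1 (x : R) : is_derive x 1 K1 (K2 x).
  have h := dHK 1%N x isT.
  have h1 : is_derive x 1 K1
      (- (derive1n 1 H (K x)) ^- 2 *: (derive1n 2 H (K x) * K1 x)).
    exact: is_deriveV.
  by apply: (is_derive_eq h1); rewrite /K2 /K1 /GRing.scale/=; field.
pose K3 x := - (derive1n 3 H (K x) * K1 x * K1 x ^+ 3 + derive1n 2 H (K x) * (3 * K1 x ^+ 2 * K2 x)).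
have dK2 (x : R) : is_derive x 1 K2 (K3 x).
  have h := dHK 2%N x isT; have h1 := dK1 x.
  have h2 : is_derive x 1 (K1 ^+ 3) (3 * K1 x ^+ 2 * K2 x).
    by apply: is_derive_eq; rewrite /GRing.scale/= -mulr_natr; ring.
  have h3 := is_deriveM h h2.
  have -> : K2 = - ((fun y => derive1n 2 H (K y)) * K1 ^+ 3).
    by apply/funext => y; rewrite /K2 /=.
  apply: (is_derive_eq (is_deriveN h3)); rewrite /K3 /GRing.scale/=.
  have -> : (K1 ^+ 3) x = K1 x ^+ 3 by rewrite !exprS expr0.
  move: (derive1n 3 H (K x)) (derive1n 2 H (K x)) (K1 x) (K2 x) => u v p q; ring.
apply: (C3_of_derivatives dK dK1 dK2).
have cK1 : continuous K1 by move=> x; exact: is_derive_continuous (dK1 x).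
have cK2 : continuous K2 by move=> x; exact: is_derive_continuous (dK2 x).
have cHK i : (i < 4)%N -> continuous (fun y => derive1n i H (K y)).
  by move=> i4 x; apply: (@continuous_comp _ _ _ K (derive1n i H)); [exact: cK|exact: C3_continuous].
have cM (u v : R -> R) : continuous u -> continuous v -> continuous (fun x => u x * v x).
  by move=> cu cv x; apply: continuousM; [exact: cu|exact: cv].
have cX3 : continuous (fun x => K1 x ^+ 3) by exact: (cM _ _ cK1 (cM _ _ cK1 cK1)).
have cX2 : continuous (fun x => 3 * K1 x ^+ 2).
  by apply: (cM (fun=> 3) _ _ (cM _ _ cK1 cK1)) => x; exact: cst_continuous.
have c1 := cM _ _ (cM _ _ (cHK 3%N isT) cK1) cX3.
have c2 := cM _ _ (cHK 2%N isT) (cM _ _ cX2 cK2).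
by move=> x; exact: continuousN (continuousD (c1 x) (c2 x)).
Qed.

Lemma circle_diffeo_of_lift f H : degree1_lift f H -> (forall x, 0 < derive1n 1 H x) ->
  circle_diffeo f.
Proof.
move=> [Hf H1 H3] H'0; have [K [HK KH K3]] := inverse_C3 H3 H1 H'0.
have K1 : degree1 K by move=> x; apply: (can_inj HK); rewrite KH H1 KH.
pose g (p : circle R) : circle R := circle_proj (K (repr p)).
have gK : degree1_lift g K.
  split=> // x; rewrite /g; have [m ->] := repr_circle_proj x.
  by rewrite (degree1_int _ _ K1); apply/circle_proj_eqP; exists (- m); rewrite mulrNz addrK.
have gP : `[< exists F, degree1_lift g F >] by apply/asboolP; exists K.
have [gKE _ _] := gK.
exists (CMap gP); split=> p /=; rewrite -(circle_reprK p).
  by rewrite -Hf -gKE HK.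
by rewrite -gKE -Hf KH.
Qed.

End diffeomorphisms.

(** * The tangent space *)

Section tangent_space.
Context {R : realType}.
Local Arguments derive1n : simpl never.
Implicit Types (v w : vfield R) (t e : R).
Variables (alpha a : R) (f0 : cmap R).
Hypothesis sf0 : (@circle_diffeo R `|` @multicritical R) f0.
Hypothesis cl0 : closure (@circle_diffeo R) f0.
Hypothesis Fa : tn (rlift f0) a.
Hypothesis ia : irrational a.
Hypothesis aE : circle_proj a = circle_proj alpha.
Local Notation F := (rlift f0).
Local Notation dF := (derive1n 1 (rlift f0)).

Let Fm : monotone_lift F := closure_diffeo_monotone cl0 (rliftP f0).

Let perturbed v x := F x + v (circle_proj x).

Let perturbed_lift v : degree1_lift (translate f0 v) (perturbed v).
Proof. exact: degree1_lift_translate (rliftP f0). Qed.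

Let perturbed_mono v : closure (@circle_diffeo R) (translate f0 v) -> monotone_lift (perturbed v).
Proof. by move=> cv; exact: closure_diffeo_monotone cv (perturbed_lift v). Qed.

(** The translation number of the chosen lift is prescribed exactly, not mod 1. The default 0 can
    only occur for [v] outside the admissible perturbations. *)
Definition graph v : R := xget 0 [set t | tn (fun x => perturbed v x + t) a].

Lemma graph_tn v : closure (@circle_diffeo R) (translate f0 v) ->
  tn (fun x => perturbed v x + graph v) a.
Proof.
move=> cv; have cG := degree1_lift_continuous (perturbed_lift v).
have FG x : `|perturbed v x - F x| <= `|v|.
  by rewrite /perturbed addrAC subrr add0r vfield_le_norm.
have [t _ ht] := tn_shift_exists Fm Fa cG (perturbed_mono cv) FG.
by apply: (@xgetPex R 0 [set t | tn (fun x => perturbed v x + t) a]); exists t.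
Qed.

Lemma graph_unique v t : closure (@circle_diffeo R) (translate f0 v) ->
  tn (fun x => perturbed v x + t) a -> t = graph v.
Proof.
move=> cv ht; have Gm := perturbed_mono cv; have hg := graph_tn cv.
have h x : perturbed v x <= perturbed v x + 0 by rewrite addr0.
have := tn_shift_le Gm Gm ht hg ia h; have := tn_shift_le Gm Gm hg ht ia h.
by rewrite !addr0 => h1 h2; apply/eqP; rewrite eq_le h1 h2.
Qed.

Lemma graph_dist v w : closure (@circle_diffeo R) (translate f0 v) ->
  closure (@circle_diffeo R) (translate f0 w) -> `|graph v - graph w| <= `|v - w|.
Proof.
move=> cv cw; have hv := graph_tn cv; have hw := graph_tn cw.
have Gv := perturbed_mono cv; have Gw := perturbed_mono cw.
have key x : `|perturbed v x - perturbed w x| <= `|v - w|.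
  rewrite (_ : _ - _ = (v - w) (circle_proj x)) ?vfield_le_norm//.
  by rewrite /perturbed -[(v - w) _]/(v _ - w _); ring.
have h1 x : perturbed v x <= perturbed w x + `|v - w|.
  by have := key x; rewrite ler_norml => /andP[]; lra.
have h2 x : perturbed w x <= perturbed v x + `|v - w|.
  by have := key x; rewrite ler_norml => /andP[]; lra.
have := tn_shift_le Gv Gw hv hw ia h1; have := tn_shift_le Gw Gv hw hv ia h2.
by rewrite ler_norml => ? ?; apply/andP; split; lra.
Qed.

Lemma graph0 : graph 0 = 0.
Proof.
apply/esym/graph_unique; first by rewrite translate0.
rewrite (_ : (fun x => _) = F)//; apply/funext => x.
by rewrite /perturbed -[(0 : vfield R) _]/(0 : R) !addr0.
Qed.

Lemma graph_le v : closure (@circle_diffeo R) (translate f0 v) -> `|graph v| <= `|v|.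
Proof.
move=> cv; have c0 : closure (@circle_diffeo R) (translate f0 0) by rewrite translate0.
by have := graph_dist cv c0; rewrite graph0 !subr0.
Qed.

(** The bound [|v| + |t| < 1] excludes an integer jump of the translation number, so the condition
    mod 1 becomes the exact one. *)
Lemma rotation_number_graph v t : closure (@circle_diffeo R) (translate f0 v) ->
  `|v| + `|t| < 1 ->
  rotation_number (translate f0 (v + vfield_cst t)) = circle_proj alpha <-> t = graph v.
Proof.
move=> cv vt; have Gm := monotone_liftD t (perturbed_mono cv).
have [b hb] := tn_exists Gm.
have lift : degree1_lift (translate f0 (v + vfield_cst t)) (fun x => perturbed v x + t).
  rewrite (_ : (fun x => _) = perturbed (v + vfield_cst t)); first exact: perturbed_lift.
  apply/funext => x; rewrite /perturbed -addrA.
  by rewrite -[(v + vfield_cst t) _]/(v _ + t).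
rewrite (rotation_numberE lift hb) -aE; split=> [/circle_proj_eqP[m bm]|tE].
  apply: graph_unique => //; rewrite bm in hb.
  suff m0 : m = 0 by move: hb; rewrite m0 addr0.
  apply: (tn_near Fm Fa ia Gm hb _ vt) => x.
  rewrite (_ : _ - _ = v (circle_proj x) + t); last by rewrite /perturbed; ring.
  by apply: le_trans (ler_normD _ _) _; rewrite lerD2r vfield_le_norm.
by congr circle_proj; rewrite tE in hb Gm; apply: tn_unique Gm hb (graph_tn cv).
Qed.

Lemma graph_local_graph : local_graph alpha f0 graph.
Proof.
split; first exact: graph0.
(* Two radii with sum 1, as the exclusion of integer jumps requires. *)
exists 2^-1, 2^-1; split; [by rewrite invr_gt0|by rewrite invr_gt0| |].
  apply/subspace_continuousP => v [[_ cv] _]; apply/cvgrPdist_lt => e e0.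
  rewrite near_withinE; near=> w => -[[_ cw] _].
  apply: le_lt_trans (graph_dist cv cw) _; near: w; exact: cvgr_dist_lt.
move=> v [[v0 cv] /= v2]; split; first exact: le_lt_trans (graph_le cv) v2.
move=> t t2; apply: rotation_number_graph => //.
by rewrite (splitr 1) mul1r ltrD.
Unshelve. all: by end_near. Qed.

Variable mu : probability (circle R) R.
Hypothesis hmu : minus_one_measure f0 mu.

Definition tangent_functional v : R := - \int[mu]_p v (cinv f0 p).

Let M := tilde_state f0 mu.

Let sM : state M.
Proof. by have [] := minus_one_invariant sf0 hmu. Qed.

Lemma tangent_functionalE v : tangent_functional v = - M (fun x => v (circle_proj x)).
Proof. by rewrite /M tilde_state_circle. Qed.

Lemma tangent_functional_lin c v w :
  tangent_functional (c *: v + w) = c * tangent_functional v + tangent_functional w.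
Proof.
rewrite !tangent_functionalE.
have -> : (fun x => (c *: v + w) (circle_proj x)) =
  (fun x => c * v (circle_proj x) + w (circle_proj x)) by [].
by rewrite state_lin//; [ring|exact: vfield_cper|exact: vfield_cper].
Qed.

Lemma tangent_functional_cst c : tangent_functional (vfield_cst c) = - c.
Proof. by rewrite tangent_functionalE (_ : (fun x => _) = fun=> c) ?state_cst. Qed.

Lemma tangent_functional_bounded : bounded_linear_on_V0 tangent_functional.
Proof.
split=> [c v w _ _|]; first exact: tangent_functional_lin.
exists 1 => v _; rewrite mul1r tangent_functionalE normrN.
by apply: state_norm sM (vfield_cper v) _ => x; exact: vfield_le_norm.
Qed.

(** A coboundary for [v] bounds [graph v] from below and one for [- v] from above. Both have size
    [B * |v|], so the Taylor error and the variation of [v] along the displacement are quadratic in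
    [|v|]. *)
Lemma graph_derivative e : 0 < e -> exists2 d, 0 < d & forall v,
  closure (@circle_diffeo R) (translate f0 v) -> `|v| < d ->
  `|graph v - tangent_functional v| <= e * `|v|.
Proof.
move=> e0; have [C taylor] := rlift_taylor f0; have e2 : 0 < e / 2 by rewrite divr_gt0.
have C0 : 0 <= C by have := taylor 0 1; rewrite expr1n !mulr1; exact: le_trans (normr_ge0 _).
have approx f e' : cper f -> 0 < e' -> exists2 xi, cper xi &
    forall x, f x - xi (F x) + dF x * xi x <= M f + e'.
  exact: (tilde_state_approx sf0 Fm Fa ia hmu).
have [B B0 hB] := uniform_approx sM approx e2.
have D0 : 0 < C * B ^+ 2 + B + 1.
  by rewrite ltr_wpDl// addr_ge0// mulr_ge0// sqr_ge0.
exists (e / 2 / (C * B ^+ 2 + B + 1)); first by rewrite divr_gt0.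
move=> v cv; rewrite ltr_pdivlMr// => vd.
have Gm := monotone_liftD (graph v) (perturbed_mono cv); have Ga := graph_tn cv.
pose w x := v (circle_proj x) + graph v.
have GE : (fun x => perturbed v x + graph v) = (fun x => F x + w x).
  by apply/funext => x; rewrite /perturbed /w addrA.
rewrite GE in Gm Ga.
have wl x y : `|w x - w y| <= `|v| * `|x - y|.
  by rewrite (_ : _ - _ = v (circle_proj x) - v (circle_proj y)) ?vfield_lipschitz// /w; ring.
have small : C * (B * `|v|) ^+ 2 + `|v| * (B * `|v|) <= e / 2 * `|v|.
  rewrite (_ : _ + _ = (`|v| * (C * B ^+ 2 + B)) * `|v|); last by ring.
  by rewrite ler_wpM2r//; move: vd; rewrite [_ * (_ + 1)]mulrDr mulr1; have := normr_ge0 v; lra.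
rewrite tangent_functionalE opprK ler_norml; apply/andP; split.
  have [xi [_ xiB h]] := hB _ `|v| (vfield_cper v) (fun x => vfield_le_norm v _) (vfield_lipschitz v).
  set c := M _ in h *.
  have hc x : w x - xi (F x) + dF x * xi x <= c + e / 2 * `|v| + graph v.
    by have := h x; rewrite /w; lra.
  have := shift_bound_below Fa ia taylor Gm Ga wl (normr_ge0 v) xiB hc.
  by lra.
have cNv : cper (fun x => - v (circle_proj x)) by exact: cperN (vfield_cper v).
have [||xi [_ xiB h]] := hB _ `|v| cNv.
- by move=> x; rewrite normrN vfield_le_norm.
- by move=> x y; rewrite opprK addrC distrC vfield_lipschitz.
have MN : M (fun x => - v (circle_proj x)) = - M (fun x => v (circle_proj x)).
  rewrite -mulN1r -stateZ//; last exact: vfield_cper.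
  by congr M; apply/funext => x; rewrite mulN1r.
rewrite MN in h; set c := M _ in h *.
have hc x : - w x - xi (F x) + dF x * xi x <= - c + e / 2 * `|v| - graph v.
  by have := h x; rewrite /w; lra.
have := shift_bound_above Fa ia taylor Gm Ga wl (normr_ge0 v) xiB hc.
by lra.
Qed.

Lemma frechet_tangent_exists : exists T, frechet_tangent alpha f0 T.
Proof.
exists [set v + vfield_cst (tangent_functional v) | v in V0 (R := R)], graph, tangent_functional.
split=> //; [exact: graph_local_graph|exact: tangent_functional_bounded|].
move=> e /graph_derivative[d d0 h]; rewrite near_withinE; near=> v => -[_ cv].
apply: h => //; near: v.
Unshelve. all: by end_near. Qed.

End tangent_space.

(** * Uniqueness of the tangent functional *)

Section tangent_space_unique.
Context {R : realType}.
Local Arguments derive1n : simpl never.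
Implicit Types (v w u : vfield R) (t e : R).
Variables (alpha a : R) (f0 : cmap R).
Hypothesis sf0 : (@circle_diffeo R `|` @multicritical R) f0.
Hypothesis cl0 : closure (@circle_diffeo R) f0.
Hypothesis Fa : tn (rlift f0) a.
Hypothesis ia : irrational a.
Hypothesis aE : circle_proj a = circle_proj alpha.
Variable mu : probability (circle R) R.
Hypothesis hmu : minus_one_measure f0 mu.
Local Notation F := (rlift f0).
Local Notation dF := (derive1n 1 (rlift f0)).

(** The field directed from [f0] to a rigid rotation. Its derivative [1 - F'] equals 1 at critical
    points, so moving along it makes the derivative positive. *)
Lemma lift_displacement_field : exists w, forall x, w (circle_proj x) = x - F x + F 0.
Proof.
have [_ F1 F3] := rliftP f0.
pose g (p : circle R) := repr p - F (repr p) + F 0.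
have gE x : g (circle_proj x) = x - F x + F 0.
  rewrite /g; have [m ->] := repr_circle_proj x.
  by rewrite (degree1_int _ _ F1); ring.
have g3 : g \in @C3_pred R.
  apply/asboolP; have -> : g \o @circle_proj R = 1 *: ((- 1) *: F + id) + cst (F 0).
    apply/funext => x; rewrite /= gE scale1r.
    by rewrite -[RHS]/(-1 * F x + x + F 0); ring.
  by apply: C3_lin (C3_cst _); exact: C3_lin F3 (@C3_id R).
by exists (VField g3).
Qed.

(* For [w = id - F + F 0], [F + t (K w + v)] has derivative
   [(1 - t K) F' + t (K + v')], which is positive if [K > |v|] and [t K <= 1]. *)
Lemma displacement_admissible w v (K t : R) : (forall x, w (circle_proj x) = x - F x + F 0) ->
  `|v| < K -> 0 < t -> t * K <= 1 ->
  circle_diffeo (translate f0 (t *: (K *: w + v))).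
Proof.
move=> wE vK t0 tK; have [fK _ _] := bijective_cinv sf0.
have [_ F1 F3] := rliftP f0.
have inc := injective_lift_increasing (rliftP f0) (can_inj fK).
have hl := degree1_lift_translate (t *: (K *: w + v)) (rliftP f0).
apply: (circle_diffeo_of_lift hl) => x; have [_ _ H3] := hl.
have dFx : is_derive x 1 F (dF x) by exact: C3_is_derive0 F3 I.
have dv := vfield_is_derive v x.
have HE : (fun x => F x + (t *: (K *: w + v)) (circle_proj x)) =
    F + t *: (K *: (id - F + cst (F 0)) + (fun x => v (circle_proj x))).
  by apply/funext => y; rewrite -[LHS]/(F y + t * (K * w (circle_proj y) + v (circle_proj y))) wE.
have h1 : is_derive x 1 (F + t *: (K *: (id - F + cst (F 0)) + (fun x => v (circle_proj x))))
    (dF x + t * (K * (1 - dF x) + vderiv 1 v x)).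
  have hB : is_derive x 1 (id - F) (1 - dF x) by exact: is_deriveB.
  have hw := is_deriveD hB (is_derive_cst (F 0) x 1).
  have h := is_deriveD dFx (is_deriveZ t (is_deriveD (is_deriveZ K hw) dv)).
  by apply: (is_derive_eq h); rewrite /GRing.scale/= addr0.
rewrite -HE in h1; rewrite (is_derive_unique (C3_is_derive0 H3 I) h1).
have dF0 := increasing_derive_ge0 x F3 inc.
have := vderiv_le_norm v x (isT : (1 < 4)%N); rewrite ler_norml => /andP[v1 _].
have h2 : 0 < t * (K + vderiv 1 v x) by rewrite mulr_gt0//; lra.
have h3 : 0 <= (1 - t * K) * dF x by rewrite mulr_ge0// subr_ge0.
rewrite (_ : dF x + _ = (1 - t * K) * dF x + t * (K + vderiv 1 v x)); last by ring.
exact: ltr_wpDl h3 h2.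
Qed.

Lemma near_admissibleP (P : vfield R -> Prop) :
  (\forall v \near within (admissible f0) (nbhs 0), P v) ->
  exists2 d, 0 < d & forall v, admissible f0 v -> `|v| < d -> P v.
Proof.
rewrite near_withinE => /nbhs_ballP[d /= d0 h]; exists d => // v av vd.
by apply: h av; rewrite -ball_normE /= sub0r normrN.
Qed.

Lemma local_graph_eq tau : local_graph alpha f0 tau -> exists2 d, 0 < d &
  forall v, admissible f0 v -> `|v| < d -> tau v = graph a f0 v.
Proof.
move=> [_ [d [eta [d0 eta0 _ h]]]].
exists (Num.min d (Num.min eta 2^-1)); first by rewrite !lt_min d0 eta0 invr_gt0/=.
move=> v av; rewrite !lt_min => /and3P[vd veta v2]; have [_ cv] := av.
have [_ ht] := h v (conj av vd); apply/esym/ht.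
  exact: le_lt_trans (graph_le cl0 Fa ia cv) veta.
apply/(rotation_number_graph cl0 Fa ia aE cv) => //.
rewrite (splitr 1) mul1r ltrD//.
exact: le_lt_trans (graph_le cl0 Fa ia cv) v2.
Qed.

(** Along a ray of diffeomorphisms both functionals are derivatives of the same graph function,
    hence agree. This applies to [w] and to [K w + v] with [K > |v|]; linearity isolates [v]. *)
Lemma frechet_functional_unique tau L : local_graph alpha f0 tau -> bounded_linear_on_V0 L ->
  (forall e, 0 < e -> \forall v \near within (admissible f0) (nbhs 0),
     `|tau v - L v| <= e * `|v|) ->
  forall v, V0 v -> L v = tangent_functional f0 mu v.
Proof.
move=> lg [Llin _] Ltau.
have V00 : V0 (0 : vfield R) by [].
have L0 : L 0 = 0.
  have := Llin 1 0 0 V00 V00; rewrite scale1r addr0 mul1r => h.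
  by apply: (addrI (L 0)); rewrite -h addr0.
have LZ c v : V0 v -> L (c *: v) = c * L v.
  by move=> v0; rewrite -[c *: v]addr0 Llin// L0 addr0.
pose T := tangent_functional f0 mu.
have Tlin := tangent_functional_lin sf0 hmu.
have TZ c v : T (c *: v) = c * T v.
  have T0 : T 0 = 0 := linear_functional0 Tlin.
  by rewrite -[c *: v]addr0 /T Tlin -/T T0 addr0.
have V0Z c v : V0 v -> V0 (c *: v).
  by move=> v0; rewrite -[V0 _]/(c * v 0 = 0) (v0 : v 0 = 0) mulr0.
have key u (s : R) : V0 u -> 0 < s -> (forall t, 0 < t -> t <= s ->
    circle_diffeo (translate f0 (t *: u))) -> L u = T u.
  move=> u0 s0 hu; apply/eqP; rewrite -subr_eq0 -normr_le0; apply/ler_addgt0Pr => e e0.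
  rewrite add0r; have U1 : 0 < 2 * (`|u| + 1) by rewrite mulr_gt0// ltr_wpDl.
  pose e' := e / (2 * (`|u| + 1)); have e'0 : 0 < e' by rewrite divr_gt0.
  have [d1 d10 h1] := near_admissibleP (Ltau e' e'0).
  have [d2 d20 h2] := graph_derivative sf0 cl0 Fa ia hmu e'0.
  have [d3 d30 h3] := local_graph_eq lg.
  pose d := Num.min d1 (Num.min d2 d3).
  have d0 : 0 < d by rewrite !lt_min d10 d20 d30.
  pose t := Num.min s (d / (`|u| + 1) / 2).
  have u1 : 0 < `|u| + 1 by rewrite ltr_wpDl.
  have t0 : 0 < t by rewrite lt_min s0 !divr_gt0.
  have ts : t <= s by rewrite ge_min lexx.
  have tu : `|t *: u| < d.
    rewrite normrZ (gtr0_norm t0); apply: (@le_lt_trans _ _ (d / (`|u| + 1) / 2 * (`|u| + 1))).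
      by rewrite ler_pM ?(ltW t0)// ?lerDl// ge_min lexx orbT.
    by rewrite mulrAC divfK ?gt_eqF//; lra.
  have cu : closure (@circle_diffeo R) (translate f0 (t *: u)) by exact/subset_closure/hu.
  have au : admissible f0 (t *: u) by split=> //; exact: V0Z.
  move: tu; rewrite !lt_min => /and3P[tu1 tu2 tu3].
  have := h1 _ au tu1; have := h2 _ cu tu2; rewrite (h3 _ au tu3).
  rewrite LZ// -/T TZ normrZ (gtr0_norm t0) => h4 h5.
  have : `|t * (L u - T u)| <= t * e.
    rewrite mulrBr; apply: (@le_trans _ _ (2 * (e' * (t * `|u|)))).
      move: h4 h5; rewrite !ler_norml => /andP[? ?] /andP[? ?].
      by apply/andP; split; lra.
    rewrite /e' (_ : 2 * _ = t * (e / (2 * (`|u| + 1)) * (2 * `|u|))); last by ring.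
    rewrite ler_wpM2l ?(ltW t0)// mulrAC ler_pdivrMr// ler_wpM2l ?(ltW e0)//.
    by rewrite ler_wpM2l// lerDl.
  by rewrite normrM (gtr0_norm t0) ler_pM2l.
have [w wE] := lift_displacement_field.
have w0 : V0 w by rewrite -[V0 _]/(w 0 = 0) -circle_proj0 wE sub0r addNr.
have main v (K : R) : V0 v -> `|v| < K -> L (K *: w + v) = T (K *: w + v).
  move=> v0 vK; have K0 : 0 < K by apply: le_lt_trans vK.
  apply: (key _ K^-1); last 1 first.
  - move=> t t0 tK; apply: displacement_admissible => //.
    by rewrite -(mulVf (x := K)) ?gt_eqF// ler_wpM2r// ltW.
  - by rewrite -[V0 _]/(K * w 0 + v 0 = 0) (w0 : w 0 = 0) (v0 : v 0 = 0) mulr0 addr0.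
  - by rewrite invr_gt0.
have Lw : L w = T w.
  by have := main 0 1 V00; rewrite normr0 scale1r addr0; apply.
move=> v v0; have := main v (`|v| + 1) v0 ltac:(by rewrite ltrDl).
by rewrite Llin// /T Tlin -/T Lw => /addrI.
Qed.

Lemma frechet_tangentP T : frechet_tangent alpha f0 T ->
  forall v, T v <-> \int[mu]_p v (cinv f0 p) = 0.
Proof.
move=> [tau [L [lg bL Ltau ->]]] v.
have LE := frechet_functional_unique lg bL Ltau.
pose Tf := tangent_functional f0 mu.
have TfE u : \int[mu]_p u (cinv f0 p) = - Tf u by rewrite opprK.
have TD u c : Tf (u + vfield_cst c) = Tf u - c.
  have := tangent_functional_lin sf0 hmu 1 u (vfield_cst c).
  by rewrite scale1r mul1r (tangent_functional_cst sf0 hmu).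
rewrite TfE; split=> [[u u0 <-]|/eqP].
  by rewrite LE// TD subrr oppr0.
(* The part of [v] in [V0] is [v - v 0], and the functional sends it to the constant [v 0] when it
   kills [v]. *)
rewrite oppr_eq0 => /eqP Tv; exists (v + vfield_cst (- v 0)).
  by rewrite -[V0 _]/(v 0 - v 0 = 0) subrr.
rewrite LE; last by rewrite -[V0 _]/(v 0 - v 0 = 0) subrr.
rewrite -/Tf TD Tv sub0r opprK; apply/val_inj/funext => p.
by rewrite -[LHS]/(v p - v 0 + v 0) subrK.
Qed.

End tangent_space_unique.

(** * Weak continuity *)

Section weak_continuity.
Context {R : realType}.
Local Arguments derive1n : simpl never.
Implicit Types (f g h : cmap R) (mu nu : probability (circle R) R) (v : vfield R).

Lemma derive_translate f v x : derive1n 1 (rlift (translate f v)) x =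
  derive1n 1 (rlift f) x + vderiv 1 v x.
Proof.
have [_ _ F3] := rliftP f; have [_ _ H3] := rliftP (translate f v).
have [m hm] := degree1_lift_unique (degree1_lift_translate v (rliftP f)) (rliftP (translate f v)).
have HE : rlift (translate f v) = rlift f + (fun x => v (circle_proj x)) + cst m%:~R.
  by apply/funext => y; rewrite hm.
have hF : is_derive x 1 (rlift f) (derive1n 1 (rlift f) x) by exact: C3_is_derive0 F3 I.
have h := is_deriveD (is_deriveD hF (vfield_is_derive v x)) (is_derive_cst (m%:~R : R) x 1).
rewrite addr0 -HE in h.
exact: is_derive_unique (C3_is_derive0 H3 I) h.
Qed.

Variables (a : R) (g : cmap R) (mu : probability (circle R) R).
Hypothesis sg : (@circle_diffeo R `|` @multicritical R) g.
Hypothesis clg : closure (@circle_diffeo R) g.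
Hypothesis ga : tn (rlift g) a.
Hypothesis ia : irrational a.
Hypothesis hmu : minus_one_measure g mu.

(** The inequality that holds for [g] with the coboundary of [xi] persists for nearby maps up to
    [e], because only [g] and its derivative enter. Any state invariant for the nearby map
    annihilates the perturbed coboundary. *)
Lemma tilde_state_upper phi e : cper phi -> 0 < e -> exists2 d, 0 < d &
  forall v nu, `|v| < d -> (@circle_diffeo R `|` @multicritical R) (translate g v) ->
    minus_one_measure (translate g v) nu ->
    tilde_state (translate g v) nu phi <= tilde_state g mu phi + e.
Proof.
move=> cphi e0; have e3 : 0 < e / 3 by rewrite divr_gt0.
have gm := closure_diffeo_monotone clg (rliftP g).
have [xi cxi hxi] := tilde_state_approx sg gm ga ia hmu cphi e3.
have [B B0 hB] := cper_bounded cxi; have [d1 d10 hd1] := cper_unif cxi e3.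
exists (Num.min d1 (e / 3 / B)); first by rewrite lt_min d10 divr_gt0.
move=> v nu; rewrite lt_min => /andP[v1]; rewrite ltr_pdivlMr// => v2 sh hnu.
set h := translate g v in sh hnu *.
have [sM iM] := minus_one_invariant sh hnu.
set M := tilde_state h nu in sM iM *; set H := rlift h in iM *; set dH := derive1n 1 H in iM *.
have cH : continuous H by exact: degree1_lift_continuous (rliftP h).
have [_ H1 _] := rliftP h.
have [m hm] := degree1_lift_unique (degree1_lift_translate v (rliftP g)) (rliftP h).
have cxH : cper (fun x => xi (H x)) by exact: cper_comp cxi cH H1.
have cdx : cper (fun x => dH x * xi x) by exact: cperM (rlift_derive_cper h) cxi.
set c := tilde_state g mu phi in hxi *.
have le x : phi x <= c + e + (xi (H x) - dH x * xi x).
  have k1 : `|xi (rlift g x) - xi (H x)| < e / 3.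
    rewrite /H hm cper_int//; apply: hd1; apply: le_lt_trans v1.
    by rewrite opprD addrA subrr add0r normrN vfield_le_norm.
  have k2 : `|(dH x - derive1n 1 (rlift g) x) * xi x| <= e / 3.
    rewrite normrM; apply: le_trans (ltW v2); apply: ler_pM => //.
    by rewrite /dH /H derive_translate addrAC subrr add0r vderiv_le_norm.
  move: k1 k2 (hxi x); rewrite mulrBl ltr_norml ler_norml => /andP[? ?] /andP[? ?].
  by lra.
have := @state_le _ M _ (fun x => c + e + (xi (H x) - dH x * xi x)) sM cphi _ le.
have cc : cper (fun=> c + e) by exact: cper_cst.
rewrite stateD//; last exact: cperB.
rewrite stateB// iM// subrr addr0 state_cst//; apply.
by apply: cperD => //; exact: cperB.
Qed.

Lemma tilde_state_continuous phi e : cper phi -> 0 < e -> exists2 d, 0 < d &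
  forall v nu, `|v| < d -> (@circle_diffeo R `|` @multicritical R) (translate g v) ->
    minus_one_measure (translate g v) nu ->
    `|tilde_state g mu phi - tilde_state (translate g v) nu phi| <= e.
Proof.
move=> cphi e0; have [d1 d10 h1] := tilde_state_upper cphi e0.
have [d2 d20 h2] := tilde_state_upper (cperN cphi) e0.
exists (Num.min d1 d2) => [|v nu]; first by rewrite lt_min d10.
rewrite lt_min => /andP[v1 v2] sh hnu.
have N f (m : probability (circle R) R) : (@circle_diffeo R `|` @multicritical R) f ->
    minus_one_measure f m -> tilde_state f m (fun x => - phi x) = - tilde_state f m phi.
  move=> sf hm; have [sM _] := minus_one_invariant sf hm.
  by rewrite -mulN1r -stateZ//; congr tilde_state; apply/funext => x; rewrite mulN1r.
have := h1 v nu v1 sh hnu; have := h2 v nu v2 sh hnu; rewrite !N//.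
by rewrite ler_norml => ? ?; apply/andP; split; lra.
Qed.

End weak_continuity.

(** * The transported measure *)

Section tilde_measures.
Context {R : realType}.
Variables (h : cmap R) (mu : probability (circle R) R).
Hypothesis sh : (@circle_diffeo R `|` @multicritical R) h.

(** Images under [h] are preimages under its inverse, so [tilde_measure] is a push-forward and the
    change of variables applies. *)
Lemma integral_tilde_measure (phi : circle R -> R) : continuous phi ->
  (\int[mu]_p (phi (cinv h p))%:E = \int[tilde_measure h mu]_p (phi p)%:E)%E.
Proof.
move=> cphi; have [hK Kh cK] := bijective_cinv sh.
have -> : tilde_measure h mu = pushforward mu (cinv h).
  apply/funext => A; rewrite /tilde_measure /pushforward; congr (mu _).
  apply/seteqP; split=> [_ [p Ap <-] /=|p Ap]; first by rewrite hK.
  by exists (cinv h p) => //; rewrite Kh.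
have mphi := circle_measurable_fun cphi.
rewrite integral_pushforward//; first exact: measurable_circle_map.
  by apply/measurable_realfun.measurable_EFinP.
rewrite preimage_setT; apply: circle_integrable (fun p => phi (cinv h p)) _ => p.
by apply: (@continuous_comp _ _ _ (cinv h) phi); [exact: cK|exact: cphi].
Qed.

Lemma integral_tilde_state (phi : circle R -> R) : continuous phi ->
  (\int[tilde_measure h mu]_p (phi p)%:E)%E =
  (tilde_state h mu (fun x => phi (circle_proj x)))%:E.
Proof.
move=> cphi; rewrite -integral_tilde_measure// tilde_state_circle /Rintegral fineK//.
have [_ _ cK] := bijective_cinv sh.
apply: integrable_fin_num => //; apply: (circle_integrable mu (phi := fun p => phi (cinv h p))) => p.
by apply: (@continuous_comp _ _ _ (cinv h) phi); [exact: cK|exact: cphi].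
Qed.

End tilde_measures.

(** The lift [rlift f] is an arbitrary choice, so its translation number equals [alpha] only up to
    an integer. *)
Lemma Malpha_tn {R : realType} (alpha : R) (f : cmap R) : irrational alpha -> Malpha alpha f ->
  exists a, [/\ tn (rlift f) a, irrational a & circle_proj a = circle_proj alpha].
Proof.
move=> ialpha [cf rf]; have [a fa] := tn_exists (closure_diffeo_monotone cf (rliftP f)).
exists a; move: rf; rewrite (rotation_numberE (rliftP f) fa) => ra; split=> //.
by have /circle_proj_eqP[m ->] := ra; exact: irrationalDint.
Qed.

Theorem theorem20 (R : realType) (alpha : R) (halpha : irrational alpha) :
  (forall f0 : cmap R, Malpha_star alpha f0 ->
    exists mu : probability (circle R) R,
      [/\ minus_one_measure f0 mu,
          (forall nu : probability (circle R) R, minus_one_measure f0 nu ->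
             forall A : set (circle R), measurable A -> nu A = mu A),
          (exists T : set (vfield R), frechet_tangent alpha f0 T) &
          (forall T : set (vfield R), frechet_tangent alpha f0 T ->
             forall v : vfield R, T v <-> \int[mu]_x v (cinv f0 x) = 0)])
  /\
  (forall (g_ : nat -> cmap R) (g : cmap R)
      (mu_ : nat -> probability (circle R) R) (mu : probability (circle R) R),
    (forall n, Malpha_star alpha (g_ n)) -> Malpha_star alpha g ->
    (forall n, minus_one_measure (g_ n) (mu_ n)) -> minus_one_measure g mu ->
    g_ n @[n --> \oo] --> g ->
    weakly_cvg (fun n => tilde_measure (g_ n) (mu_ n)) (tilde_measure g mu))
  /\
  (forall (h : cmap R) (mu : probability (circle R) R),
    Malpha_star alpha h -> minus_one_measure h mu ->
    forall v : circle R -> R, continuous v ->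
      (\int[mu]_x (v (cinv h x))%:E = \int[tilde_measure h mu]_x (v x)%:E)%E).
Proof.
split; [|split].
- move=> f0 [Mf sf]; have [cf _] := Mf.
  have [a [fa ia aE]] := Malpha_tn halpha Mf.
  have fm := closure_diffeo_monotone cf (rliftP f0).
  have [mu hmu] := minus_one_exists sf fm fa ia; exists mu; split=> //.
  + by move=> nu hnu A mA; exact: (minus_one_unique sf fm fa ia hnu hmu mA).
  + exact: (frechet_tangent_exists sf cf fa ia aE hmu).
  + exact: (frechet_tangentP sf cf fa ia aE hmu).
- move=> g_ g mu_ mu sg_ [Mg sg] hmu_ hmu gg phi cphi; have [cg _] := Mg.
  have [a [ga ia _]] := Malpha_tn halpha Mg.
  rewrite (integral_tilde_state mu sg cphi).
  rewrite (_ : (fun n => _) = fun n => (tilde_state (g_ n) (mu_ n) (fun x => phi (circle_proj x)))%:E); last first.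
    by apply/funext => n; rewrite integral_tilde_state//; have [] := sg_ n.
  apply: cvg_EFin; first exact: nearW.
  apply/cvgrPdist_le => e e0.
  have [d d0 hd] := tilde_state_continuous sg cg ga ia hmu (cper_circle cphi) e0.
  have gd : \forall n \near \oo, ball g d (g_ n) by exact: cvg_ball gg _ d0.
  near=> n.
  have [v vd gE] : cmap_ball g d (g_ n) by near: n; exact: gd.
  have [_ sn] := sg_ n; have := hmu_ n; move: sn; rewrite gE => sn hn.
  by rewrite [(fine \o _) n]/= gE; exact: hd.
- by move=> h mu [_ sh] _ v cv; exact: integral_tilde_measure.
Unshelve. all: by end_near. Qed.
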